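(* For positive integers $n$, let $a_n=[z^n]f_0(z)$ and $b_n=[z^n]f_1(z)$, where $f_0(z)=e^{z/(1-z)}$ and $f_1(z)=e^{x}E_1(x)$ with $x=1/(1-z)$. Then, as $n\to\infty$, $$a_n \sim \frac{e^{2\sqrt{n}}}{2n^{3/4}\sqrt{\pi e}}\sum_{m\ge 0} c_m n^{-m/2}$$ and $$b_n \sim -\,\frac{\sqrt{\pi e}}{n^{3/4}e^{2\sqrt{n}}}\sum_{m\ge 0} (-1)^m c_m n^{-m/2},$$ where $$c_m = (-1)^m\sum_{j=0}^m \,\bigl([h^{m-j}]\exp(\mu(h))\bigr)\,\frac{(m-2j+3/2)_{2j}}{4^j\, j!}$$ and $$\mu(h) = h^{-1} - (e^h-1)^{-1} - \tfrac12.$$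
   Context: $E_1(x):=\int_x^\infty \frac{e^{-t}}{t}\,dt$ is the exponential integral (principal branch; for $|z|<1$ the point $x=1/(1-z)$ lies in the right half-plane). Both $f_0$ and $f_1$ are analytic in the open unit disk, and $[z^n]f(z)$ denotes the coefficient of $z^n$ in the Maclaurin series of $f$; likewise $[h^n]$ for series in $h$. The function $\mu(h)$ has a removable singularity at $h=0$, with $\mu(h)=-\frac{h}{12}+\frac{h^3}{720}-O(h^5)$, so $\exp(\mu(h))$ has a Maclaurin expansion. $(x)_\ell:=x(x+1)\cdots(x+\ell-1)$ is the ascending factorial (Pochhammer symbol), $(x)_0=1$. The symbol $\sim$ denotes an asymptotic series in the sense of Poincaré: $u_n\sim g(n)\sum_{m\ge0}s_m n^{-m/2}$ means that for every fixed $N>0$, $u_n/g(n)=\sum_{m=0}^{N-1}s_m n^{-m/2}+O(n^{-N/2})$ as $n\to\infty$. *)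

(* Defs.v *)
From Stdlib Require Import Reals Factorial.
From Coquelicot Require Import Coquelicot.
Open Scope R_scope.

(* The coefficient [z^n] f as f^(n)(0)/n!.  [C_derive] is total; it agrees with
   the complex derivative wherever that exists ([is_C_derive_unique]). *)
Definition C_maclaurin (f : C -> C) (n : nat) : C :=
  (Nat.iter n C_derive f (RtoC 0) / RtoC (INR (fact n)))%C.

Definition R_maclaurin (f : R -> R) (n : nat) : R :=
  Derive_n f n 0 / INR (fact n).

Definition Cexp (z : C) : C :=
  (exp (Re z) * cos (Im z), exp (Re z) * sin (Im z)).

(* The contour from z to infinity is the horizontal ray t = z + s, s >= 0.  For
   z off the cut (-oo, 0] the ray avoids the cut, so this is the principal
   branch; for real z > 0 it is the integral of exp(-t)/t over [z, +oo). *)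
Definition E1_integrand (z : C) (s : R) : C :=
  (Cexp (- (z + RtoC s)) / (z + RtoC s))%C.

Definition E1 (z : C) : C :=
  (RInt_gen (fun s => Re (E1_integrand z s)) (at_point 0) (Rbar_locally p_infty),
   RInt_gen (fun s => Im (E1_integrand z s)) (at_point 0) (Rbar_locally p_infty)).

Definition f0 (z : C) : C := Cexp (z / (RtoC 1 - z))%C.

Definition f1 (z : C) : C :=
  let x := (RtoC 1 / (RtoC 1 - z))%C in (Cexp x * E1 x)%C.

(* The value at 0 fills the removable singularity. *)
Definition mu (h : R) : R :=
  if Req_EM_T h 0 then 0 else / h - / (exp h - 1) - 1 / 2.

(* Ascending factorial x (x + 1) ... (x + l - 1). *)
Fixpoint poch (x : R) (l : nat) : R :=
  match l with
  | O => 1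
  | S k => poch x k * (x + INR k)
  end.

Definition c (m : nat) : R :=
  (-1) ^ m *
  sum_f_R0 (fun j =>
    R_maclaurin (fun h => exp (mu h)) (m - j)
    * (poch (INR m - 2 * INR j + 3 / 2) (2 * j) / (4 ^ j * INR (fact j)))) m.

(* Poincare expansion u_n ~ g(n) * sum_(m >= 0) s_m n^(-m/2).  For N > 0,
   [sum_f_R0 _ (N - 1)] has the N terms m = 0, ..., N - 1. *)
Definition poincare_sim (u : nat -> C) (g : nat -> R) (s : nat -> R) : Prop :=
  forall N : nat, (0 < N)%nat ->
  exists K : R, eventually (fun n : nat =>
    Cmod (u n / RtoC (g n)
          - RtoC (sum_f_R0 (fun m => s m * Rpower (INR n) (- (INR m / 2))) (N - 1)%nat)%R)%C
    <= K * Rpower (INR n) (- (INR N / 2))).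

(* Main.v *)
Require Import Defs.
From Stdlib Require Import Reals.
From Coquelicot Require Import Coquelicot.
From Stdlib Require Import Factorial Lra Lia.
Open Scope R_scope.

(** The two sequences are linked by a three-term recurrence, and the theorem follows from
    Laplace's method for [b_n] together with a duality argument for [a_n].

    _The coefficients._  Both functions satisfy a linear differential equation
    [(1 - z)^2 f' = f - kappa (1 - z)] in the unit disk, with [kappa = 0] for [f0] and
    [kappa = 1] for [f1] ([disk_ode_f0], [disk_ode_f1]; for [f1] this needs the derivative
    of [E1], [qderiv_E1]).  Hence [f0] and [f1] have derivatives of all orders there, and
    for [n >= 1] both sequences satisfy [(n + 2) y_(n + 2) = (2 n + 3) y_(n + 1) - n y_n]
    ([C_maclaurin_ode]).  Integration by parts shows that [- b_n] is
    [beta n = int_0^oo exp (- n h - 1 / (exp h - 1)) dh] ([C_maclaurin_f1]).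

    _The expansion of [b_n]._  By definition of [mu], the integrand of [beta n] is
    [sqrt e * exp (mu h) * exp (- n h - 1 / h)].  The Taylor expansion of [exp (mu h)] has
    an error [O (h^N)] on the whole half-line ([exp_mu_taylor]), so it may be integrated
    term by term.  The integral of [h^k exp (- n h - 1 / h)] is a Bessel function
    [K_(k + 1) (2 sqrt n)] up to elementary factors.  A substitution that makes the exponent
    exactly quadratic turns it into a Gaussian integral of
    [exp (2 (k + 1) arsinh w) / sqrt (1 + w^2)]; the differential equation of that function
    yields its Taylor coefficients, and with the Gaussian moments they give the Pochhammer
    symbols ([bessel_expansion]).  Collecting powers of [1 / sqrt n] gives the coefficients
    [(-1)^m c m] ([beta_asym]).

    _The expansion of [a_n]._  Truncate the expansion of [b_n], and change [sqrt n] into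
    [- sqrt n] in it.  Applying the recurrence to either truncation gives, up to the leading
    factor, one smooth function [residual] evaluated at [- 1 / sqrt n] or at [1 / sqrt n].  It is small on the first side, because [b_n] is an
    exact solution; so its low Taylor coefficients vanish, and it is small on the other side
    too ([bigO_smooth_reflect], [bigO_residual]).  The truncated series for [a_n] thus nearly
    solves the recurrence.  For two solutions [u], [v], the Casoratian
    [n (n + 1) (u_(n + 1) v_n - u_n v_(n + 1))] is constant.  For [a_n] and [beta n] it
    equals 1, and for the truncated series and [beta n] it is nearly constant, with a limit
    that can be computed from the leading terms.  Comparing the two gives both the leading
    constant and the expansion of [a_n], because [a_n] is the dominant solution
    ([a_asym]). *)

Local Notation RN := R_NormedModule.
Local Notation RCN := R_CompleteNormedModule.
Local Notation at_oo := (Rbar_locally p_infty).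
Local Notation at_moo := (Rbar_locally m_infty).

(** * Finite sums and smooth functions *)

(** Sums over [i < n], so that a Taylor polynomial of order [0] is the empty sum. *)
Fixpoint psum (u : nat -> R) (n : nat) : R :=
  match n with O => 0 | S k => psum u k + u k end.

Lemma psum_ext u v n : (forall i, (i < n)%nat -> u i = v i) -> psum u n = psum v n.
Proof.
  induction n as [|n IH]; intros H; simpl; [reflexivity|].
  rewrite IH, H; [reflexivity|lia|intros; apply H; lia].
Qed.

Lemma psum_plus u v n : psum (fun i => u i + v i) n = psum u n + psum v n.
Proof. induction n as [|n IH]; simpl; [ring|rewrite IH; ring]. Qed.

Lemma psum_scal a u n : psum (fun i => a * u i) n = a * psum u n.
Proof. induction n as [|n IH]; simpl; [ring|rewrite IH; ring]. Qed.

Lemma psum_zero u n : (forall i, (i < n)%nat -> u i = 0) -> psum u n = 0.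
Proof.
  induction n as [|n IH]; intros H; simpl; [reflexivity|].
  rewrite IH, H; [ring|lia|intros; apply H; lia].
Qed.

Lemma psum_Sl u n : psum u (S n) = u 0%nat + psum (fun i => u (S i)) n.
Proof.
  induction n as [|n IH]; [simpl; ring|].
  change (psum u (S (S n))) with (psum u (S n) + u (S n)).
  rewrite IH; simpl; ring.
Qed.

Lemma sum_f_R0_psum u n : sum_f_R0 u n = psum u (S n).
Proof. induction n as [|n IH]; simpl in *; [ring|rewrite IH; reflexivity]. Qed.

(** Asking for a derivative function at each level, instead of speaking of
    [Derive_n], lets closure under products, compositions and inverses go by induction
    on the order without a Leibniz formula. *)
Fixpoint Cn (n : nat) (f : R -> R) : Prop :=
  match n with
  | O => True
  | S k => exists f' : R -> R, (forall x, is_derive f x (f' x)) /\ Cn k f'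
  end.

Definition smooth (f : R -> R) : Prop := forall n, Cn n f.

Lemma Cn_ext n f g : (forall x, f x = g x) -> Cn n f -> Cn n g.
Proof.
  destruct n as [|n]; simpl; [auto|].
  intros E [f' [D S]]; exists f'; split; [|exact S].
  intros x; apply (is_derive_ext f); auto.
Qed.

Lemma Cn_down n f : Cn (S n) f -> Cn n f.
Proof.
  revert f; induction n as [|n IH]; intros f; [simpl; auto|].
  intros [f' [D S]]; exists f'; split; auto.
Qed.

Lemma Cn_const n a : Cn n (fun _ => a).
Proof.
  revert a; induction n as [|n IH]; intros a; simpl; [auto|].
  exists (fun _ => 0); split; auto.
  intros x; apply (is_derive_const (K := R_AbsRing) (V := RN)).
Qed.

Lemma Cn_id n : Cn n (fun x => x).
Proof.
  destruct n; simpl; auto.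
  exists (fun _ => 1); split; [|apply Cn_const].
  intros x; apply (is_derive_id (K := R_AbsRing)).
Qed.

Lemma Cn_plus n f g : Cn n f -> Cn n g -> Cn n (fun x => f x + g x).
Proof.
  revert f g; induction n as [|n IH]; intros f g; simpl; [auto|].
  intros [f' [Df Sf]] [g' [Dg Sg]].
  exists (fun x => f' x + g' x); split; auto.
  intros x; apply (is_derive_plus (V := RN) f g); auto.
Qed.

Lemma Cn_mult n f g : Cn n f -> Cn n g -> Cn n (fun x => f x * g x).
Proof.
  revert f g; induction n as [|n IH]; intros f g Hf Hg; [simpl; auto|].
  pose proof (Cn_down _ _ Hf) as Kf; pose proof (Cn_down _ _ Hg) as Kg.
  destruct Hf as [f' [Df Sf]]; destruct Hg as [g' [Dg Sg]].
  exists (fun x => f' x * g x + f x * g' x); split.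
  - intros x; apply (is_derive_mult (K := R_AbsRing) f g x); auto.
    intros; apply Rmult_comm.
  - apply Cn_plus; apply IH; auto.
Qed.

Lemma Cn_comp n f g : Cn n f -> Cn n g -> Cn n (fun x => f (g x)).
Proof.
  revert f g; induction n as [|n IH]; intros f g Hf Hg; [simpl; auto|].
  pose proof (Cn_down _ _ Hg) as Kg.
  destruct Hf as [f' [Df Sf]]; destruct Hg as [g' [Dg Sg]].
  exists (fun x => g' x * f' (g x)); split.
  - intros x; apply (is_derive_comp (V := RN) f g); auto.
  - apply Cn_mult; auto.
Qed.

Lemma Cn_inv n g : (forall x, g x <> 0) -> Cn n g -> Cn n (fun x => / g x).
Proof.
  intros N; induction n as [|n IH]; intros Hg; [simpl; auto|].
  pose proof (IH (Cn_down _ _ Hg)) as Ki.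
  destruct Hg as [g' [Dg Sg]].
  exists (fun x => (-1 * g' x) * (/ g x * / g x)); split.
  - intros x. replace (-1 * g' x * (/ g x * / g x)) with (- g' x / g x ^ 2)
      by (field; auto).
    apply is_derive_inv; auto.
  - repeat apply Cn_mult; auto using Cn_const.
Qed.

Lemma Cn_exp n : Cn n exp.
Proof.
  induction n as [|n IH]; simpl; auto.
  exists exp; split; auto. intros x; apply is_derive_exp.
Qed.

Lemma Cn_sqrt n g : (forall x, 0 < g x) -> Cn n g -> Cn n (fun x => sqrt (g x)).
Proof.
  intros N; induction n as [|n IH]; intros Hg; [simpl; auto|].
  pose proof (IH (Cn_down _ _ Hg)) as Ki.
  destruct Hg as [g' [Dg Sg]].
  exists (fun x => g' x * (/ 2 * / sqrt (g x))); split.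
  - intros x. replace (g' x * (/ 2 * / sqrt (g x))) with (g' x / (2 * sqrt (g x))).
    apply is_derive_sqrt; auto.
    field. apply Rgt_not_eq, sqrt_lt_R0, N.
  - apply Cn_mult; auto. apply Cn_mult; auto using Cn_const.
    apply Cn_inv; auto. intros x; apply Rgt_not_eq, sqrt_lt_R0, N.
Qed.

Lemma Cn_ln n g : (forall x, 0 < g x) -> Cn n g -> Cn n (fun x => ln (g x)).
Proof.
  intros N; destruct n as [|n]; intros Hg; [simpl; auto|].
  pose proof (Cn_down _ _ Hg) as Kg.
  destruct Hg as [g' [Dg Sg]].
  exists (fun x => g' x * / g x); split.
  - intros x; apply (is_derive_comp (V := RN) ln g); auto.
    apply is_derive_ln; auto.
  - apply Cn_mult; auto. apply Cn_inv; auto.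
    intros x; apply Rgt_not_eq, N.
Qed.

Lemma smooth_ext f g : (forall x, f x = g x) -> smooth f -> smooth g.
Proof. intros E S n; apply (Cn_ext n f); auto. Qed.

Lemma smooth_const a : smooth (fun _ => a).
Proof. intros n; apply Cn_const. Qed.

Lemma smooth_id : smooth (fun x => x).
Proof. intros n; apply Cn_id. Qed.

Lemma smooth_plus f g : smooth f -> smooth g -> smooth (fun x => f x + g x).
Proof. intros F G n; apply Cn_plus; auto. Qed.

Lemma smooth_mult f g : smooth f -> smooth g -> smooth (fun x => f x * g x).
Proof. intros F G n; apply Cn_mult; auto. Qed.

Lemma smooth_comp f g : smooth f -> smooth g -> smooth (fun x => f (g x)).
Proof. intros F G n; apply Cn_comp; auto. Qed.

Lemma smooth_exp g : smooth g -> smooth (fun x => exp (g x)).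
Proof. intros G n; apply (Cn_comp n exp); auto using Cn_exp. Qed.

Lemma smooth_inv g : (forall x, g x <> 0) -> smooth g -> smooth (fun x => / g x).
Proof. intros N G n; apply Cn_inv; auto. Qed.

Lemma smooth_sqrt g : (forall x, 0 < g x) -> smooth g -> smooth (fun x => sqrt (g x)).
Proof. intros N G n; apply Cn_sqrt; auto. Qed.

Lemma smooth_ln g : (forall x, 0 < g x) -> smooth g -> smooth (fun x => ln (g x)).
Proof. intros N G n; apply Cn_ln; auto. Qed.

Lemma smooth_opp f : smooth f -> smooth (fun x => - f x).
Proof.
  intros F; apply (smooth_ext (fun x => -1 * f x)); [intros; ring|].
  apply smooth_mult; auto using smooth_const.
Qed.

Lemma smooth_minus f g : smooth f -> smooth g -> smooth (fun x => f x - g x).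
Proof. intros F G; apply smooth_plus; auto using smooth_opp. Qed.

Lemma smooth_div f g : (forall x, g x <> 0) -> smooth f -> smooth g ->
  smooth (fun x => f x / g x).
Proof. intros N F G; apply smooth_mult; auto using smooth_inv. Qed.

Lemma smooth_pow f k : smooth f -> smooth (fun x => f x ^ k).
Proof.
  intros F; induction k as [|k IH]; simpl; auto using smooth_const, smooth_mult.
Qed.

Lemma smooth_psum (f : nat -> R -> R) n : (forall i, smooth (f i)) ->
  smooth (fun x => psum (fun i => f i x) n).
Proof.
  intros F; induction n as [|n IH]; simpl; auto using smooth_const, smooth_plus.
Qed.

Lemma smooth_PSeries (a : nat -> R) : CV_radius a = p_infty -> smooth (PSeries a).
Proof.
  intros H n; revert a H; induction n as [|n IH]; intros a H; simpl; auto.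
  exists (PSeries (PS_derive a)); split.
  - intros x; apply is_derive_PSeries; rewrite H; exact I.
  - apply IH; rewrite <- CV_radius_derive in H; exact H.
Qed.

Lemma is_derive_smooth f x : smooth f -> is_derive f x (Derive f x).
Proof.
  intros F; apply Derive_correct.
  destruct (F 1%nat) as [f' [D _]]; exists (f' x); apply D.
Qed.

Lemma smooth_Derive f : smooth f -> smooth (Derive f).
Proof.
  intros F n; destruct (F (S n)) as [f' [D S]].
  apply (Cn_ext n f'); auto.
  intros x; symmetry; apply is_derive_unique; auto.
Qed.

Lemma smooth_Derive_n f k : smooth f -> smooth (Derive_n f k).
Proof. intros F; induction k as [|k IH]; simpl; auto using smooth_Derive. Qed.

Lemma smooth_continuous f x : smooth f -> continuous f x.
Proof.
  intros F; apply (ex_derive_continuous (V := RN)).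
  exists (Derive f x); apply is_derive_smooth; auto.
Qed.

Lemma R_maclaurin_Derive f i :
  R_maclaurin (Derive f) i = R_maclaurin f (S i) * INR (S i).
Proof.
  unfold R_maclaurin.
  change (Derive_n (Derive f) i 0) with (Derive_n (Derive_n f 1) i 0).
  rewrite Derive_n_comp, Nat.add_1_r.
  rewrite fact_simpl, mult_INR; field; split; [apply INR_fact_neq_0|].
  apply not_0_INR; discriminate.
Qed.

Lemma is_derive_psum_pow (u : nat -> R) n x :
  is_derive (fun x => psum (fun i => u i * x ^ i) (S n)) x
            (psum (fun i => u (S i) * INR (S i) * x ^ i) n).
Proof.
  induction n as [|n IH].
  - simpl. auto_derive; auto.
  - change (is_derive (fun x => psum (fun i => u i * x ^ i) (S n) + u (S n) * x ^ S n) x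
      (psum (fun i => u (S i) * INR (S i) * x ^ i) n + u (S n) * INR (S n) * x ^ n)).
    apply (is_derive_plus (V := RN)); auto.
    auto_derive; auto. change (Nat.pred (S n)) with n. change (match n with O => 1 | S _ => INR n + 1 end) with (INR (S n)). ring.
Qed.

(** By the mean value theorem the remainder of [f] is at most [|x|] times a bound for its
    derivative, and that derivative is the remainder of [f'] at the previous order. *)
Lemma taylor_near_0 f N : smooth f -> exists K, 0 <= K /\ forall x, Rabs x <= 1 ->
  Rabs (f x - psum (fun i => R_maclaurin f i * x ^ i) N) <= K * Rabs x ^ N.
Proof.
  revert f; induction N as [|N IH]; intros f F.
  - destruct (continuity_ab_maj (fun x => Rabs (f x)) (-1) 1) as [M [HM _]]; [lra| |].
    + intros c _. apply continuity_pt_filterlim.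
      apply (continuous_comp f Rabs); [apply smooth_continuous; auto|].
      apply continuous_Rabs.
    + exists (Rabs (f M)); split; [apply Rabs_pos|].
      intros x Hx. apply Rabs_le_between in Hx.
      simpl. rewrite Rminus_0_r, Rmult_1_r. apply HM; lra.
  - destruct (IH (Derive f) (smooth_Derive f F)) as [K [K0 HK]].
    exists K; split; auto. intros x Hx.
    set (r := fun x => f x - psum (fun i => R_maclaurin f i * x ^ i) (S N)).
    set (r' := fun x => Derive f x - psum (fun i => R_maclaurin (Derive f) i * x ^ i) N).
    assert (D : forall x, is_derive r x (r' x)).
    { intros y. apply (is_derive_minus (V := RN)); [apply is_derive_smooth; auto|].
      replace (psum (fun i => R_maclaurin (Derive f) i * y ^ i) N)
        with (psum (fun i => R_maclaurin f (S i) * INR (S i) * y ^ i) N).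
      apply is_derive_psum_pow.
      apply psum_ext; intros; rewrite R_maclaurin_Derive; reflexivity. }
    assert (r0 : r 0 = 0).
    { unfold r. rewrite psum_Sl, psum_zero.
      - unfold R_maclaurin; simpl; field.
      - intros; simpl; ring. }
    destruct (MVT_gen r 0 x r') as [c [Hc E]].
    { intros; apply D. }
    { intros y _. apply continuity_pt_filterlim.
      apply (ex_derive_continuous (V := RN)); exists (r' y); auto. }
    rewrite r0, !Rminus_0_r in E. fold (r x). rewrite E, Rabs_mult.
    assert (Hcx : Rabs c <= Rabs x).
    { unfold Rmin, Rmax in Hc. destruct (Rle_dec 0 x).
      - rewrite !Rabs_pos_eq; lra.
      - rewrite !Rabs_left1; lra. }
    assert (H1 := HK c ltac:(lra)).
    simpl pow. rewrite (Rmult_comm (Rabs x)), <- Rmult_assoc.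
    apply Rmult_le_compat_r; [apply Rabs_pos|].
    apply (Rle_trans _ _ _ H1). apply Rmult_le_compat_l; auto.
    apply pow_incr; split; auto using Rabs_pos.
Qed.

Lemma psum_pow_bound (u : nat -> R) N : exists K, 0 <= K /\ forall x, 1 <= Rabs x ->
  Rabs (psum (fun i => u i * x ^ i) N) <= K * Rabs x ^ N.
Proof.
  induction N as [|N [K [K0 IH]]].
  - exists 0; split; [lra|]. intros; simpl; rewrite Rabs_R0; lra.
  - exists (K + Rabs (u N)); split; [pose proof (Rabs_pos (u N)); lra|].
    intros x Hx. simpl psum. eapply Rle_trans; [apply Rabs_triang|].
    rewrite Rabs_mult, <- RPow_abs. simpl pow.
    specialize (IH x Hx).
    pose proof (pow_R1_Rle (Rabs x) N Hx) as H1.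
    pose proof (Rabs_pos (u N)) as H2.
    assert (Rabs x ^ N <= Rabs x * Rabs x ^ N) by nra.
    nra.
Qed.

(** Away from 0 the function and its Taylor polynomial are separately dominated by
    [|x|^N].  With a global bound, a Taylor expansion can be integrated term by term over
    an infinite interval, and no tail has to be estimated. *)
Lemma taylor_global f N (P : R -> Prop) C : smooth f -> 0 <= C ->
  (forall x, P x -> 1 <= Rabs x -> Rabs (f x) <= C * Rabs x ^ N) ->
  exists K, 0 <= K /\ forall x, P x ->
    Rabs (f x - psum (fun i => R_maclaurin f i * x ^ i) N) <= K * Rabs x ^ N.
Proof.
  intros F C0 H.
  destruct (taylor_near_0 f N F) as [K1 [K10 H1]].
  destruct (psum_pow_bound (R_maclaurin f) N) as [K2 [K20 H2]].
  exists (K1 + (C + K2)); split; [lra|]. intros x Px.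
  pose proof (pow_le (Rabs x) N (Rabs_pos x)) as Q.
  destruct (Rle_dec (Rabs x) 1) as [L|L].
  - specialize (H1 x L). nra.
  - specialize (H x Px ltac:(lra)); specialize (H2 x ltac:(lra)).
    unfold Rminus. eapply Rle_trans; [apply Rabs_triang|]. rewrite Rabs_Ropp. nra.
Qed.

Lemma pow_unit_le_1 x n : 0 <= x <= 1 -> x ^ n <= 1.
Proof. intros H; rewrite <- (pow1 n); apply pow_incr; auto. Qed.

(** * Expansions in powers of 1 / sqrt n *)

(** The expansions are in powers of [x = 1 / sqrt n]: functions of [n] are seen as
    functions of [x] that extend smoothly to negative [x]. *)
Definition rsqrt (n : nat) : R := / sqrt (INR n).

Lemma sqrt_INR_ge1 n : (0 < n)%nat -> 1 <= sqrt (INR n).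
Proof.
  intros H. rewrite <- sqrt_1. apply sqrt_le_1_alt.
  replace 1 with (INR 1) by reflexivity. apply le_INR; lia.
Qed.

Lemma rsqrt_bounds n : (0 < n)%nat -> 0 < rsqrt n <= 1.
Proof.
  intros H; pose proof (sqrt_INR_ge1 n H). unfold rsqrt. split.
  - apply Rinv_0_lt_compat; lra.
  - rewrite <- Rinv_1. apply Rinv_le_contravar; lra.
Qed.

Lemma rsqrt_lim : is_lim_seq rsqrt 0.
Proof.
  apply (is_lim_seq_inv (fun n => sqrt (INR n)) p_infty); [|discriminate].
  apply (filterlim_comp _ _ _ INR sqrt _ at_oo).
  - apply is_lim_seq_INR.
  - apply filterlim_sqrt_p.
Qed.

Lemma rsqrt_small d : 0 < d -> eventually (fun n => 0 < rsqrt n <= 1 /\ rsqrt n < d).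
Proof.
  intros H. pose proof (proj2 (is_lim_seq_spec _ _) rsqrt_lim (mkposreal d H)) as [n0 Hn].
  exists (S n0); intros n L. pose proof (rsqrt_bounds n ltac:(lia)).
  split; auto. specialize (Hn n ltac:(lia)). simpl in Hn.
  rewrite Rminus_0_r in Hn. apply Rabs_def2 in Hn; lra.
Qed.

Definition bigO (u : nat -> R) (N : nat) : Prop :=
  exists K, 0 <= K /\ eventually (fun n => Rabs (u n) <= K * rsqrt n ^ N).

Lemma eventually_pos : eventually (fun n => (0 < n)%nat).
Proof. exists 1%nat; intros; lia. Qed.

Lemma bigO_ext u v N : eventually (fun n => u n = v n) -> bigO u N -> bigO v N.
Proof.
  intros E [K [K0 H]]; exists K; split; auto.
  eapply filter_imp; [|apply filter_and; [apply E|apply H]].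
  intros n [e h]; rewrite <- e; auto.
Qed.

Lemma bigO_plus u v N : bigO u N -> bigO v N -> bigO (fun n => u n + v n) N.
Proof.
  intros [K [K0 H]] [L [L0 G]]; exists (K + L); split; [lra|].
  eapply filter_imp; [|apply filter_and; [apply G|apply H]].
  intros n [g h]. eapply Rle_trans; [apply Rabs_triang|]. lra.
Qed.

Lemma bigO_mult u v N M : bigO u N -> bigO v M -> bigO (fun n => u n * v n) (N + M).
Proof.
  intros [K [K0 H]] [L [L0 G]]; exists (K * L); split; [nra|].
  eapply filter_imp; [|apply filter_and; [apply G|apply H]].
  intros n [g h]. rewrite Rabs_mult, pow_add.
  replace (K * L * (rsqrt n ^ N * rsqrt n ^ M)) with ((K * rsqrt n ^ N) * (L * rsqrt n ^ M)) by ring.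
  apply Rmult_le_compat; auto using Rabs_pos.
Qed.

Lemma bigO_const a : bigO (fun _ => a) 0.
Proof.
  exists (Rabs a); split; [apply Rabs_pos|]. exists 0%nat; intros; simpl; lra.
Qed.

Lemma bigO_scal a u N : bigO u N -> bigO (fun n => a * u n) N.
Proof. intros H; apply (bigO_mult (fun _ => a) u 0 N); auto using bigO_const. Qed.

Lemma bigO_opp u N : bigO u N -> bigO (fun n => - u n) N.
Proof.
  intros H. apply (bigO_ext (fun n => -1 * u n)).
  exists 0%nat; intros; ring. apply bigO_scal; auto.
Qed.

Lemma bigO_minus u v N : bigO u N -> bigO v N -> bigO (fun n => u n - v n) N.
Proof. intros; apply bigO_plus; auto using bigO_opp. Qed.

Lemma bigO_pow N : bigO (fun n => rsqrt n ^ N) N.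
Proof.
  exists 1; split; [lra|].
  eapply filter_imp; [|apply eventually_pos]. intros n Hn.
  rewrite Rabs_pos_eq; [lra|]. apply pow_le, Rlt_le, rsqrt_bounds; auto.
Qed.

Lemma bigO_le u N M : (N <= M)%nat -> bigO u M -> bigO u N.
Proof.
  intros L [K [K0 H]]; exists K; split; auto.
  eapply filter_imp; [|apply filter_and; [apply H|apply eventually_pos]].
  intros n [h Hn]. apply (Rle_trans _ _ _ h). apply Rmult_le_compat_l; auto.
  pose proof (rsqrt_bounds n Hn).
  replace M with (N + (M - N))%nat by lia. rewrite pow_add.
  assert (rsqrt n ^ (M - N) <= 1) by (rewrite <- (pow1 (M - N)); apply pow_incr; lra).
  pose proof (pow_le (rsqrt n) N ltac:(lra)). nra.
Qed.

Lemma bigO_psum (u : nat -> nat -> R) K N : (forall i, (i < K)%nat -> bigO (u i) N) ->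
  bigO (fun n => psum (fun i => u i n) K) N.
Proof.
  induction K as [|K IH]; intros H; simpl.
  - exists 0; split; [lra|].
    exists 0%nat; intros; rewrite Rabs_R0; lra.
  - apply bigO_plus; auto.
Qed.

Definition asym (u : nat -> R) (s : nat -> R) : Prop :=
  forall N, bigO (fun n => u n - psum (fun m => s m * rsqrt n ^ m) N) N.

Lemma bigO_psum_tail (s : nat -> R) N k :
  bigO (fun n => psum (fun m => s m * rsqrt n ^ m) (N + k)
                 - psum (fun m => s m * rsqrt n ^ m) N) N.
Proof.
  induction k as [|k IH].
  - rewrite Nat.add_0_r. exists 0; split; [lra|].
    exists 0%nat; intros. rewrite Rminus_diag, Rabs_R0; lra.
  - rewrite Nat.add_succ_r; simpl psum.
    apply (bigO_ext (fun n => (psum (fun m => s m * rsqrt n ^ m) (N + k)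
       - psum (fun m => s m * rsqrt n ^ m) N) + s (N + k)%nat * rsqrt n ^ (N + k))).
    exists 0%nat; intros; ring.
    apply bigO_plus; auto. apply bigO_scal.
    apply (bigO_le _ _ (N + k)); [lia|apply bigO_pow].
Qed.

(** The terms beyond order [N] are themselves of that order, so an argument that yields
    an error of lower order than the length of the expansion is still good enough. *)
Lemma asym_of_large u s :
  (forall N, exists k, bigO (fun n => u n - psum (fun m => s m * rsqrt n ^ m) (N + k)) N) ->
  asym u s.
Proof.
  intros H N. destruct (H N) as [k Hk].
  apply (bigO_ext (fun n => (u n - psum (fun m => s m * rsqrt n ^ m) (N + k)) +
    (psum (fun m => s m * rsqrt n ^ m) (N + k) - psum (fun m => s m * rsqrt n ^ m) N))).
  exists 0%nat; intros; ring.
  apply bigO_plus; auto using bigO_psum_tail.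
Qed.

Lemma bigO_smooth f N : smooth f ->
  bigO (fun n => f (rsqrt n) - psum (fun i => R_maclaurin f i * rsqrt n ^ i) N) N.
Proof.
  intros F. destruct (taylor_near_0 f N F) as [K [K0 H]].
  exists K; split; auto.
  eapply filter_imp; [|apply eventually_pos]. intros n Hn.
  pose proof (rsqrt_bounds n Hn). specialize (H (rsqrt n)).
  rewrite Rabs_pos_eq in H by lra. apply H; lra.
Qed.

Lemma bigO_const_0 a : bigO (fun _ => a) 1 -> a = 0.
Proof.
  intros [K [K0 H]]. apply Rabs_eq_0. apply Rle_antisym; [|apply Rabs_pos].
  apply le_epsilon; intros e He. rewrite Rplus_0_l.
  assert (D : 0 < e / (K + 1)) by (apply Rdiv_lt_0_compat; lra).
  destruct (filter_and _ _ H (rsqrt_small _ D)) as [n Hn].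
  destruct (Hn n (le_n n)) as [H1 [H2 H3]]. simpl in H1. rewrite Rmult_1_r in H1.
  apply (Rle_trans _ _ _ H1).
  apply (Rmult_lt_compat_r (K + 1)) in H3; [|lra].
  unfold Rdiv in H3; rewrite Rmult_assoc, Rinv_l in H3; nra.
Qed.

Lemma bigO_div_pow u N k : bigO (fun n => u n * rsqrt n ^ k) (N + k) -> bigO u N.
Proof.
  intros [K [K0 H]]; exists K; split; auto.
  eapply filter_imp; [|apply filter_and; [apply H|apply eventually_pos]].
  intros n [h Hn]. pose proof (rsqrt_bounds n Hn).
  assert (P : 0 < rsqrt n ^ k) by (apply pow_lt; lra).
  rewrite pow_add, Rabs_mult, (Rabs_pos_eq (rsqrt n ^ k)) in h by lra.
  apply (Rmult_le_reg_r (rsqrt n ^ k)); auto. lra.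
Qed.

(** Uniqueness of the coefficients: the lowest nonzero term would dominate. *)
Lemma bigO_poly_vanish (s : nat -> R) N :
  bigO (fun n => psum (fun m => s m * rsqrt n ^ m) N) N ->
  forall m, (m < N)%nat -> s m = 0.
Proof.
  induction N as [|N IH]; intros H; [lia|].
  assert (V : forall m, (m < N)%nat -> s m = 0).
  { apply IH. apply (bigO_ext (fun n => psum (fun m => s m * rsqrt n ^ m) (S N)
       - s N * rsqrt n ^ N)).
    exists 0%nat; intros; simpl; ring.
    apply bigO_minus; [apply (bigO_le _ _ (S N)); auto|].
    apply bigO_scal, bigO_pow. }
  intros m Hm. destruct (Nat.eq_dec m N) as [->|]; [|apply V; lia].
  apply bigO_const_0. apply (bigO_div_pow _ 1 N).
  apply (bigO_ext (fun n => psum (fun m => s m * rsqrt n ^ m) (S N))); auto.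
  exists 0%nat; intros. simpl. rewrite psum_zero; [ring|].
  intros; rewrite V; auto; ring.
Qed.

(** Smallness of a smooth function along -1/sqrt n forces its low Taylor
    coefficients at 0 to vanish, and this is insensitive to the sign of the
    argument. *)
Lemma bigO_smooth_reflect F N : smooth F ->
  bigO (fun n => F (- rsqrt n)) N -> bigO (fun n => F (rsqrt n)) N.
Proof.
  intros S H.
  set (G := fun x => F (- x)).
  assert (SG : smooth G) by (apply (smooth_comp F); auto using smooth_opp, smooth_id).
  assert (V : forall i, (i < N)%nat -> R_maclaurin G i = 0).
  { apply bigO_poly_vanish.
    apply (bigO_ext (fun n => G (rsqrt n) - (G (rsqrt n) -
       psum (fun i => R_maclaurin G i * rsqrt n ^ i) N))).
    exists 0%nat; intros; ring.
    apply bigO_minus; auto using bigO_smooth. }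
  destruct (taylor_near_0 G N SG) as [K [K0 T]].
  exists K; split; auto.
  eapply filter_imp; [|apply eventually_pos]. intros n Hn.
  pose proof (rsqrt_bounds n Hn). specialize (T (- rsqrt n)).
  rewrite Rabs_Ropp, (Rabs_pos_eq (rsqrt n)) in T by lra.
  rewrite psum_zero in T by (intros; rewrite V; auto; ring).
  unfold G in T. rewrite Ropp_involutive, Rminus_0_r in T. apply T; lra.
Qed.

(** * Improper integrals *)

Ltac ring_R := unfold plus, minus, opp, scal, mult, zero; simpl; unfold mult; simpl;
  repeat match goal with |- context [@RInt ?V ?f ?a ?b] =>
    let t := fresh in pose (t := (@RInt V f a b : R)); change (@RInt V f a b) with t end;
  match goal with |- @eq _ ?x ?y => change (@eq R x y) end; ring.


(** Half-lines and the whole line are treated alike: [D] is exhausted by segments whose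
    end points follow the filters [Fa] and [Fb], and integrands need to be controlled on [D]
    only. *)
Record spans (D : R -> Prop) (Fa Fb : (R -> Prop) -> Prop) : Prop := {
  spans_convex : forall x y z, D x -> D z -> x <= y <= z -> D y;
  spans_left : Fa D;
  spans_right : Fb D;
  spans_le : filter_prod Fa Fb (fun ab => fst ab <= snd ab) }.

Lemma spans_between D Fa Fb a b x : spans D Fa Fb -> D a -> D b ->
  Rmin a b <= x <= Rmax a b -> D x.
Proof.
  intros S Da Db. unfold Rmin, Rmax. destruct (Rle_dec a b); intros Hx.
  - apply (spans_convex _ _ _ S a x b); auto.
  - apply (spans_convex _ _ _ S b x a); auto.
Qed.

Lemma spans_ends D Fa Fb : spans D Fa Fb ->
  filter_prod Fa Fb (fun ab => D (fst ab) /\ D (snd ab)).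
Proof. intros S; exists D D; auto; apply S. Qed.

Lemma spans_R : spans (fun _ => True) at_moo at_oo.
Proof.
  split; auto.
  - exists 0; auto.
  - exists 0; auto.
  - exists (fun x => x < 0) (fun x => 0 < x).
    exists 0; auto. exists 0; auto. simpl; intros; lra.
Qed.

Lemma spans_pos : spans (fun x => 0 < x) (at_right 0) at_oo.
Proof.
  split.
  - intros; lra.
  - exists (mkposreal 1 Rlt_0_1); auto.
  - exists 0; auto.
  - exists (fun x => x < 1) (fun x => 1 < x).
    + exists (mkposreal 1 Rlt_0_1). intros y Hy _.
      apply Rabs_def2 in Hy. unfold minus, plus, opp in Hy; simpl in Hy. lra.
    + exists 1; auto.
    + simpl; intros; lra.
Qed.

Lemma spans_nonneg : spans (fun x => 0 <= x) (at_point 0) at_oo.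
Proof.
  split.
  - intros; lra.
  - unfold at_point; lra.
  - exists 0; intros; lra.
  - exists (fun x => x = 0) (fun x => 0 < x).
    + reflexivity.
    + exists 0; auto.
    + simpl; intros; lra.
Qed.

Lemma ex_RInt_spans D Fa Fb (f : R -> R) a b : spans D Fa Fb ->
  (forall x, D x -> continuous f x) -> D a -> D b -> ex_RInt f a b.
Proof.
  intros S C Da Db. apply (ex_RInt_continuous (V := RCN)). intros x Hx. apply C.
  apply (spans_between D Fa Fb a b x S Da Db Hx).
Qed.

Lemma is_RInt_gen_FTC D Fa Fb {FFa : Filter Fa} {FFb : Filter Fb} (F f : R -> R) la lb :
  spans D Fa Fb ->
  (forall x, D x -> is_derive F x (f x)) -> (forall x, D x -> continuous f x) ->
  filterlim F Fa (locally la) -> filterlim F Fb (locally lb) ->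
  is_RInt_gen f Fa Fb (lb - la).
Proof.
  intros S HD HC La Lb P HP.
  assert (T : filterlim (fun ab => F (snd ab) - F (fst ab)) (filter_prod Fa Fb)
                (locally (lb - la))).
  { apply (filterlim_comp_2 (F := filter_prod Fa Fb) (G := locally lb) (H := locally (- la))
       (fun ab => F (snd ab)) (fun ab => - F (fst ab)) Rplus).
    - apply (filterlim_comp _ _ _ snd F _ Fb); auto using filterlim_snd.
    - apply (filterlim_comp _ _ _ (fun ab => F (fst ab)) Ropp _ (locally la)).
      + apply (filterlim_comp _ _ _ fst F _ Fa); auto using filterlim_fst.
      + apply (filterlim_opp (V := RN)).
    - apply (filterlim_plus (V := RN)). }
  specialize (T P HP). unfold filtermapi.
  pose proof (spans_ends D Fa Fb S) as DD.
  eapply filter_imp; [|apply filter_and; [apply T|apply DD]].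
  intros [a b] [Hp [Da Db]]; simpl in *. exists (F b - F a); split; auto.
  apply (is_RInt_derive F f); intros x Hx; pose proof (spans_between _ _ _ _ _ _ S Da Db Hx); auto.
Qed.

(** Only convergence of the integral of [g] is assumed; convergence on the other side comes
    with the substitution. *)
Lemma is_RInt_gen_comp D Fa Fb E Ga Gb {FFa : Filter Fa} {FFb : Filter Fb}
    {FGa : ProperFilter Ga} {FGb : ProperFilter Gb}
    (g phi phi' : R -> R) l :
  spans D Fa Fb -> spans E Ga Gb ->
  (forall x, D x -> E (phi x)) ->
  (forall x, D x -> is_derive phi x (phi' x)) -> (forall x, D x -> continuous phi' x) ->
  (forall x, E x -> continuous g x) ->
  filterlim phi Fa Ga -> filterlim phi Fb Gb ->
  is_RInt_gen g Ga Gb l ->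
  is_RInt_gen (fun x => phi' x * g (phi x)) Fa Fb l.
Proof.
  intros S T DE HD HC Hg La Lb I P HP.
  specialize (I P HP). destruct I as [Q R HQ HR I].
  pose proof (spans_ends D Fa Fb S) as DD.
  assert (QR : filter_prod Fa Fb (fun ab => Q (phi (fst ab)) /\ R (phi (snd ab)))).
  { exists (fun a => Q (phi a)) (fun b => R (phi b));
      [exact (La Q HQ)|exact (Lb R HR)|auto]. }
  unfold filtermapi.
  eapply filter_imp; [|apply filter_and; [apply QR|apply DD]].
  intros [a b] [[Ha Hb] [Da Db]]; simpl in *.
  destruct (I _ _ Ha Hb) as [y [Iy Py]]. simpl in Iy.
  exists y; split; auto.
  rewrite <- (is_RInt_unique _ _ _ _ Iy).
  apply (is_RInt_comp (V := RCN) g phi phi').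
  - intros x Hx. apply Hg, DE. apply (spans_between _ _ _ _ _ _ S Da Db Hx).
  - intros x Hx. pose proof (spans_between _ _ _ _ _ _ S Da Db Hx). auto.
Qed.

Lemma Rabs_RInt_le D Fa Fb (f g : R -> R) a b : spans D Fa Fb ->
  (forall x, D x -> continuous f x) -> (forall x, D x -> continuous g x) ->
  (forall x, D x -> Rabs (f x) <= g x) -> D a -> D b ->
  Rabs (RInt f a b) <= Rabs (RInt g a b).
Proof.
  intros S Cf Cg H.
  assert (K : forall a b, a <= b -> D a -> D b -> Rabs (RInt f a b) <= Rabs (RInt g a b)).
  { intros x y L Dx Dy.
    eapply Rle_trans; [|apply Rle_abs].
    apply (norm_RInt_le (V := RN) f g x y); auto.
    - intros t Ht. apply H. apply (spans_convex _ _ _ S x t y); auto.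
    - apply (RInt_correct (V := RCN)), (ex_RInt_spans D Fa Fb); auto.
    - apply (RInt_correct (V := RCN)), (ex_RInt_spans D Fa Fb); auto. }
  intros Da Db. destruct (Rle_dec a b) as [L|L]; [apply K; auto|].
  rewrite <- (opp_RInt_swap (V := RCN) f), <- (opp_RInt_swap (V := RCN) g); try (apply (ex_RInt_spans D Fa Fb); auto).
  unfold opp; simpl. rewrite !Rabs_Ropp. apply K; auto; lra.
Qed.

(** Domination gives the Cauchy criterion for the integral of [f] from the
    convergence of the integral of [g]. *)
Lemma ex_RInt_gen_dominated D Fa Fb {FFa : ProperFilter Fa} {FFb : ProperFilter Fb}
    (f g : R -> R) lg :
  spans D Fa Fb ->
  (forall x, D x -> continuous f x) -> (forall x, D x -> continuous g x) ->
  (forall x, D x -> Rabs (f x) <= g x) ->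
  is_RInt_gen g Fa Fb lg -> exists lf, is_RInt_gen f Fa Fb lf.
Proof.
  intros S Cf Cg H I.
  pose proof (ex_RInt_spans D Fa Fb f) as Ef.
  pose proof (ex_RInt_spans D Fa Fb g) as Eg.
  assert (C : exists l, filterlim (fun ab => RInt f (fst ab) (snd ab)) (filter_prod Fa Fb)
                          (locally l)).
  { apply (filterlim_locally_cauchy (U := R_CompleteSpace) (F := filter_prod Fa Fb)).
    intros eps.
    assert (e4 : 0 < eps / 4) by (destruct eps; simpl; lra).
    destruct (I (ball lg (mkposreal _ e4)) (locally_ball _ _)) as [Q W HQ HW K].
    exists (fun ab => (Q (fst ab) /\ D (fst ab)) /\ (W (snd ab) /\ D (snd ab))).
    split.
    { exists (fun a => Q a /\ D a) (fun b => W b /\ D b); auto.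
      - apply filter_and; auto. apply (spans_left _ _ _ S).
      - apply filter_and; auto. apply (spans_right _ _ _ S). }
    assert (K' : forall a b, Q a -> W b -> Rabs (RInt g a b - lg) < eps / 4).
    { intros a b Ha Hb. destruct (K a b Ha Hb) as [y [Iy By]]. simpl in Iy.
      rewrite (is_RInt_unique _ _ _ _ Iy). exact By. }
    intros [a b] [a' b'] [[Qa Da] [Wb Db]] [[Qa' Da'] [Wb' Db']]; simpl in *.
    assert (EE : forall h, (forall x, D x -> continuous h x) ->
       RInt h a' b' = RInt h a' a + RInt h a b + RInt h b b').
    { intros h Ch.
      rewrite <- (RInt_Chasles (V := RCN) h a' a b'),
        <- (RInt_Chasles (V := RCN) h a b b');
        try (apply (ex_RInt_spans D Fa Fb); auto).
      ring_R. }
    assert (EA : RInt g a' a = RInt g a' b - RInt g a b).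
    { rewrite <- (RInt_Chasles (V := RCN) g a' a b);
        try (apply (ex_RInt_spans D Fa Fb); auto). ring_R. }
    assert (EB : RInt g b b' = RInt g a b' - RInt g a b).
    { rewrite <- (RInt_Chasles (V := RCN) g a b b');
        try (apply (ex_RInt_spans D Fa Fb); auto). ring_R. }
    change (Rabs (RInt f a' b' - RInt f a b) < eps).
    rewrite (EE f Cf).
    replace (RInt f a' a + RInt f a b + RInt f b b' - RInt f a b)
      with (RInt f a' a + RInt f b b') by ring.
    pose proof (Rabs_RInt_le D Fa Fb f g a' a S Cf Cg H Da' Da) as B1.
    pose proof (Rabs_RInt_le D Fa Fb f g b b' S Cf Cg H Db Db') as B2.
    rewrite EA in B1; rewrite EB in B2.
    pose proof (K' a b Qa Wb) as K1. pose proof (K' a' b Qa' Wb) as K2.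
    pose proof (K' a b' Qa Wb') as K3.
    apply Rabs_def2 in K1. apply Rabs_def2 in K2. apply Rabs_def2 in K3.
    assert (Rabs (RInt g a' b - RInt g a b) < eps / 2) by (apply Rabs_def1; lra).
    assert (Rabs (RInt g a b' - RInt g a b) < eps / 2) by (apply Rabs_def1; lra).
    eapply Rle_lt_trans; [apply Rabs_triang|]. lra. }
  destruct C as [l Hl]. exists l. intros P HP.
  specialize (Hl P HP). unfold filtermapi.
  pose proof (spans_ends D Fa Fb S) as DD.
  eapply filter_imp; [|apply filter_and; [apply Hl|apply DD]].
  intros [a b] [Hp [Da Db]]; simpl in *. exists (RInt f a b); split; auto.
  apply (RInt_correct (V := RCN)); auto.
Qed.

Lemma Rabs_RInt_gen_le D Fa Fb {FFa : ProperFilter Fa} {FFb : ProperFilter Fb}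
    (f g : R -> R) lf lg :
  spans D Fa Fb -> (forall x, D x -> Rabs (f x) <= g x) ->
  is_RInt_gen f Fa Fb lf -> is_RInt_gen g Fa Fb lg -> Rabs lf <= lg.
Proof.
  intros S H If Ig.
  apply (RInt_gen_norm (V := RCN) (Fa := Fa) (Fb := Fb) f g lf lg); auto.
  - apply (spans_le _ _ _ S).
  - eapply filter_imp; [|apply (spans_ends D Fa Fb S)].
    intros [a b] [Da Db] x Hx; simpl in *. apply H. apply (spans_convex _ _ _ S a x b); auto.
Qed.

Lemma is_RInt_gen_spans_ext D Fa Fb {FFa : Filter Fa} {FFb : Filter Fb} (f g : R -> R) l :
  spans D Fa Fb -> (forall x, D x -> f x = g x) ->
  is_RInt_gen f Fa Fb l -> is_RInt_gen g Fa Fb l.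
Proof.
  intros S H. apply is_RInt_gen_ext.
  eapply filter_imp; [|apply (spans_ends D Fa Fb S)].
  intros [a b] [Da Db] x Hx; simpl in *. apply H.
  apply (spans_between _ _ _ a b x S); auto; lra.
Qed.

Lemma is_RInt_gen_Rplus {Fa Fb : (R -> Prop) -> Prop} {FFa : Filter Fa} {FFb : Filter Fb} (f g : R -> R) lf lg :
  is_RInt_gen f Fa Fb lf -> is_RInt_gen g Fa Fb lg ->
  is_RInt_gen (fun x => f x + g x) Fa Fb (lf + lg).
Proof. apply (is_RInt_gen_plus (V := RN)). Qed.

Lemma is_RInt_gen_Rminus {Fa Fb : (R -> Prop) -> Prop} {FFa : Filter Fa} {FFb : Filter Fb} (f g : R -> R) lf lg :
  is_RInt_gen f Fa Fb lf -> is_RInt_gen g Fa Fb lg ->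
  is_RInt_gen (fun x => f x - g x) Fa Fb (lf - lg).
Proof. apply (is_RInt_gen_minus (V := RN)). Qed.

Lemma is_RInt_gen_Rscal {Fa Fb : (R -> Prop) -> Prop} {FFa : Filter Fa} {FFb : Filter Fb} (f : R -> R) k l :
  is_RInt_gen f Fa Fb l -> is_RInt_gen (fun x => k * f x) Fa Fb (k * l).
Proof. apply (is_RInt_gen_scal (V := RN)). Qed.

Lemma is_RInt_gen_psum Fa Fb {FFa : Filter Fa} {FFb : Filter Fb}
    (f : nat -> R -> R) (l : nat -> R) N :
  (forall i, is_RInt_gen (f i) Fa Fb (l i)) ->
  is_RInt_gen (fun x => psum (fun i => f i x) N) Fa Fb (psum l N).
Proof.
  intros H. induction N as [|N IH].
  - intros P HP. unfold filtermapi. apply filter_forall. intros [a b]; simpl.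
    exists 0; split; [|exact (locally_singleton _ _ HP)].
    pose proof (is_RInt_const (V := RN) a b 0) as C.
    unfold scal in C; simpl in C; unfold mult in C; simpl in C. rewrite Rmult_0_r in C.
    exact C.
  - apply (is_RInt_gen_Rplus (fun x => psum (fun i => f i x) N) (f N)); auto.
Qed.

(** * Gaussian moments *)

Lemma continuous_R_derive (f : R -> R) x l : is_derive f x l -> continuous f x.
Proof. intros H; apply (ex_derive_continuous (V := RN)); exists l; exact H. Qed.

Ltac cont := eapply continuous_R_derive; auto_derive; [|reflexivity].

Ltac ex_RInt_cont := apply (ex_RInt_continuous (V := RCN)); intros; cont; auto; nra.

Lemma exp_INR_mult n t : exp (INR n * t) = exp t ^ n.
Proof.
  induction n as [|n IH].
  - simpl. rewrite Rmult_0_l; apply exp_0.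
  - rewrite S_INR, Rmult_plus_distr_r, exp_plus, IH, Rmult_1_l. simpl; ring.
Qed.

Lemma exp_monotone x y : x <= y -> exp x <= exp y.
Proof. intros [H| ->]; [left; apply exp_increasing; auto|lra]. Qed.

(** From [(1 + y / m)^m <= exp y]. *)
Lemma pow_le_exp m : exists K, 0 <= K /\ forall y, 0 <= y -> y ^ m <= K * exp y.
Proof.
  destruct m as [|m].
  - exists 1; split; [lra|]. intros y Hy; simpl. pose proof (exp_ineq1_le y); lra.
  - exists (INR (S m) ^ S m); split; [apply pow_le, pos_INR|]. intros y Hy.
    assert (P : 0 < INR (S m)) by (apply lt_0_INR; lia).
    replace y with (INR (S m) * (y / INR (S m))) at 1 by (field; lra).
    rewrite Rpow_mult_distr. apply Rmult_le_compat_l; [apply pow_le; lra|].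
    replace (exp y) with (exp (y / INR (S m)) ^ S m).
    + apply pow_incr. split.
      * apply Rdiv_le_0_compat; auto.
      * pose proof (exp_ineq1_le (y / INR (S m))); lra.
    + rewrite <- exp_INR_mult. f_equal. field; lra.
Qed.

Lemma pow_gauss_bounded k : exists K, 0 <= K /\ forall x, Rabs x ^ k * exp (- x ^ 2) <= K.
Proof.
  destruct (pow_le_exp k) as [K [K0 H]].
  exists (1 + K); split; [lra|]. intros x.
  pose proof (Rabs_pos x) as P. pose proof (exp_pos (- x ^ 2)) as E.
  destruct (Rle_dec (Rabs x) 1) as [L|L].
  - assert (Rabs x ^ k <= 1) by (rewrite <- (pow1 k); apply pow_incr; lra).
    assert (exp (- x ^ 2) <= 1) by (rewrite <- exp_0; apply exp_monotone; nra).
    pose proof (pow_le (Rabs x) k P). nra.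
  - specialize (H (x ^ 2) ltac:(nra)).
    assert (Rabs x ^ k <= K * exp (x ^ 2)).
    { eapply Rle_trans; [|apply H]. rewrite <- (pow2_abs x).
      apply pow_incr. split; auto. simpl. nra. }
    assert (exp (x ^ 2) * exp (- x ^ 2) = 1) by (rewrite <- exp_plus, Rplus_opp_r; apply exp_0).
    nra.
Qed.

Lemma pow_gauss_decay k e : 0 < e -> exists M, 0 < M /\ forall x, M < Rabs x ->
  Rabs (x ^ k * exp (- x ^ 2)) < e.
Proof.
  intros He. destruct (pow_gauss_bounded (S k)) as [K [K0 H]].
  assert (0 <= K / e) by (apply Rdiv_le_0_compat; lra).
  exists (K / e + 1); split; [lra|]. intros x Hx.
  specialize (H x). simpl in H.
  rewrite Rabs_mult, <- RPow_abs, (Rabs_pos_eq (exp _)) by (apply Rlt_le, exp_pos).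
  assert (K < e * Rabs x).
  { replace K with (e * (K / e)) by (field; lra). apply Rmult_lt_compat_l; lra. }
  pose proof (Rabs_pos x).
  set (v := Rabs x ^ k * exp (- x ^ 2)) in *.
  assert (Rabs x * v <= K) by (unfold v; simpl; lra).
  apply (Rmult_lt_reg_l (Rabs x)); nra.
Qed.

Lemma lim_pow_gauss k :
  filterlim (fun x => x ^ k * exp (- x ^ 2)) at_moo (locally 0) /\
  filterlim (fun x => x ^ k * exp (- x ^ 2)) at_oo (locally 0).
Proof.
  split; intros P [e He]; destruct (pow_gauss_decay k e (cond_pos e)) as [M [M0 H]].
  - exists (- M). intros x Hx. apply He.
    change (Rabs (x ^ k * exp (- x ^ 2) - 0) < e). rewrite Rminus_0_r. apply H.
    rewrite Rabs_left; lra.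
  - exists M. intros x Hx. apply He.
    change (Rabs (x ^ k * exp (- x ^ 2) - 0) < e). rewrite Rminus_0_r. apply H.
    rewrite Rabs_pos_eq; lra.
Qed.

Definition erf_int (x : R) : R := RInt (fun t => exp (- t ^ 2)) 0 x.

Definition erf_aux (x : R) : R := RInt (fun t => exp (- x ^ 2 * (1 + t ^ 2)) / (1 + t ^ 2)) 0 1.

Lemma is_derive_erf_int x : is_derive erf_int x (exp (- x ^ 2)).
Proof.
  apply (is_derive_RInt (V := RN) (fun t => exp (- t ^ 2)) erf_int 0).
  - apply filter_forall. intros y.
    apply (RInt_correct (V := RCN)).
    ex_RInt_cont.
  - cont; auto.
Qed.

Lemma is_derive_erf_aux x : is_derive erf_aux x (- 2 * exp (- x ^ 2) * erf_int x).
Proof.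
  replace (- 2 * exp (- x ^ 2) * erf_int x)
    with (RInt (fun t => Derive (fun u => exp (- u ^ 2 * (1 + t ^ 2)) / (1 + t ^ 2)) x) 0 1).
  - apply (is_derive_RInt_param (fun u t => exp (- u ^ 2 * (1 + t ^ 2)) / (1 + t ^ 2)) 0 1 x).
    + apply filter_forall. intros y t _. auto_derive. nra.
    + intros t _.
      apply (continuity_2d_pt_ext (fun u v => -2 * u * exp (- u ^ 2 * (1 + v ^ 2)))).
      { intros u v. symmetry. apply is_derive_unique. auto_derive; [nra|].
        simpl. field. nra. }
      apply continuity_2d_pt_filterlim.
      apply (continuous_mult (K := R_AbsRing) (fun z : R * R => -2 * fst z)
        (fun z : R * R => exp (- fst z ^ 2 * (1 + snd z ^ 2)))).
      * apply (continuous_scal_r (K := R_AbsRing) (V := RN) (-2) fst).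
        apply continuous_fst.
      * apply (continuous_comp (fun z : R * R => - fst z ^ 2 * (1 + snd z ^ 2)) exp).
        -- apply (continuous_mult (K := R_AbsRing) (fun z : R * R => - fst z ^ 2)
             (fun z : R * R => 1 + snd z ^ 2)).
           ++ apply (continuous_comp fst (fun u => - u ^ 2)); [apply continuous_fst|cont; auto].
           ++ apply (continuous_comp snd (fun u => 1 + u ^ 2)); [apply continuous_snd|cont; auto].
        -- cont; auto.
    + apply filter_forall. intros y.
      ex_RInt_cont.
  - assert (H : RInt (fun t => x * exp (- (x * t + 0) ^ 2)) 0 1 = erf_int x).
    { apply (eq_trans (y := RInt (fun t => exp (- t ^ 2)) (x * 0 + 0) (x * 1 + 0))).
      - apply (RInt_comp_lin (V := RCN) (fun t => exp (- t ^ 2)) x 0 0 1).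
        ex_RInt_cont.
      - unfold erf_int. f_equal; ring. }
    rewrite <- H.
    rewrite (RInt_ext (V := RCN) _
      (fun t => scal (-2 * exp (- x ^ 2)) (x * exp (- (x * t + 0) ^ 2)))).
    + apply (RInt_scal (V := RCN)).
      ex_RInt_cont.
    + intros t _. apply is_derive_unique. auto_derive; [nra|].
      unfold scal; simpl; unfold mult; simpl.
      replace (- (x * (x * 1)) * (1 + t * (t * 1)))
        with (- (x * (x * 1)) + - ((x * t + 0) * ((x * t + 0) * 1))) by ring.
      rewrite exp_plus. field. nra.
Qed.

(** The two terms have opposite derivatives, and at [x = 0] their sum is the integral of
    [1 / (1 + t^2)] from 0 to 1, that is [PI / 4].  As [erf_aux] tends to 0, this gives the
    value of the Gaussian integral. *)
Lemma erf_int_sqr x : 0 < x -> erf_int x ^ 2 + erf_aux x = PI / 4.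
Proof.
  intros Hx.
  replace (PI / 4) with (erf_int 0 ^ 2 + erf_aux 0).
  - symmetry. apply (eq_is_derive (V := RN) (fun x => erf_int x ^ 2 + erf_aux x)); auto.
    intros t _.
    match goal with |- is_derive _ _ ?z => replace z with
      (plus (INR 2 * exp (- t ^ 2) * erf_int t ^ 1) (- 2 * exp (- t ^ 2) * erf_int t)) end.
    + apply (is_derive_plus (V := RN)); [|apply is_derive_erf_aux].
      apply (is_derive_pow erf_int 2). apply is_derive_erf_int.
    + unfold plus, zero; simpl. ring.
  - unfold erf_int. rewrite (RInt_point (V := RCN)).
    unfold erf_aux. rewrite (RInt_ext (V := RCN) _ (fun t => / (1 + t ^ 2))).
    + rewrite (is_RInt_unique _ _ _ (atan 1 - atan 0)).
      * rewrite atan_1, atan_0. unfold zero; simpl. ring.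
      * apply (is_RInt_derive (V := RCN) atan (fun t => / (1 + t ^ 2))).
        -- intros t _. auto_derive; auto. unfold Rsqr. field. nra.
        -- intros t _. cont. nra.
    + intros t _. replace (- 0 ^ 2 * (1 + t ^ 2)) with 0 by ring. rewrite exp_0. apply Rmult_1_l.
Qed.

Lemma erf_aux_bound x : 0 <= erf_aux x <= exp (- x ^ 2).
Proof.
  assert (E : ex_RInt (fun t => exp (- x ^ 2 * (1 + t ^ 2)) / (1 + t ^ 2)) 0 1).
  { ex_RInt_cont. }
  split.
  - apply RInt_ge_0; auto; [lra|]. intros t _.
    apply Rlt_le, Rdiv_lt_0_compat; [apply exp_pos|nra].
  - replace (exp (- x ^ 2)) with (RInt (fun _ => exp (- x ^ 2)) 0 1).
    + apply RInt_le; auto; [lra|apply ex_RInt_const|]. intros t _.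
      apply Rle_div_l; [nra|].
      assert (exp (- x ^ 2 * (1 + t ^ 2)) <= exp (- x ^ 2)) by (apply exp_monotone; nra).
      pose proof (exp_pos (- x ^ 2)). nra.
    + rewrite RInt_const. unfold scal; simpl; unfold mult; simpl. ring.
Qed.

Lemma erf_int_opp x : erf_int (- x) = - erf_int x.
Proof.
  unfold erf_int.
  pose proof (RInt_comp_lin (V := RCN) (fun t => exp (- t ^ 2)) (-1) 0 0 x) as H.
  replace (-1 * 0 + 0) with 0 in H by ring. replace (-1 * x + 0) with (- x) in H by ring.
  rewrite <- H.
  - rewrite (RInt_ext (V := RCN) _ (fun t => scal (-1) (exp (- t ^ 2)))).
    + rewrite (RInt_scal (V := RCN)).
      * unfold scal; simpl; unfold mult; simpl. ring_R.
      * ex_RInt_cont.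
    + intros t _. f_equal. f_equal. ring.
  - ex_RInt_cont.
Qed.

Lemma erf_int_lim : filterlim erf_int at_oo (locally (sqrt PI / 2)).
Proof.
  pose proof PI_RGT_0 as HPI. pose proof (sqrt_lt_R0 PI HPI) as S0.
  pose proof (sqrt_sqrt PI (Rlt_le _ _ HPI)) as SS.
  destruct (lim_pow_gauss 0) as [_ L].
  intros P [e He].
  assert (e1 : 0 < e * (sqrt PI / 2)) by (apply Rmult_lt_0_compat; [apply cond_pos|lra]).
  destruct (L _ (locally_ball 0 (mkposreal _ e1))) as [M HM].
  exists (Rmax M 0). intros x Hx. apply He.
  pose proof (Rmax_l M 0). pose proof (Rmax_r M 0).
  specialize (HM x ltac:(lra)).
  change (Rabs (x ^ 0 * exp (- x ^ 2) - 0) < e * (sqrt PI / 2)) in HM.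
  simpl pow in HM. rewrite Rmult_1_l, Rminus_0_r in HM. fold (x ^ 2) in HM.
  rewrite Rabs_pos_eq in HM by (apply Rlt_le, exp_pos).
  change (Rabs (erf_int x - sqrt PI / 2) < e).
  pose proof (erf_int_sqr x ltac:(lra)) as Q. pose proof (erf_aux_bound x) as B.
  change (x * (x * 1)) with (x ^ 2) in HM.
  assert (A0 : 0 <= erf_int x).
  { apply RInt_ge_0; [lra| |intros; apply Rlt_le, exp_pos].
    ex_RInt_cont. }
  assert (E : (sqrt PI / 2 - erf_int x) * (sqrt PI / 2 + erf_int x) = erf_aux x) by nra.
  assert (0 <= sqrt PI / 2 - erf_int x) by nra.
  rewrite Rabs_left1 by lra. nra.
Qed.

Lemma gauss_integral :
  is_RInt_gen (fun x => exp (- x ^ 2)) at_moo at_oo (sqrt PI).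
Proof.
  replace (sqrt PI) with (sqrt PI / 2 - - (sqrt PI / 2)) by field.
  apply (is_RInt_gen_FTC _ _ _ erf_int _ _ _ spans_R).
  - intros; apply is_derive_erf_int.
  - intros; cont; auto.
  - apply (filterlim_ext (fun x => - erf_int (- x))).
    { intros x; rewrite erf_int_opp; ring. }
    apply (filterlim_comp _ _ _ (fun x => erf_int (- x)) Ropp _ (locally (sqrt PI / 2))).
    + apply (filterlim_comp _ _ _ Ropp erf_int _ at_oo).
      * apply (filterlim_Rbar_opp m_infty).
      * apply erf_int_lim.
    + apply (filterlim_opp (V := RN)).
  - apply erf_int_lim.
Qed.

Fixpoint gauss_moment (i : nat) : R :=
  match i with
  | O => sqrt PI
  | S O => 0
  | S (S j) => (INR j + 1) / 2 * gauss_moment j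
  end.

(** The integrand is the derivative of [- x^k exp (- x^2) / 2]. *)
Lemma gauss_moment_step k :
  is_RInt_gen (fun x => x ^ S k * exp (- x ^ 2) - INR k / 2 * (x ^ pred k * exp (- x ^ 2)))
    at_moo at_oo 0.
Proof.
  replace 0 with (- / 2 * 0 - - / 2 * 0) by ring.
  destruct (lim_pow_gauss k) as [L1 L2].
  apply (is_RInt_gen_FTC _ _ _ (fun x => - / 2 * (x ^ k * exp (- x ^ 2))) _ _ _ spans_R).
  - intros x _. auto_derive; auto. simpl. field.
  - intros x _. cont; auto.
  - apply (filterlim_comp _ _ _ _ (fun y => - / 2 * y) _ (locally 0)); auto.
    apply (filterlim_scal_r (K := R_AbsRing) (V := RN)).
  - apply (filterlim_comp _ _ _ _ (fun y => - / 2 * y) _ (locally 0)); auto.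
    apply (filterlim_scal_r (K := R_AbsRing) (V := RN)).
Qed.

Lemma gauss_moment_correct i :
  is_RInt_gen (fun x => x ^ i * exp (- x ^ 2)) at_moo at_oo
    (gauss_moment i).
Proof.
  enough (H : forall i,
    is_RInt_gen (fun x => x ^ i * exp (- x ^ 2)) at_moo at_oo
      (gauss_moment i) /\
    is_RInt_gen (fun x => x ^ S i * exp (- x ^ 2)) at_moo at_oo
      (gauss_moment (S i))) by exact (proj1 (H i)).
  clear i; induction i as [|i [IH1 IH2]]; split; try exact IH2.
  - apply (is_RInt_gen_spans_ext _ _ _ (fun x => exp (- x ^ 2)) _ _ spans_R); [|apply gauss_integral].
    intros; simpl; ring.
  - apply (is_RInt_gen_spans_ext _ _ _ _ (fun x => x ^ 1 * exp (- x ^ 2)) _ spans_R)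
      with (2 := gauss_moment_step 0).
    intros x _; change (INR 0) with 0; field.
  - apply (is_RInt_gen_spans_ext _ _ _
      (fun x => (x ^ S (S i) * exp (- x ^ 2) - INR (S i) / 2 * (x ^ pred (S i) * exp (- x ^ 2)))
                + INR (S i) / 2 * (x ^ i * exp (- x ^ 2))) _ _ spans_R).
    + intros x _. simpl. ring.
    + replace (gauss_moment (S (S i))) with (0 + INR (S i) / 2 * gauss_moment i)
        by (rewrite S_INR; simpl; ring).
      apply is_RInt_gen_Rplus; [apply gauss_moment_step|]. apply is_RInt_gen_Rscal; auto.
Qed.

(** * Two smooth functions: exp (mu h) and the arsinh kernel *)

Lemma CV_radius_exp : CV_radius (fun n => / INR (fact n)) = p_infty.
Proof.
  apply CV_radius_infinite_DAlembert.
  - intros n; apply Rinv_neq_0_compat, INR_fact_neq_0.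
  - apply (is_lim_seq_ext (fun n => / INR (S n))).
    + intros n. rewrite Rabs_pos_eq.
      * rewrite fact_simpl, mult_INR. field. split; [apply INR_fact_neq_0|].
        apply not_0_INR; discriminate.
      * apply Rlt_le, Rdiv_lt_0_compat; apply Rinv_0_lt_compat, lt_0_INR, lt_O_fact.
    + apply (is_lim_seq_incr_1 (fun n => / INR n)).
      apply (is_lim_seq_inv INR p_infty); [apply is_lim_seq_INR|discriminate].
Qed.

(** The entire functions [(exp h - 1) / h] and [(exp h - 1 - h) / h^2]. *)
Definition expm1_quot : R -> R := PSeries (PS_decr_1 (fun n => / INR (fact n))).

Definition expm1_quot2 : R -> R := PSeries (PS_decr_1 (PS_decr_1 (fun n => / INR (fact n)))).

Lemma expm1_quot_eq h : exp h = 1 + h * expm1_quot h.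
Proof.
  rewrite exp_Reals, PSeries_decr_1.
  - unfold expm1_quot. simpl. field.
  - exists (exp h); apply is_exp_Reals.
Qed.

Lemma expm1_quot2_eq h : expm1_quot h = 1 + h * expm1_quot2 h.
Proof.
  unfold expm1_quot. rewrite PSeries_decr_1.
  - unfold expm1_quot2, PS_decr_1 at 1. simpl. field.
  - apply CV_radius_inside. rewrite CV_radius_decr_1, CV_radius_exp. exact I.
Qed.

Lemma expm1_quot_neq_0 h : expm1_quot h <> 0.
Proof.
  intros E. pose proof (expm1_quot_eq h) as H. rewrite E, Rmult_0_r, Rplus_0_r in H.
  rewrite <- exp_0 in H. apply exp_inv in H. subst h.
  rewrite expm1_quot2_eq in E. lra.
Qed.

Lemma expm1_quot2_0 : expm1_quot2 0 = 1 / 2.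
Proof. unfold expm1_quot2. rewrite PSeries_0. unfold PS_decr_1. simpl. field. Qed.

(** This removes the singularity of [mu]: the denominator never vanishes, so [mu] is
    smooth on the whole line. *)
Lemma mu_eq h : mu h = expm1_quot2 h / expm1_quot h - 1 / 2.
Proof.
  unfold mu. destruct (Req_EM_T h 0) as [->|N].
  - rewrite (expm1_quot2_eq 0), expm1_quot2_0. rewrite Rmult_0_l. field.
  - pose proof (expm1_quot_neq_0 h) as Q.
    rewrite (expm1_quot_eq h).
    replace (1 + h * expm1_quot h - 1) with (h * expm1_quot h) by ring.
    rewrite (expm1_quot2_eq h) in Q |- *.
    field. auto.
Qed.

Lemma smooth_exp_mu : smooth (fun h => exp (mu h)).
Proof.
  apply smooth_exp. eapply smooth_ext; [intros; symmetry; apply mu_eq|].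
  apply smooth_minus; [|apply smooth_const].
  apply smooth_div; [apply expm1_quot_neq_0| |];
    apply smooth_PSeries; rewrite ?CV_radius_decr_1; apply CV_radius_exp.
Qed.

Lemma exp_gt_1 h : 0 < h -> 1 < exp h.
Proof. intros H; rewrite <- exp_0; apply exp_increasing; auto. Qed.

Lemma exp_mu_taylor N : exists K, 0 <= K /\ forall h, 0 < h ->
  Rabs (exp (mu h) - psum (fun i => R_maclaurin (fun h => exp (mu h)) i * h ^ i) N) <= K * h ^ N.
Proof.
  destruct (taylor_global _ N (fun h => 0 < h) (exp 1) smooth_exp_mu) as [K [K0 H]].
  - apply Rlt_le, exp_pos.
  - intros x Px Hx. rewrite (Rabs_pos_eq x) in * by lra.
    rewrite Rabs_pos_eq by (apply Rlt_le, exp_pos).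
    apply (Rle_trans _ (exp 1)).
    + apply exp_monotone. unfold mu. destruct (Req_EM_T x 0); [lra|].
      assert (0 < / (exp x - 1)) by (apply Rinv_0_lt_compat; pose proof (exp_gt_1 x Px); lra).
      assert (/ x <= 1) by (rewrite <- Rinv_1; apply Rinv_le_contravar; lra).
      lra.
    + pose proof (pow_R1_Rle x N Hx). pose proof (exp_pos 1). nra.
  - exists K; split; auto. intros h Hh. specialize (H h Hh).
    rewrite (Rabs_pos_eq h) in H by lra. exact H.
Qed.

(** This is [exp (2 nu arsinh w) / sqrt (1 + w^2)], the factor in front of the Gaussian
    when the Bessel integral of order [nu] is centred at its saddle point. *)
Definition asinh_ker (nu : nat) (w : R) : R := (w + sqrt (1 + w ^ 2)) ^ (2 * nu) / sqrt (1 + w ^ 2).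

Lemma sqrt_1_sqr_pos w : 0 < sqrt (1 + w ^ 2).
Proof. apply sqrt_lt_R0; nra. Qed.

Lemma smooth_asinh_ker nu : smooth (asinh_ker nu).
Proof.
  assert (S : smooth (fun w => sqrt (1 + w ^ 2))).
  { apply smooth_sqrt; [intros; nra|].
    apply smooth_plus; auto using smooth_const, smooth_pow, smooth_id. }
  apply smooth_div; auto.
  - intros w; apply Rgt_not_eq, sqrt_1_sqr_pos.
  - apply smooth_pow, smooth_plus; auto using smooth_id.
Qed.

Lemma Derive_asinh_ker nu w :
  (1 + w ^ 2) * Derive (asinh_ker nu) w + w * asinh_ker nu w
  = 2 * INR nu * (w + sqrt (1 + w ^ 2)) ^ (2 * nu).
Proof.
  pose proof (sqrt_1_sqr_pos w) as P.
  assert (Q : sqrt (1 + w ^ 2) * sqrt (1 + w ^ 2) = 1 + w ^ 2) by (apply sqrt_sqrt; nra).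
  assert (D : is_derive (asinh_ker nu) w
    ((2 * INR nu * (w + sqrt (1 + w ^ 2)) ^ (2 * nu) - w * asinh_ker nu w) / (1 + w ^ 2))).
  { unfold asinh_ker. auto_derive.
    - split; [simpl; nra|]. split; [simpl; nra|]. split; auto.
      apply Rgt_not_eq. exact P.
    - replace (1 + w * (w * 1)) with (1 + w ^ 2) by (simpl; ring).
      set (s := sqrt (1 + w ^ 2)) in *. change (sqrt (1 + w * (w * 1))) with s.
      rewrite <- Q.
      destruct nu as [|nu].
      + simpl. field. lra.
      + change (S nu + (S nu + 0))%nat with (2 * S nu)%nat. rewrite mult_INR.
        set (p := Nat.pred (2 * S nu)). assert (Hp : (2 * S nu)%nat = S p) by (unfold p; lia).
        rewrite Hp. clearbody p. change (INR 2) with 2. simpl (_ ^ S _). field. lra. }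
  rewrite (is_derive_unique _ _ _ D). field. nra.
Qed.

Lemma is_derive_Derive_n f i x : smooth f -> is_derive (Derive_n f i) x (Derive_n f (S i) x).
Proof. intros S; apply is_derive_smooth, smooth_Derive_n; auto. Qed.

(** With [E = exp (2 nu arsinh w)], the kernel [g = E / sqrt (1 + w^2)] satisfies
    [E' = 2 nu g] and [(1 + w^2) g' + w g = 2 nu E].  Differentiating the second equation
    gives the case [i = 0], and [i] further derivatives give the others.  At [w = 0] they are
    a two-term recurrence for the Taylor coefficients. *)
Lemma ODE_asinh_ker nu i w :
  (1 + w ^ 2) * Derive_n (asinh_ker nu) (S (S i)) w + (2 * INR i + 3) * w * Derive_n (asinh_ker nu) (S i) w
  + ((INR i + 1) ^ 2 - 4 * INR nu ^ 2) * Derive_n (asinh_ker nu) i w = 0.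
Proof.
  revert w; induction i as [|i IH]; intros w.
  - assert (D1 : is_derive (fun w => (1 + w ^ 2) * Derive (asinh_ker nu) w + w * asinh_ker nu w) w
      (2 * w * Derive (asinh_ker nu) w + (1 + w ^ 2) * Derive_n (asinh_ker nu) 2 w + (asinh_ker nu w + w * Derive (asinh_ker nu) w))).
    { apply (is_derive_plus (V := RN)).
      - apply (is_derive_mult (K := R_AbsRing) (fun w => 1 + w ^ 2) (Derive (asinh_ker nu))).
        + auto_derive; auto. simpl; ring.
        + apply (is_derive_Derive_n (asinh_ker nu) 1), smooth_asinh_ker.
        + intros; apply Rmult_comm.
      - replace (asinh_ker nu w + w * Derive (asinh_ker nu) w) with (1 * asinh_ker nu w + w * Derive (asinh_ker nu) w) by ring.
        apply (is_derive_mult (K := R_AbsRing) (fun w => w) (asinh_ker nu)).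
        + apply (is_derive_id (K := R_AbsRing)).
        + apply is_derive_smooth, smooth_asinh_ker.
        + intros; apply Rmult_comm. }
    assert (D2 : is_derive (fun w => (1 + w ^ 2) * Derive (asinh_ker nu) w + w * asinh_ker nu w) w
      (2 * INR nu * (2 * INR nu * asinh_ker nu w))).
    { apply (is_derive_ext (fun w => 2 * INR nu * (w + sqrt (1 + w ^ 2)) ^ (2 * nu))).
      - intros; symmetry; apply Derive_asinh_ker.
      - pose proof (sqrt_1_sqr_pos w) as P.
        unfold asinh_ker. auto_derive.
        + simpl; nra.
        + change (sqrt (1 + w * (w * 1))) with (sqrt (1 + w ^ 2)).
          set (s := sqrt (1 + w ^ 2)) in *.
          destruct nu as [|nu].
          * simpl. field. lra.
          * change (S nu + (S nu + 0))%nat with (2 * S nu)%nat. rewrite mult_INR.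
            set (p := Nat.pred (2 * S nu)). assert (Hp : (2 * S nu)%nat = S p) by (unfold p; lia).
            rewrite Hp. clearbody p. change (INR 2) with 2. simpl (_ ^ S _). field. lra. }
    pose proof (is_derive_unique _ _ _ D1) as E1. pose proof (is_derive_unique _ _ _ D2) as E2.
    rewrite E1 in E2. change (Derive_n (asinh_ker nu) 1 w) with (Derive (asinh_ker nu) w).
    change (Derive_n (asinh_ker nu) 0 w) with (asinh_ker nu w). change (INR 0) with 0. lra.
  - set (L := fun w => (1 + w ^ 2) * Derive_n (asinh_ker nu) (S (S i)) w
      + (2 * INR i + 3) * w * Derive_n (asinh_ker nu) (S i) w
      + ((INR i + 1) ^ 2 - 4 * INR nu ^ 2) * Derive_n (asinh_ker nu) i w).
    assert (D1 : is_derive L w 0).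
    { apply (is_derive_ext (fun _ => 0)); [intros; symmetry; apply IH|].
      apply (is_derive_const (K := R_AbsRing) (V := RN)). }
    pose proof (fun i => is_derive_Derive_n (asinh_ker nu) i w (smooth_asinh_ker nu)) as DG.
    assert (D2 : is_derive L w
      ((2 * w * Derive_n (asinh_ker nu) (S (S i)) w + (1 + w ^ 2) * Derive_n (asinh_ker nu) (S (S (S i))) w)
      + ((2 * INR i + 3) * Derive_n (asinh_ker nu) (S i) w
         + (2 * INR i + 3) * w * Derive_n (asinh_ker nu) (S (S i)) w)
      + ((INR i + 1) ^ 2 - 4 * INR nu ^ 2) * Derive_n (asinh_ker nu) (S i) w)).
    { apply (is_derive_plus (V := RN)); [apply (is_derive_plus (V := RN))|].
      - apply (is_derive_mult (K := R_AbsRing) (fun w => 1 + w ^ 2)); auto.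
        + auto_derive; auto. simpl; ring.
        + intros; apply Rmult_comm.
      - apply (is_derive_mult (K := R_AbsRing) (fun w => (2 * INR i + 3) * w)); auto.
        + auto_derive; auto. ring.
        + intros; apply Rmult_comm.
      - apply (is_derive_scal (Derive_n (asinh_ker nu) i)); auto. }
    pose proof (is_derive_unique _ _ _ D1) as E1. pose proof (is_derive_unique _ _ _ D2) as E2.
    rewrite E1 in E2. rewrite S_INR. rewrite E2. ring.
Qed.

Lemma maclaurin_asinh_ker_0 nu : R_maclaurin (asinh_ker nu) 0 = 1.
Proof.
  unfold R_maclaurin, asinh_ker; simpl. replace (1 + 0 * (0 * 1)) with 1 by ring.
  rewrite sqrt_1, Rplus_0_l, pow1. field.
Qed.

Lemma maclaurin_asinh_ker_SS nu i :
  R_maclaurin (asinh_ker nu) (S (S i)) * ((INR i + 2) * (INR i + 1))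
  = (4 * INR nu ^ 2 - (INR i + 1) ^ 2) * R_maclaurin (asinh_ker nu) i.
Proof.
  pose proof (ODE_asinh_ker nu i 0) as H. unfold R_maclaurin.
  rewrite !fact_simpl, !mult_INR, !S_INR.
  pose proof (pos_INR i). pose proof (INR_fact_neq_0 i).
  replace (Derive_n (asinh_ker nu) (S (S i)) 0) with ((4 * INR nu ^ 2 - (INR i + 1) ^ 2) * Derive_n (asinh_ker nu) i 0).
  - field. repeat split; auto; lra.
  - replace ((1 + 0 ^ 2) * Derive_n (asinh_ker nu) (S (S i)) 0) with (Derive_n (asinh_ker nu) (S (S i)) 0) in H by ring.
    lra.
Qed.

(** The kernel grows like [|w|^(2 nu - 1)], whence the condition on [M]. *)
Lemma asinh_ker_taylor nu M : (nu <= M)%nat -> exists K, 0 <= K /\ forall w,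
  Rabs (asinh_ker nu w - psum (fun i => R_maclaurin (asinh_ker nu) i * w ^ i) (2 * M)) <= K * w ^ (2 * M).
Proof.
  intros L.
  destruct (taylor_global (asinh_ker nu) (2 * M) (fun _ => True) (3 ^ (2 * nu)) (smooth_asinh_ker nu)) as [K [K0 H]].
  - apply pow_le; lra.
  - intros w _ Hw.
    assert (S1 : 1 <= sqrt (1 + w ^ 2)) by (rewrite <- sqrt_1 at 1; apply sqrt_le_1_alt; pose proof (pow2_ge_0 w); lra).
    assert (S2 : sqrt (1 + w ^ 2) <= 2 * Rabs w).
    { rewrite <- (sqrt_Rsqr (2 * Rabs w)) by lra. apply sqrt_le_1_alt.
      unfold Rsqr. rewrite <- (pow2_abs w). simpl. nra. }
    unfold asinh_ker. unfold Rdiv. rewrite Rabs_mult, <- RPow_abs, (Rabs_pos_eq (/ _)).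
    + apply (Rle_trans _ (Rabs (w + sqrt (1 + w ^ 2)) ^ (2 * nu) * 1)).
      * apply Rmult_le_compat_l; [apply pow_le, Rabs_pos|].
        apply (Rle_trans _ (/ 1)); [apply Rinv_le_contravar; lra|rewrite Rinv_1; lra].
      * rewrite Rmult_1_r. apply (Rle_trans _ ((3 * Rabs w) ^ (2 * nu))).
        -- apply pow_incr. split; [apply Rabs_pos|].
           eapply Rle_trans; [apply Rabs_triang|]. rewrite (Rabs_pos_eq (sqrt _)); lra.
        -- rewrite Rpow_mult_distr. apply Rmult_le_compat_l; [apply pow_le; lra|].
           apply Rle_pow; auto; lia.
    + apply Rlt_le, Rinv_0_lt_compat; lra.
  - exists K; split; auto. intros w. specialize (H w I).
    replace (w ^ (2 * M)) with (Rabs w ^ (2 * M)); auto.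
    rewrite !pow_mult, pow2_abs; auto.
Qed.

(** * Expansion of the Bessel integrals *)

(** Laplace's method with the saddle point moved to 0 and the exponent made exactly
    quadratic: the Taylor expansion of the kernel is integrated against the Gaussian. *)
Lemma gauss_integral_asinh_ker nu M : (nu <= M)%nat -> exists K, 0 <= K /\ forall d, exists l,
  is_RInt_gen (fun x => asinh_ker nu (d * x) * exp (- x ^ 2)) at_moo at_oo l
  /\ Rabs (l - psum (fun i => R_maclaurin (asinh_ker nu) i * gauss_moment i * d ^ i) (2 * M))
     <= K * d ^ (2 * M).
Proof.
  intros L. destruct (asinh_ker_taylor nu M L) as [K [K0 H]].
  exists (K * Rabs (gauss_moment (2 * M))).
  split; [apply Rmult_le_pos; auto using Rabs_pos|]. intros d.
  set (T := fun x => psum (fun i => R_maclaurin (asinh_ker nu) i * d ^ i * (x ^ i * exp (- x ^ 2))) (2 * M)).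
  assert (ST : smooth T).
  { apply smooth_psum. intros i. apply smooth_mult; [apply smooth_const|].
    apply smooth_mult; [apply smooth_pow, smooth_id|].
    apply smooth_exp, smooth_opp, smooth_pow, smooth_id. }
  assert (SG : smooth (fun x => asinh_ker nu (d * x) * exp (- x ^ 2))).
  { apply smooth_mult.
    - apply (smooth_comp (asinh_ker nu)); [apply smooth_asinh_ker|]. apply smooth_mult; auto using smooth_const, smooth_id.
    - apply smooth_exp, smooth_opp, smooth_pow, smooth_id. }
  assert (IT : is_RInt_gen T at_moo at_oo
     (psum (fun i => R_maclaurin (asinh_ker nu) i * gauss_moment i * d ^ i) (2 * M))).
  { apply (is_RInt_gen_psum _ _ (fun i x => R_maclaurin (asinh_ker nu) i * d ^ i * (x ^ i * exp (- x ^ 2)))).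
    intros i.
    replace (R_maclaurin (asinh_ker nu) i * gauss_moment i * d ^ i)
      with (R_maclaurin (asinh_ker nu) i * d ^ i * gauss_moment i) by ring.
    apply is_RInt_gen_Rscal, gauss_moment_correct. }
  set (B := fun x => K * d ^ (2 * M) * (x ^ (2 * M) * exp (- x ^ 2))).
  assert (IB : is_RInt_gen B at_moo at_oo
     (K * d ^ (2 * M) * gauss_moment (2 * M))).
  { apply is_RInt_gen_Rscal, gauss_moment_correct. }
  assert (HB : forall x, Rabs (asinh_ker nu (d * x) * exp (- x ^ 2) - T x) <= B x).
  { intros x. specialize (H (d * x)).
    replace (asinh_ker nu (d * x) * exp (- x ^ 2) - T x) with
      ((asinh_ker nu (d * x) - psum (fun i => R_maclaurin (asinh_ker nu) i * (d * x) ^ i) (2 * M)) * exp (- x ^ 2)).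
    - rewrite Rabs_mult, (Rabs_pos_eq (exp _)) by (apply Rlt_le, exp_pos).
      unfold B. rewrite Rpow_mult_distr in H. pose proof (exp_pos (- x ^ 2)). nra.
    - rewrite Rmult_minus_distr_r. f_equal. unfold T.
      rewrite Rmult_comm, <- psum_scal. apply psum_ext. intros i _.
      rewrite Rpow_mult_distr; ring. }
  assert (EX : exists r, is_RInt_gen (fun x => asinh_ker nu (d * x) * exp (- x ^ 2) - T x)
                 at_moo at_oo r).
  { refine (ex_RInt_gen_dominated _ _ _ _ B _ spans_R _ _ _ IB).
    - intros x _. apply smooth_continuous, smooth_minus; auto.
    - intros x _. unfold B. cont; auto.
    - intros x _; apply HB. }
  destruct EX as [r Ir].
  - exists (r + psum (fun i => R_maclaurin (asinh_ker nu) i * gauss_moment i * d ^ i) (2 * M)).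
    split.
    + apply (is_RInt_gen_spans_ext _ _ _
        (fun x => (asinh_ker nu (d * x) * exp (- x ^ 2) - T x) + T x) _ _ spans_R).
      * intros x _; ring.
      * apply is_RInt_gen_Rplus; auto.
    + unfold Rminus. rewrite Rplus_assoc, Rplus_opp_r, Rplus_0_r.
      eapply Rle_trans; [apply (Rabs_RInt_gen_le _ _ _ _ _ _ _ spans_R (fun x _ => HB x) Ir IB)|].
      pose proof (Rle_abs (gauss_moment (2 * M))).
      assert (0 <= d ^ (2 * M)) by (rewrite pow_mult; apply pow_le; nra).
      assert (0 <= K * d ^ (2 * M)) by (apply Rmult_le_pos; auto).
      apply (Rle_trans _ (K * d ^ (2 * M) * Rabs (gauss_moment (2 * M)))).
      * apply Rmult_le_compat_l; auto.
      * right; simpl; ring.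
Qed.

Lemma lim_at_right_0_rsqrt (s : R) : 0 < s ->
  filterlim (fun h => s ^ 2 * sqrt h - / sqrt h) (at_right 0) at_moo.
Proof.
  intros Hs P [M HM].
  assert (A : 0 < s ^ 2 + Rabs M + 1) by (pose proof (Rabs_pos M); nra).
  set (e := Rmin 1 (/ (s ^ 2 + Rabs M + 1) ^ 2)).
  assert (He : 0 < e).
  { apply Rmin_pos; [lra|]. apply Rinv_0_lt_compat, pow_lt; auto. }
  exists (mkposreal e He). intros h Hh Hp. apply HM.
  apply Rabs_def2 in Hh. unfold minus, plus, opp in Hh; simpl in Hh.
  assert (h < 1) by (pose proof (Rmin_l 1 (/ (s ^ 2 + Rabs M + 1) ^ 2)); unfold e in *; lra).
  assert (h < / (s ^ 2 + Rabs M + 1) ^ 2)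
    by (pose proof (Rmin_r 1 (/ (s ^ 2 + Rabs M + 1) ^ 2)); unfold e in *; lra).
  assert (S0 : 0 < sqrt h) by (apply sqrt_lt_R0; auto).
  assert (S1 : sqrt h < 1) by (rewrite <- sqrt_1; apply sqrt_lt_1; lra).
  assert (S2 : sqrt h < / (s ^ 2 + Rabs M + 1)).
  { rewrite <- (sqrt_Rsqr (/ (s ^ 2 + Rabs M + 1))) by (apply Rlt_le, Rinv_0_lt_compat; auto).
    apply sqrt_lt_1; try lra.
    - apply Rle_0_sqr.
    - rewrite Rsqr_inv'; unfold Rsqr. replace ((s ^ 2 + Rabs M + 1) * (s ^ 2 + Rabs M + 1))
        with ((s ^ 2 + Rabs M + 1) ^ 2) by ring. auto. }
  apply Rinv_lt_contravar in S2; [|apply Rmult_lt_0_compat; auto; apply Rinv_0_lt_compat; auto].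
  rewrite Rinv_inv in S2.
  pose proof (Rle_abs (- M)) as Q. rewrite Rabs_Ropp in Q.
  assert (0 < s ^ 2) by nra. nra.
Qed.

Lemma lim_p_infty_sqrt (s : R) : 0 < s ->
  filterlim (fun h => s ^ 2 * sqrt h - / sqrt h) at_oo at_oo.
Proof.
  intros Hs P [M HM].
  assert (H2 : 0 < s ^ 2) by (apply pow_lt; auto).
  set (b := (Rabs M + 1) / s ^ 2 + 1).
  assert (Hb : 1 <= b).
  { unfold b. pose proof (Rabs_pos M). assert (0 <= (Rabs M + 1) / s ^ 2) by (apply Rdiv_le_0_compat; lra). lra. }
  exists (b ^ 2). intros h Hh. apply HM.
  assert (S0 : b < sqrt h).
  { rewrite <- (sqrt_Rsqr b) by lra. apply sqrt_lt_1; [apply Rle_0_sqr|nra|unfold Rsqr; nra]. }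
  assert (/ sqrt h <= 1) by (rewrite <- Rinv_1; apply Rinv_le_contravar; lra).
  assert (s ^ 2 * b < s ^ 2 * sqrt h) by (apply Rmult_lt_compat_l; auto).
  assert (s ^ 2 * b = Rabs M + 1 + s ^ 2) by (unfold b; field; lra).
  pose proof (Rle_abs M). lra.
Qed.

(** In terms of [t = s * sqrt h], the substitution is [x = s * (t - 1 / t)], chosen so
    that [x^2 = s^4 * h + 1 / h - 2 * s^2]; then [x / (2 * s) = sinh (ln t)]. *)
Lemma bessel_substitution k s h : 0 < s -> 0 < h ->
  (s ^ 2 / (2 * sqrt h) + / (2 * (h * sqrt h)))
  * (asinh_ker (S k) (/ (2 * s) * (s ^ 2 * sqrt h - / sqrt h)) * exp (- (s ^ 2 * sqrt h - / sqrt h) ^ 2))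
  = s ^ (2 * k + 3) * exp (2 * s ^ 2) * (h ^ k * exp (- (s ^ 4 * h) - / h)).
Proof.
  intros Hs Hh.
  assert (R0 : 0 < sqrt h) by (apply sqrt_lt_R0; auto).
  assert (RR : h = sqrt h ^ 2) by (simpl; rewrite Rmult_1_r, sqrt_sqrt; lra).
  set (r := sqrt h) in *. clearbody r. subst h.
  assert (E1 : sqrt (1 + (/ (2 * s) * (s ^ 2 * r - / r)) ^ 2) = (s ^ 2 * r ^ 2 + 1) / (2 * s * r)).
  { rewrite <- (sqrt_Rsqr ((s ^ 2 * r ^ 2 + 1) / (2 * s * r))).
    - f_equal. unfold Rsqr. field. lra.
    - apply Rlt_le, Rdiv_lt_0_compat; [nra|]. apply Rmult_lt_0_compat; nra. }
  unfold asinh_ker. rewrite E1.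
  replace (/ (2 * s) * (s ^ 2 * r - / r) + (s ^ 2 * r ^ 2 + 1) / (2 * s * r)) with (s * r)
    by (field; lra).
  replace (- (s ^ 2 * r - / r) ^ 2) with (2 * s ^ 2 + (- (s ^ 4 * r ^ 2) - / r ^ 2)) by (field; lra).
  rewrite exp_plus.
  replace (2 * S k)%nat with (2 * k + 2)%nat by lia.
  rewrite Rpow_mult_distr, !pow_add, <- pow_mult.
  assert (s ^ 2 * r ^ 2 + 1 <> 0) by nra.
  field. repeat split; lra || nra.
Qed.

(** Up to elementary factors, the modified Bessel function [K_(k + 1) (2 sqrt n)] for
    [n = s^4]. *)
Lemma bessel_integral k s l : 0 < s ->
  is_RInt_gen (fun x => asinh_ker (S k) (/ (2 * s) * x) * exp (- x ^ 2))
    at_moo at_oo l ->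
  is_RInt_gen (fun h => h ^ k * exp (- (s ^ 4 * h) - / h)) (at_right 0) at_oo
    (/ (s ^ (2 * k + 3) * exp (2 * s ^ 2)) * l).
Proof.
  intros Hs I.
  assert (P : 0 < s ^ (2 * k + 3) * exp (2 * s ^ 2)).
  { apply Rmult_lt_0_compat; [apply pow_lt; auto|apply exp_pos]. }
  apply (is_RInt_gen_spans_ext _ _ _
    (fun h => / (s ^ (2 * k + 3) * exp (2 * s ^ 2)) *
      ((s ^ 2 / (2 * sqrt h) + / (2 * (h * sqrt h)))
       * (asinh_ker (S k) (/ (2 * s) * (s ^ 2 * sqrt h - / sqrt h)) * exp (- (s ^ 2 * sqrt h - / sqrt h) ^ 2))))
    _ _ spans_pos).
  - intros h Hh. rewrite bessel_substitution by auto.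
    field.
    split; [apply Rgt_not_eq, exp_pos|apply pow_nonzero; lra].
  - apply is_RInt_gen_Rscal.
    apply (is_RInt_gen_comp _ _ _ _ _ _ (fun x => asinh_ker (S k) (/ (2 * s) * x) * exp (- x ^ 2))
      (fun h => s ^ 2 * sqrt h - / sqrt h) (fun h => s ^ 2 / (2 * sqrt h) + / (2 * (h * sqrt h))) l
      spans_pos spans_R); auto.
    + intros h Hh. pose proof (sqrt_lt_R0 h Hh) as R0.
      pose proof (sqrt_sqrt h (Rlt_le _ _ Hh)) as RR.
      auto_derive; [repeat split; auto; lra|].
      set (r := sqrt h) in *. clearbody r. subst h. field. lra.
    + intros h Hh. pose proof (sqrt_lt_R0 h Hh) as R0. cont.
      repeat split; auto; try lra. apply Rmult_integral_contrapositive_currified; lra || nra.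
    + intros x _. apply smooth_continuous. apply smooth_mult.
      * apply (smooth_comp (asinh_ker (S k))); [apply smooth_asinh_ker|].
        apply smooth_mult; auto using smooth_const, smooth_id.
      * apply smooth_exp, smooth_opp, smooth_pow, smooth_id.
    + apply lim_at_right_0_rsqrt; auto.
    + apply lim_p_infty_sqrt; auto.
Qed.

(** The coefficients of the expansion of [K_(k + 1)], that is
    [prod_(i < j) ((k + 1)^2 - (i + 1/2)^2) / (4^j j!)]: the factors of the Pochhammer symbol
    pair off around its centre [k + 1]. *)
Definition bessel_coef (k j : nat) : R :=
  poch (INR k - INR j + 3 / 2) (2 * j) / (4 ^ j * INR (fact j)).

Lemma poch_Sl x l : poch (x - 1) (S l) = (x - 1) * poch x l.
Proof.
  induction l as [|l IH]; [simpl; ring|].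
  change (poch (x - 1) (S (S l))) with (poch (x - 1) (S l) * (x - 1 + INR (S l))).
  rewrite IH, S_INR. simpl. ring.
Qed.

Lemma bessel_coef_S k j :
  bessel_coef k (S j) * (4 * (INR j + 1)) = bessel_coef k j * ((INR k + 1) ^ 2 - (INR j + / 2) ^ 2).
Proof.
  unfold bessel_coef. replace (2 * S j)%nat with (S (S (2 * j))) by lia.
  replace (INR k - INR (S j) + 3 / 2) with ((INR k - INR j + 3 / 2) - 1) by (rewrite S_INR; ring).
  rewrite poch_Sl.
  change (poch (INR k - INR j + 3 / 2) (S (2 * j))) with
    (poch (INR k - INR j + 3 / 2) (2 * j) * (INR k - INR j + 3 / 2 + INR (2 * j))).
  rewrite fact_simpl, !mult_INR, (S_INR j). change (INR 2) with 2. simpl (4 ^ S j).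
  pose proof (INR_fact_neq_0 j). pose proof (pos_INR j).
  assert (4 ^ j <> 0) by (apply pow_nonzero; lra).
  field. repeat split; auto; lra.
Qed.

Lemma gauss_moment_odd j : gauss_moment (S (2 * j)) = 0.
Proof.
  induction j as [|j IH]; [reflexivity|].
  replace (S (2 * S j)) with (S (S (S (2 * j)))) by lia.
  change (gauss_moment (S (S (S (2 * j))))) with ((INR (S (2 * j)) + 1) / 2 * gauss_moment (S (2 * j))).
  rewrite IH; ring.
Qed.

(** Odd moments vanish, and for even ones the recurrences of the Taylor coefficients and
    of the moments combine into that of [bessel_coef]. *)
Lemma maclaurin_asinh_ker_even k j :
  R_maclaurin (asinh_ker (S k)) (2 * j) * gauss_moment (2 * j) = sqrt PI * 4 ^ j * bessel_coef k j.
Proof.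
  induction j as [|j IH].
  - change (2 * 0)%nat with 0%nat. rewrite maclaurin_asinh_ker_0. unfold bessel_coef; simpl. field.
  - replace (2 * S j)%nat with (S (S (2 * j))) by lia.
    change (gauss_moment (S (S (2 * j)))) with ((INR (2 * j) + 1) / 2 * gauss_moment (2 * j)).
    pose proof (maclaurin_asinh_ker_SS (S k) (2 * j)) as H1.
    pose proof (bessel_coef_S k j) as H2.
    pose proof (pos_INR j) as P.
    rewrite mult_INR, (S_INR k) in H1. rewrite mult_INR. change (INR 2) with 2 in *.
    simpl (4 ^ S j).
    set (g := R_maclaurin (asinh_ker (S k)) (S (S (2 * j)))) in *.
    set (g' := R_maclaurin (asinh_ker (S k)) (2 * j)) in *.
    set (m := gauss_moment (2 * j)) in *.
    apply (Rmult_eq_reg_r (4 * (INR j + 1))); [|lra].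
    replace (sqrt PI * (4 * 4 ^ j) * bessel_coef k (S j) * (4 * (INR j + 1)))
      with (4 * (sqrt PI * 4 ^ j) * (bessel_coef k (S j) * (4 * (INR j + 1)))) by ring.
    rewrite H2.
    replace (4 * (sqrt PI * 4 ^ j) * (bessel_coef k j * ((INR k + 1) ^ 2 - (INR j + / 2) ^ 2)))
      with (4 * (sqrt PI * 4 ^ j * bessel_coef k j) * ((INR k + 1) ^ 2 - (INR j + / 2) ^ 2)) by ring.
    rewrite <- IH.
    replace (g * ((2 * INR j + 1) / 2 * m) * (4 * (INR j + 1)))
      with (m * (g * ((2 * INR j + 2) * (2 * INR j + 1)))) by field.
    rewrite H1. field.
Qed.

Lemma psum_even u M : (forall j, u (S (2 * j)) = 0) -> psum u (2 * M) = psum (fun j => u (2 * j)%nat) M.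
Proof.
  intros H; induction M as [|M IH]; [reflexivity|].
  replace (2 * S M)%nat with (S (S (2 * M))) by lia.
  change (psum u (2 * M) + u (2 * M)%nat + u (S (2 * M))
    = psum (fun j => u (2 * j)%nat) M + u (2 * M)%nat).
  rewrite IH, H. ring.
Qed.

(** The common size, up to a power of [n], of the integrals below. *)
Definition scale (n : nat) : R := sqrt PI * exp (- (2 * sqrt (INR n))) * (rsqrt n * sqrt (rsqrt n)).

Lemma scale_pos n : (0 < n)%nat -> 0 < scale n.
Proof.
  intros H. pose proof (rsqrt_bounds n H). unfold scale.
  repeat apply Rmult_lt_0_compat; try (apply sqrt_lt_R0); try apply exp_pos; try lra; apply PI_RGT_0.
Qed.

Definition bessel (k n : nat) : R :=
  RInt_gen (fun h => h ^ k * exp (- (INR n * h) - / h)) (at_right 0) at_oo.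

Lemma bessel_expansion k :
  (forall n, (0 < n)%nat ->
    is_RInt_gen (fun h => h ^ k * exp (- (INR n * h) - / h)) (at_right 0) at_oo
      (bessel k n))
  /\ asym (fun n => bessel k n / (scale n * rsqrt n ^ k)) (bessel_coef k).
Proof.
  set (I := fun n => RInt_gen (fun x => asinh_ker (S k) (/ (2 * sqrt (sqrt (INR n))) * x) * exp (- x ^ 2))
       at_moo at_oo).
  assert (HI : forall M, (S k <= M)%nat -> exists K, 0 <= K /\ forall n, (0 < n)%nat ->
    is_RInt_gen (fun x => asinh_ker (S k) (/ (2 * sqrt (sqrt (INR n))) * x) * exp (- x ^ 2))
       at_moo at_oo (I n) /\
    Rabs (I n / sqrt PI - psum (fun j => bessel_coef k j * rsqrt n ^ j) M) <= K * rsqrt n ^ M).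
  { intros M L. destruct (gauss_integral_asinh_ker (S k) M L) as [K [K0 H]].
    pose proof (sqrt_lt_R0 PI PI_RGT_0) as SP.
    exists (K / sqrt PI / 4 ^ M). split.
    { apply Rdiv_le_0_compat; [|apply pow_lt; lra]. apply Rdiv_le_0_compat; auto. }
    intros n Hn. destruct (H (/ (2 * sqrt (sqrt (INR n))))) as [l [Hl B]].
    assert (E : I n = l) by exact (is_RInt_gen_unique _ _ Hl).
    rewrite E; split; auto.
    pose proof (sqrt_INR_ge1 n Hn) as S1.
    (* The scale of the kernel's argument is 1 / (2 n^(1/4)), and only its even powers occur. *)
    assert (D : (/ (2 * sqrt (sqrt (INR n)))) ^ 2 = rsqrt n / 4).
    { unfold rsqrt. rewrite <- (sqrt_sqrt (sqrt (INR n))) at 2 by lra. field.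
      apply Rgt_not_eq, sqrt_lt_R0; lra. }
    assert (D' : forall j, (/ (2 * sqrt (sqrt (INR n)))) ^ (2 * j) = rsqrt n ^ j / 4 ^ j).
    { intros j. rewrite pow_mult, D. unfold Rdiv. rewrite Rpow_mult_distr, pow_inv. reflexivity. }
    rewrite psum_even, D' in B by (intros j; rewrite gauss_moment_odd; ring).
    rewrite (psum_ext _ (fun j => sqrt PI * (bessel_coef k j * rsqrt n ^ j))) in B.
    2:{ intros j _. rewrite maclaurin_asinh_ker_even, D'. field. apply pow_nonzero; lra. }
    rewrite psum_scal in B.
    replace (l / sqrt PI - psum (fun j => bessel_coef k j * rsqrt n ^ j) M)
      with ((l - sqrt PI * psum (fun j => bessel_coef k j * rsqrt n ^ j) M) * / sqrt PI) by (field; lra).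
    rewrite Rabs_mult, (Rabs_pos_eq (/ sqrt PI)) by (apply Rlt_le, Rinv_0_lt_compat; auto).
    apply (Rmult_le_compat_r (/ sqrt PI)) in B; [|apply Rlt_le, Rinv_0_lt_compat; auto].
    eapply Rle_trans; [apply B|]. right. field. repeat split; try (apply pow_nonzero); lra. }
  assert (HB : forall n, (0 < n)%nat ->
    is_RInt_gen (fun h => h ^ k * exp (- (INR n * h) - / h)) (at_right 0) at_oo
      (scale n * rsqrt n ^ k * (I n / sqrt PI))).
  { intros n Hn. destruct (HI (S k) (le_n _)) as [K0 [_ H]]. destruct (H n Hn) as [H1 _].
    pose proof (sqrt_INR_ge1 n Hn) as S1.
    pose proof (sqrt_lt_R0 (sqrt (INR n)) ltac:(lra)) as S2.
    pose proof (bessel_integral k (sqrt (sqrt (INR n))) (I n) S2 H1) as B.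
    set (s := sqrt (sqrt (INR n))) in *.
    assert (E2 : s ^ 2 = sqrt (INR n)) by (simpl; rewrite Rmult_1_r; apply sqrt_sqrt; lra).
    assert (E4 : s ^ 4 = INR n).
    { replace (s ^ 4) with (s ^ 2 * s ^ 2) by ring. rewrite E2. apply sqrt_sqrt, pos_INR. }
    rewrite E4 in B.
    replace (scale n * rsqrt n ^ k * (I n / sqrt PI)) with (/ (s ^ (2 * k + 3) * exp (2 * s ^ 2)) * I n).
    exact B.
    unfold scale, rsqrt. rewrite <- E2, exp_Ropp.
    replace (sqrt (/ s ^ 2)) with (/ s).
    2:{ rewrite <- (sqrt_Rsqr (/ s)) by (apply Rlt_le, Rinv_0_lt_compat; auto).
        f_equal. unfold Rsqr. field. lra. }
    rewrite pow_inv, <- pow_mult, pow_add. field.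
    pose proof (sqrt_lt_R0 PI PI_RGT_0). pose proof (exp_pos (2 * s ^ 2)).
    repeat split; try (apply pow_nonzero); lra. }
  assert (E : forall n, (0 < n)%nat -> bessel k n = scale n * rsqrt n ^ k * (I n / sqrt PI)).
  { intros n Hn. exact (is_RInt_gen_unique _ _ (HB n Hn)). }
  split.
  - intros n Hn. rewrite E; auto.
  - apply asym_of_large. intros N. exists (S k).
    destruct (HI (N + S k)%nat ltac:(lia)) as [K [K0 H]].
    apply (bigO_le _ N (N + S k)); [lia|].
    exists K; split; auto. exists 1%nat. intros n Hn.
    rewrite E by lia.
    replace (scale n * rsqrt n ^ k * (I n / sqrt PI) / (scale n * rsqrt n ^ k)) with (I n / sqrt PI).
    + apply H; lia.
    + pose proof (scale_pos n Hn). pose proof (rsqrt_bounds n Hn).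
      pose proof (sqrt_lt_R0 PI PI_RGT_0).
      field. repeat split; try lra. apply pow_nonzero; lra.
Qed.

(** * Expansion of the integral behind [b_n] *)

(** The substitution [s = 1 / (exp h - 1)] turns [- b_n], which is the integral of
    [exp (- s) s^(n - 1) / (1 + s)^(n + 1)] over [s > 0], into the integral of this function
    over [h > 0]. *)
Definition beta_integrand (n : nat) (h : R) : R := exp (- (INR n * h) - / (exp h - 1)).

Definition beta (n : nat) : R := RInt_gen (beta_integrand n) (at_right 0) at_oo.

(** This is where [mu] comes from: [1 / (exp h - 1) = 1 / h - 1 / 2 - mu h]. *)
Lemma beta_integrand_eq n h : 0 < h ->
  beta_integrand n h = sqrt (exp 1) * (exp (mu h) * exp (- (INR n * h) - / h)).
Proof.
  intros H. pose proof (exp_gt_1 h H).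
  replace (sqrt (exp 1)) with (exp (1 / 2)).
  - rewrite <- !exp_plus. unfold beta_integrand, mu.
    destruct (Req_EM_T h 0); [lra|]. f_equal. field. lra.
  - rewrite <- (sqrt_Rsqr (exp (1 / 2))) by (apply Rlt_le, exp_pos).
    f_equal. unfold Rsqr. rewrite <- exp_plus. f_equal. field.
Qed.

Lemma continuous_beta_integrand n h : 0 < h -> continuous (beta_integrand n) h.
Proof.
  intros H. pose proof (exp_gt_1 h H). unfold beta_integrand. cont. lra.
Qed.

Lemma beta_correct n : (0 < n)%nat ->
  is_RInt_gen (beta_integrand n) (at_right 0) at_oo (beta n).
Proof.
  intros Hn. destruct (exp_mu_taylor 0) as [K [K0 H]].
  destruct (bessel_expansion 0) as [HJ _].
  assert (EX : exists l, is_RInt_gen (beta_integrand n) (at_right 0) at_oo l).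
  { refine (ex_RInt_gen_dominated _ _ _ _
      (fun h => (sqrt (exp 1) * K) * (h ^ 0 * exp (- (INR n * h) - / h))) _ spans_pos _ _ _ _).
    - intros; apply continuous_beta_integrand; auto.
    - intros h Hh. simpl. cont. lra.
    - intros h Hh. rewrite beta_integrand_eq by auto.
      specialize (H h Hh). simpl in H. rewrite Rminus_0_r, Rmult_1_r in H.
      simpl.
      rewrite !Rabs_mult, (Rabs_pos_eq (sqrt _)) by apply sqrt_pos.
      rewrite (Rabs_pos_eq (exp (_ - _))) by (apply Rlt_le, exp_pos).
      rewrite Rmult_1_l, Rmult_assoc. apply Rmult_le_compat_l; [apply sqrt_pos|].
      apply Rmult_le_compat_r; auto. apply Rlt_le, exp_pos.
    - apply is_RInt_gen_Rscal, HJ; auto. }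
  destruct EX as [l Hl]. unfold beta. rewrite (is_RInt_gen_unique _ _ Hl). exact Hl.
Qed.

(** Order [N] of a sum of expansions, the [k]-th of which starts at order [k]. *)
Lemma psum_product_truncated (u : nat -> R) (v : nat -> nat -> R) (e : R) N :
  psum (fun k => u k * e ^ k * psum (fun j => v k j * e ^ j) (N - k)) N
  = psum (fun m => psum (fun j => u (m - j)%nat * v (m - j)%nat j) (S m) * e ^ m) N.
Proof.
  induction N as [|N IH]; [reflexivity|].
  set (w := fun m => psum (fun j => u (m - j)%nat * v (m - j)%nat j) (S m)) in *.
  change (psum (fun k => u k * e ^ k * psum (fun j => v k j * e ^ j) (S N - k)) (S N)
    = psum (fun m => w m * e ^ m) N + w N * e ^ N).
  change (psum (fun k => u k * e ^ k * psum (fun j => v k j * e ^ j) (N - k)) N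
    = psum (fun m => w m * e ^ m) N) in IH.
  rewrite <- IH.
  assert (RV : forall f n, psum f (S n) = psum (fun j => f (n - j)%nat) (S n)).
  { intros f n; revert f; induction n as [|n IHn]; intros f; [reflexivity|].
    rewrite psum_Sl, IHn.
    change (psum (fun j => f (S n - j)%nat) (S (S n)))
      with (psum (fun j => f (S n - j)%nat) (S n) + f (S n - S n)%nat).
    rewrite Nat.sub_diag, Rplus_comm. f_equal.
    apply psum_ext. intros i Hi. f_equal. lia. }
  assert (EW : w N = psum (fun k => u k * v k (N - k)%nat) (S N)).
  { unfold w. rewrite (RV (fun k => u k * v k (N - k)%nat)).
    apply psum_ext. intros j Hj. replace (N - (N - j))%nat with j by lia. reflexivity. }
  rewrite EW.
  change (psum (fun k => u k * e ^ k * psum (fun j => v k j * e ^ j) (S N - k)) N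
      + u N * e ^ N * psum (fun j => v N j * e ^ j) (S N - N)
    = psum (fun k => u k * e ^ k * psum (fun j => v k j * e ^ j) (N - k)) N
      + (psum (fun k => u k * v k (N - k)%nat) N + u N * v N (N - N)%nat) * e ^ N).
  rewrite (psum_ext (fun k => u k * e ^ k * psum (fun j => v k j * e ^ j) (S N - k))
    (fun k => u k * e ^ k * psum (fun j => v k j * e ^ j) (N - k) + e ^ N * (u k * v k (N - k)%nat))).
  - rewrite psum_plus, psum_scal.
    rewrite Nat.sub_diag. replace (S N - N)%nat with 1%nat by lia. simpl psum. ring.
  - intros k Hk. replace (S N - k)%nat with (S (N - k)) by lia. simpl psum.
    replace (e ^ N) with (e ^ k * e ^ (N - k)) by (rewrite <- pow_add; f_equal; lia). ring.
Qed.

Lemma alt_c_eq m : (-1) ^ m * c m =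
  psum (fun j => R_maclaurin (fun h => exp (mu h)) (m - j) * bessel_coef (m - j) j) (S m).
Proof.
  unfold c. rewrite sum_f_R0_psum, <- Rmult_assoc, <- Rpow_mult_distr.
  replace (-1 * -1) with 1 by ring. rewrite pow1, Rmult_1_l.
  apply psum_ext. intros j Hj. unfold bessel_coef. rewrite minus_INR by lia.
  do 3 f_equal. ring.
Qed.

(** The Taylor expansion of [exp (mu h)] has a global error [K h^N], so it can be integrated
    against [exp (- n h - 1 / h)]; each power of [h] gives a Bessel integral. *)
Lemma beta_asym : asym (fun n => beta n / (sqrt (exp 1) * scale n)) (fun m => (-1) ^ m * c m).
Proof.
  intros N. set (mc := R_maclaurin (fun h => exp (mu h))).
  destruct (exp_mu_taylor N) as [K [K0 H]]. fold mc in H.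
  set (J := fun k n => bessel k n / (scale n * rsqrt n ^ k)).
  assert (HJ : forall k n, (0 < n)%nat -> bessel k n = scale n * (rsqrt n ^ k * J k n)).
  { intros k n Hn. unfold J. pose proof (scale_pos n Hn). pose proof (rsqrt_bounds n Hn).
    field. split; [apply pow_nonzero|]; lra. }
  assert (H1 : bigO (fun n => beta n / (sqrt (exp 1) * scale n)
       - psum (fun k => mc k * rsqrt n ^ k * J k n) N) N).
  { assert (BJ : bigO (fun n => K * (rsqrt n ^ N * J N n)) N).
    { apply bigO_scal. apply (bigO_le _ N (N + 0)); [lia|].
      apply bigO_mult; [apply bigO_pow|].
      destruct (bessel_expansion N) as [_ A]. specialize (A 0%nat). revert A.
      apply bigO_ext. exists 0%nat; intros; apply Rminus_0_r. }
    destruct BJ as [L [L0 BJ]]. exists L; split; auto.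
    eapply filter_imp; [|apply filter_and; [apply BJ|apply eventually_pos]].
    intros n [B Hn]. eapply Rle_trans; [|apply B].
    eapply Rle_trans; [|apply Rle_abs].
    pose proof (scale_pos n Hn) as SP. pose proof (sqrt_lt_R0 _ (exp_pos 1)) as SE.
    assert (IP : is_RInt_gen (fun h => psum (fun k => mc k * (h ^ k * exp (- (INR n * h) - / h))) N)
       (at_right 0) at_oo (psum (fun k => mc k * bessel k n) N)).
    { apply (is_RInt_gen_psum _ _ (fun k h => mc k * (h ^ k * exp (- (INR n * h) - / h)))).
      intros k. apply is_RInt_gen_Rscal, bessel_expansion; auto. }
    pose proof (is_RInt_gen_Rscal _ (/ sqrt (exp 1)) _ (beta_correct n Hn)) as I1.
    pose proof (is_RInt_gen_Rminus _ _ _ _ I1 IP) as I2.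
    pose proof (is_RInt_gen_Rscal _ K _ (proj1 (bessel_expansion N) n Hn)) as I3.
    assert (BB : Rabs (/ sqrt (exp 1) * beta n - psum (fun k => mc k * bessel k n) N) <= K * bessel N n).
    { refine (Rabs_RInt_gen_le _ _ _ _ _ _ _ spans_pos _ I2 I3). intros h Hh.
      rewrite beta_integrand_eq by auto. specialize (H h Hh).
      rewrite (psum_ext _ (fun k => exp (- (INR n * h) - / h) * (mc k * h ^ k))) by (intros; ring).
      rewrite psum_scal.
      replace (/ sqrt (exp 1) * (sqrt (exp 1) * (exp (mu h) * exp (- (INR n * h) - / h))) -
         (exp (- (INR n * h) - / h) * psum (fun k => mc k * h ^ k) N))
        with ((exp (mu h) - psum (fun k => mc k * h ^ k) N) * exp (- (INR n * h) - / h)) by (field; lra).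
      rewrite Rabs_mult, (Rabs_pos_eq (exp (_ - _))) by (apply Rlt_le, exp_pos).
      rewrite <- Rmult_assoc. apply Rmult_le_compat_r; auto. apply Rlt_le, exp_pos. }
    rewrite (psum_ext _ (fun k => scale n * (mc k * rsqrt n ^ k * J k n))) in BB
      by (intros; rewrite HJ by auto; ring).
    rewrite psum_scal, HJ in BB by auto.
    replace (beta n / (sqrt (exp 1) * scale n) - psum (fun k => mc k * rsqrt n ^ k * J k n) N)
      with ((/ sqrt (exp 1) * beta n - scale n * psum (fun k => mc k * rsqrt n ^ k * J k n) N) * / scale n)
      by (field; lra).
    rewrite Rabs_mult, (Rabs_pos_eq (/ _)) by (apply Rlt_le, Rinv_0_lt_compat; auto).
    apply (Rmult_le_reg_r (scale n)); auto.
    rewrite Rmult_assoc, Rinv_l, Rmult_1_r by lra. lra. }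
  assert (H2 : bigO (fun n => psum (fun k => mc k * rsqrt n ^ k * J k n) N
      - psum (fun k => mc k * rsqrt n ^ k * psum (fun j => bessel_coef k j * rsqrt n ^ j) (N - k)) N) N).
  { apply (bigO_ext (fun n => psum (fun k => mc k * (rsqrt n ^ k *
      (J k n - psum (fun j => bessel_coef k j * rsqrt n ^ j) (N - k)))) N)).
    - exists 0%nat. intros n _.
      rewrite (psum_ext _ (fun k => mc k * rsqrt n ^ k * J k n + -1 *
        (mc k * rsqrt n ^ k * psum (fun j => bessel_coef k j * rsqrt n ^ j) (N - k)))) by (intros; ring).
      rewrite psum_plus, psum_scal. ring.
    - apply bigO_psum. intros k Hk. apply bigO_scal.
      apply (bigO_le _ N (k + (N - k))); [lia|].
      apply bigO_mult; [apply bigO_pow|]. apply bessel_expansion. }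
  pose proof (bigO_plus _ _ _ H1 H2) as H3. revert H3. apply bigO_ext.
  exists 0%nat. intros n _.
  rewrite (psum_ext (fun m => (-1) ^ m * c m * rsqrt n ^ m)
    (fun m => psum (fun j => mc (m - j)%nat * bessel_coef (m - j) j) (S m) * rsqrt n ^ m))
    by (intros; rewrite alt_c_eq; reflexivity).
  rewrite <- psum_product_truncated. ring.
Qed.

(** * The recurrence of [beta] *)

Lemma filterlim_exp_opp_0 : filterlim (fun h => exp (- h)) (at_right 0) (locally 1).
Proof.
  replace 1 with (exp (- 0)) by (rewrite Ropp_0; apply exp_0).
  apply (filterlim_filter_le_1 (F := locally 0) (G := at_right 0)).
  - apply filter_le_within.
  - apply (continuous_R_derive (fun h => exp (- h)) 0 (- exp (- 0))).
    auto_derive; auto. ring.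
Qed.

Lemma filterlim_exp_opp_p : filterlim (fun h => exp (- h)) at_oo (locally 0).
Proof.
  apply (filterlim_comp _ _ _ Ropp exp _ at_moo).
  - apply (filterlim_Rbar_opp p_infty).
  - apply is_lim_exp_m.
Qed.

Lemma exp_opp_lt_1 h : 0 < h -> 0 < exp (- h) < 1.
Proof. intros H; split; [apply exp_pos|]. rewrite <- exp_0. apply exp_increasing; lra. Qed.

Lemma beta_integrand_q n h : 0 < h ->
  beta_integrand n h = exp (- h) ^ n * exp (- (exp (- h) / (1 - exp (- h)))).
Proof.
  intros H. unfold beta_integrand. rewrite <- exp_INR_mult, <- exp_plus. f_equal.
  pose proof (exp_gt_1 h H). rewrite exp_Ropp. field. lra.
Qed.

(** Boundary values are taken in the variable [q = exp (- h)].  At [q = 1] the exponential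
    factor has an essential singularity, but it is bounded and comes with a factor
    [1 - q]. *)
Lemma filterlim_q_right (f : R -> R) : (forall q, 0 < q < 1 -> Rabs (f q) <= 1 - q) ->
  filterlim (fun h => f (exp (- h))) (at_right 0) (locally 0).
Proof.
  intros H P [e He].
  pose proof (filterlim_exp_opp_0 _ (locally_ball 1 e)) as L.
  assert (Pos : at_right 0 (fun h => 0 < h)) by apply (spans_left _ _ _ spans_pos).
  unfold filtermap in *.
  eapply filter_imp; [|apply filter_and; [apply L|apply Pos]].
  intros h [B Hh]. apply He. pose proof (exp_opp_lt_1 h Hh) as Q.
  change (Rabs (exp (- h) - 1) < e) in B.
  change (Rabs (f (exp (- h)) - 0) < e). rewrite Rminus_0_r.
  eapply Rle_lt_trans; [apply H; auto|].
  rewrite Rabs_left in B; lra.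
Qed.

Lemma filterlim_q_infty (f : R -> R) : continuous f 0 ->
  filterlim (fun h => f (exp (- h))) at_oo (locally (f 0)).
Proof.
  intros H. apply (filterlim_comp _ _ _ (fun h => exp (- h)) f _ (locally 0)); auto.
  apply filterlim_exp_opp_p.
Qed.

Lemma Rabs_q_weight_le q (a : nat) : 0 < q < 1 ->
  Rabs ((1 - q) * ((1 - q) ^ a * exp (- (q / (1 - q))))) <= 1 - q.
Proof.
  intros Hq.
  assert (exp (- (q / (1 - q))) <= 1).
  { apply (Rle_trans _ (exp 0)); [apply exp_monotone|rewrite exp_0; lra].
    assert (0 <= q / (1 - q)) by (apply Rdiv_le_0_compat; lra). lra. }
  assert ((1 - q) ^ a <= 1) by (apply pow_unit_le_1; lra).
  assert (0 <= (1 - q) ^ a) by (apply pow_le; lra).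
  pose proof (exp_pos (- (q / (1 - q)))).
  rewrite Rabs_pos_eq.
  - assert (Hp : (1 - q) ^ a * exp (- (q / (1 - q))) <= 1).
    { apply (Rle_trans _ (1 * 1)); [apply Rmult_le_compat; lra|lra]. }
    revert Hp. generalize ((1 - q) ^ a * exp (- (q / (1 - q)))). intros; nra.
  - apply Rmult_le_pos; [lra|]. apply Rmult_le_pos; lra.
Qed.

(** With [q = exp (- h)], the integrand is the derivative in [h] of
    [(1 - q)^2 q^n exp (- q / (1 - q))]; at [h = oo], that is [q = 0], this is [0^n]. *)
Lemma beta_recurrence_aux n :
  is_RInt_gen (fun h => - (INR n + 2) * beta_integrand (S (S n)) h
      + (2 * INR n + 3) * beta_integrand (S n) h - INR n * beta_integrand n h)
    (at_right 0) at_oo (0 ^ n).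
Proof.
  set (f := fun q => (1 - q) ^ 2 * q ^ n * exp (- (q / (1 - q)))).
  apply (is_RInt_gen_spans_ext _ _ _ (fun h => - exp (- h) *
    ((- 2 * (1 - exp (- h)) * exp (- h) ^ n + (1 - exp (- h)) ^ 2 * (INR n * exp (- h) ^ pred n)
      - exp (- h) ^ n) * exp (- (exp (- h) / (1 - exp (- h)))))) _ _ spans_pos).
  { intros h Hh. rewrite !beta_integrand_q by auto.
    pose proof (exp_opp_lt_1 h Hh). destruct n as [|n]; simpl pow; simpl pred; [simpl INR|]; ring. }
  replace (0 ^ n) with (0 ^ n - 0) by ring.
  apply (is_RInt_gen_FTC _ _ _ (fun h => f (exp (- h))) _ _ _ spans_pos).
  - intros h Hh. pose proof (exp_opp_lt_1 h Hh). unfold f.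
    auto_derive; [repeat split; auto; lra|].
    set (q := exp (- h)) in *. change (q * / (1 + - q)) with (q / (1 - q)).
    set (w := exp (- (q / (1 - q)))). field. lra.
  - intros h Hh. pose proof (exp_opp_lt_1 h Hh). cont. lra.
  - apply filterlim_q_right. intros q Hq. unfold f.
    replace ((1 - q) ^ 2 * q ^ n * exp (- (q / (1 - q))))
      with (q ^ n * ((1 - q) * ((1 - q) ^ 1 * exp (- (q / (1 - q)))))) by ring.
    rewrite Rabs_mult, Rabs_pos_eq by (apply pow_le; lra).
    assert (q ^ n <= 1) by (apply pow_unit_le_1; lra).
    pose proof (Rabs_q_weight_le q 1 Hq).
    pose proof (Rabs_pos ((1 - q) * ((1 - q) ^ 1 * exp (- (q / (1 - q)))))). nra.
  - replace (0 ^ n) with (f 0).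
    + apply filterlim_q_infty. unfold f. cont. lra.
    + unfold f. replace (- (0 / (1 - 0))) with 0 by field. rewrite exp_0. ring.
Qed.

Lemma beta_recurrence n :
  (INR n + 2) * beta (S (S n)) - (2 * INR n + 3) * beta (S n) + INR n * beta n = - 0 ^ n.
Proof.
  pose proof (beta_recurrence_aux n) as I0.
  pose proof (is_RInt_gen_Rscal _ (- (INR n + 2)) _
    (beta_correct (S (S n)) (Nat.lt_0_succ _))) as I2.
  pose proof (is_RInt_gen_Rscal _ (2 * INR n + 3) _
    (beta_correct (S n) (Nat.lt_0_succ _))) as I1.
  pose proof (is_RInt_gen_Rplus _ _ _ _ I2 I1) as I3.
  assert (I4 : is_RInt_gen (fun h => INR n * beta_integrand n h)
     (at_right 0) at_oo (INR n * beta n)).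
  { destruct n as [|n].
    - simpl INR. rewrite Rmult_0_l.
      apply (is_RInt_gen_spans_ext _ _ _ (fun h => 0 * beta_integrand 1 h) _ _ spans_pos).
      + intros h _; ring.
      + pose proof (is_RInt_gen_Rscal _ 0 _ (beta_correct 1 (Nat.lt_0_succ _))) as Z.
        rewrite Rmult_0_l in Z. exact Z.
    - apply is_RInt_gen_Rscal, beta_correct; lia. }
  pose proof (is_RInt_gen_Rminus _ _ _ _ I3 I4) as I5.
  pose proof (is_RInt_gen_unique _ _ I0) as E0. pose proof (is_RInt_gen_unique _ _ I5) as E5.
  cbv beta in E5. rewrite E0 in E5. lra.
Qed.

(** The change of variable [s = 1 / (exp h - 1)] and one integration by parts, done at once
    by exhibiting an antiderivative of the integrand of [beta 1]. *)
Lemma beta_1_eq l :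
  is_RInt_gen (fun s => exp (- s) / (1 + s)) (at_point 0) at_oo l ->
  beta 1 = 1 - l.
Proof.
  intros I.
  set (g := fun s => exp (- s) / (1 + s)).
  set (Phi := fun x => RInt g 0 x).
  assert (Cg : forall s, 0 <= s -> continuous g s) by (intros s Hs; unfold g; cont; lra).
  assert (DP : forall x, 0 < x -> is_derive Phi x (g x)).
  { intros x Hx. apply (is_derive_RInt (V := RN) g Phi 0).
    - exists (mkposreal x Hx). intros y Hy.
      apply (RInt_correct (V := RCN)).
      apply (ex_RInt_continuous (V := RCN)). intros z Hz. apply Cg.
      apply Rabs_def2 in Hy. unfold minus, plus, opp in Hy; simpl in Hy.
      rewrite Rmin_left in Hz; lra.
    - apply Cg; lra. }
  assert (LP : filterlim Phi at_oo (locally l)).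
  { intros P HP. destruct (I P HP) as [Q W HQ HW H].
    unfold filtermap. eapply filter_imp; [|apply HW]. intros x Hx.
    destruct (H 0 x HQ Hx) as [y [Iy Py]]. simpl in Iy.
    unfold Phi. unfold g. rewrite (is_RInt_unique _ _ _ _ Iy). exact Py. }
  assert (L0 : filterlim Phi (at_right 0) (locally 0)).
  { apply (filterlim_filter_le_1 (F := locally 0) (G := at_right 0)); [apply filter_le_within|].
    replace 0 with (Phi 0) at 2 by (apply (RInt_point (V := RCN))).
    apply (continuous_R_derive Phi 0 (g 0)).
    apply (is_derive_RInt (V := RN) g Phi 0).
    - exists (mkposreal 1 Rlt_0_1). intros y Hy.
      apply (RInt_correct (V := RCN)).
      apply (ex_RInt_continuous (V := RCN)). intros z Hz.
      apply Rabs_def2 in Hy. unfold minus, plus, opp in Hy; simpl in Hy.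
      unfold g. cont. pose proof (Rmin_glb_lt 0 y (-1) ltac:(lra) ltac:(lra)). lra.
    - apply Cg; lra. }
  assert (IB : is_RInt_gen (beta_integrand 1) (at_right 0) at_oo
     ((1 + 0) - (0 + l))).
  (* The product part is 0 at 0 and 1 at infinity; Phi goes from l, at 1 / (exp h - 1) = oo,
     to 0. *)
  { set (F := fun h => (1 - exp (- h)) * exp (- (exp (- h) / (1 - exp (- h)))) + Phi (/ (exp h - 1))).
    apply (is_RInt_gen_FTC _ _ _ F _ _ _ spans_pos).
    - intros h Hh. pose proof (exp_opp_lt_1 h Hh) as Q. pose proof (exp_gt_1 h Hh) as E.
      assert (S0 : 0 < / (exp h - 1)) by (apply Rinv_0_lt_compat; lra).
      rewrite beta_integrand_q by auto.
      set (q := exp (- h)) in *.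
      assert (Eq : exp h = / q) by (unfold q; rewrite exp_Ropp, Rinv_inv; auto).
      replace (q ^ 1 * exp (- (q / (1 - q)))) with
        ((q + q / (1 - q)) * exp (- (q / (1 - q))) + (- exp h / (exp h - 1) ^ 2) * g (/ (exp h - 1))).
      + apply (is_derive_plus (V := RN)).
        * auto_derive; fold q; [lra|]. change (q * / (1 + - q)) with (q / (1 - q)). set (w := exp (- (q / (1 - q)))). field. lra.
        * apply (is_derive_comp (V := RN) Phi (fun h => / (exp h - 1))); auto.
          auto_derive; [lra|]. field. lra.
      + unfold g. rewrite Eq. replace (/ (/ q - 1)) with (q / (1 - q)) by (field; lra).
        field. lra.
    - intros h Hh. apply continuous_beta_integrand; auto.
    - apply (filterlim_comp_2 (G := locally 0) (H := locally l)
        (fun h => (1 - exp (- h)) * exp (- (exp (- h) / (1 - exp (- h))))) (fun h => Phi (/ (exp h - 1))) Rplus).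
      + apply (filterlim_q_right (fun q => (1 - q) * exp (- (q / (1 - q))))).
        intros q Hq. pose proof (Rabs_q_weight_le q 0 Hq) as B. simpl in B.
        rewrite Rmult_1_l in B. exact B.
      + apply (filterlim_comp _ _ _ (fun h => / (exp h - 1)) Phi _ at_oo); auto.
        apply (filterlim_comp _ _ _ (fun h => exp h - 1) Rinv _ (at_right 0)); [|apply filterlim_Rinv_0_right].
        intros P [e He].
        assert (C : continuous (fun h => exp h - 1) 0) by (cont; auto).
        specialize (C _ (locally_ball _ e)). unfold filtermap in *.
        assert (C' : at_right 0 (fun h => ball (exp 0 - 1) e (exp h - 1))) by (apply filter_le_within; exact C).
        pose proof (spans_left _ _ _ spans_pos) as Pos.
        eapply filter_imp; [|apply filter_and; [apply C'|apply Pos]].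
        intros h [B Hh]. pose proof (exp_gt_1 h Hh). apply He; [|lra].
        rewrite exp_0 in B. replace (1 - 1) with 0 in B by ring. exact B.
      + apply (filterlim_plus (V := RN) 0 l).
    - apply (filterlim_comp_2 (G := locally 1) (H := locally 0)
        (fun h => (1 - exp (- h)) * exp (- (exp (- h) / (1 - exp (- h))))) (fun h => Phi (/ (exp h - 1))) Rplus).
      + pose proof (filterlim_q_infty (fun q => (1 - q) * exp (- (q / (1 - q)))) ltac:(cont; lra)) as L1. cbv beta in L1.
        replace ((1 - 0) * exp (- (0 / (1 - 0)))) with 1 in L1; [exact L1|].
        replace (- (0 / (1 - 0))) with 0 by field. rewrite exp_0; ring.
      + apply (filterlim_comp _ _ _ (fun h => / (exp h - 1)) Phi _ (at_right 0)); auto.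
        intros P [e He]. assert (0 < e) as e0 by apply cond_pos.
        exists (ln (/ e + 1) + 1). intros h Hh.
        assert (0 < / e) by (apply Rinv_0_lt_compat; auto).
        assert (E : / e + 1 < exp h) by (rewrite <- (exp_ln (/ e + 1)) by lra; apply exp_increasing; lra).
        assert (0 < / (exp h - 1)) by (apply Rinv_0_lt_compat; lra).
        apply He; auto. change (Rabs (/ (exp h - 1) - 0) < e). rewrite Rminus_0_r, Rabs_pos_eq by lra.
        rewrite <- (Rinv_inv e). apply Rinv_lt_contravar; [|lra]. apply Rmult_lt_0_compat; lra.
      + apply (filterlim_plus (V := RN) 1 0). }
  unfold beta. rewrite (is_RInt_gen_unique _ _ IB). ring.
Qed.

(** * Complex derivatives with a quadratic error *)

(** For analytic functions the error of the linear approximation is quadratic. Asking for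
    it makes sums, products and compositions a matter of norm estimates, and it is what a
    dominated integrand passes on to its integral. *)
Definition qderiv (f : C -> C) (z l : C) : Prop :=
  exists K d, 0 <= K /\ 0 < d /\
  forall k : C, Cmod k < d -> Cmod (f (z + k) - f z - l * k)%C <= K * Cmod k ^ 2.

Lemma C_derive_qderiv f z l : qderiv f z l -> C_derive f z = l.
Proof.
  intros [K [d [K0 [d0 H]]]]. apply is_C_lim_unique.
  intros P [e He].
  assert (A : forall x : C, Cmod (x - z)%C < Rmin d (e / (K + 1)) -> x <> z ->
    Cmod ((f x - f z) / (x - z) - l)%C < e).
  { intros x Lk Nx. set (k := (x - z)%C) in *.
    assert (Ek : x = (z + k)%C) by (unfold k; ring).
    assert (Nk : k <> RtoC 0).
    { intros E. apply Nx. rewrite Ek, E. ring. }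
    assert (Pk : 0 < Cmod k) by (apply Cmod_gt_0; auto).
    pose proof (Rmin_l d (e / (K + 1))). pose proof (Rmin_r d (e / (K + 1))).
    specialize (H k ltac:(lra)).
    rewrite Ek. replace ((f (z + k) - f z) / k - l)%C with ((f (z + k) - f z - l * k) / k)%C
      by (field; auto).
    rewrite Cmod_div by auto.
    apply Rlt_div_l; auto.
    assert (Cmod k * (K + 1) < e) by (apply Rlt_div_r; lra).
    eapply Rle_lt_trans; [apply H|]. nra. }
  assert (D : 0 < Rmin d (e / (K + 1)) / 2).
  { apply Rdiv_lt_0_compat; [|lra]. apply Rmin_pos; auto.
    apply Rdiv_lt_0_compat; [apply cond_pos|lra]. }
  assert (S2 : sqrt 2 <= 2) by (pose proof (sqrt_sqrt 2 ltac:(lra)); pose proof (sqrt_pos 2); nra).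
  exists (mkposreal _ D). intros x Bx Nx. apply He.
  apply C_NormedModule_mixin_compat1. apply (A x); auto.
  apply C_NormedModule_mixin_compat2 in Bx. simpl pos in Bx.
  eapply Rlt_le_trans; [apply Bx|].
  apply (Rle_trans _ (2 * (Rmin d (e / (K + 1)) / 2))); [apply Rmult_le_compat_r; lra|lra].
Qed.

Lemma qderiv_ext_loc f g z l d : 0 < d -> (forall k, Cmod k < d -> f (z + k)%C = g (z + k)%C) ->
  qderiv f z l -> qderiv g z l.
Proof.
  intros d0 E [K [d' [K0 [d0' H]]]]. exists K, (Rmin d d'). split; auto. split; [apply Rmin_pos; auto|].
  intros k Hk. pose proof (Rmin_l d d'). pose proof (Rmin_r d d').
  rewrite <- E by lra. replace (g z) with (f z).
  - apply H; lra.
  - specialize (E (RtoC 0)). rewrite Cplus_0_r in E. apply E. rewrite Cmod_0; lra.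
Qed.

Lemma qderiv_const a z : qderiv (fun _ => a) z (RtoC 0).
Proof.
  exists 0, 1. split; [lra|]. split; [lra|]. intros k _.
  replace (a - a - 0 * k)%C with (RtoC 0) by ring. rewrite Cmod_0. lra.
Qed.

Lemma qderiv_id z : qderiv (fun z => z) z (RtoC 1).
Proof.
  exists 0, 1. split; [lra|]. split; [lra|]. intros k _.
  replace (z + k - z - 1 * k)%C with (RtoC 0) by ring. rewrite Cmod_0. lra.
Qed.

Lemma qderiv_one_minus z : qderiv (fun z => 1 - z)%C z (- RtoC 1)%C.
Proof.
  exists 0, 1. split; [lra|]. split; [lra|]. intros k _.
  replace (1 - (z + k) - (1 - z) - - (1) * k)%C with (RtoC 0) by ring. rewrite Cmod_0. lra.
Qed.

Lemma qderiv_plus f g z l m : qderiv f z l -> qderiv g z m ->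
  qderiv (fun z => f z + g z)%C z (l + m)%C.
Proof.
  intros [K [d [K0 [d0 H]]]] [K' [d' [K0' [d0' H']]]].
  exists (K + K'), (Rmin d d'). split; [lra|]. split; [apply Rmin_pos; auto|].
  intros k Hk. pose proof (Rmin_l d d'). pose proof (Rmin_r d d').
  specialize (H k ltac:(lra)). specialize (H' k ltac:(lra)).
  replace (f (z + k) + g (z + k) - (f z + g z) - (l + m) * k)%C
    with ((f (z + k) - f z - l * k) + (g (z + k) - g z - m * k))%C by ring.
  eapply Rle_trans; [apply Cmod_triangle|]. lra.
Qed.

Lemma qderiv_increment f z l : qderiv f z l -> exists L d, 0 <= L /\ 0 < d <= 1 /\
  forall k, Cmod k < d -> Cmod (f (z + k) - f z)%C <= L * Cmod k.
Proof.
  intros [K [d [K0 [d0 H]]]]. exists (K + Cmod l), (Rmin d 1).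
  pose proof (Cmod_ge_0 l).
  split; [lra|]. split; [split; [apply Rmin_pos; lra|apply Rmin_r]|].
  intros k Hk. pose proof (Rmin_l d 1). pose proof (Rmin_r d 1). pose proof (Cmod_ge_0 k).
  specialize (H k ltac:(lra)).
  replace (f (z + k) - f z)%C with ((f (z + k) - f z - l * k) + l * k)%C by ring.
  eapply Rle_trans; [apply Cmod_triangle|]. rewrite Cmod_mult.
  assert (Cmod k ^ 2 <= Cmod k) by (simpl; nra).
  nra.
Qed.

Lemma qderiv_mult f g z l m : qderiv f z l -> qderiv g z m ->
  qderiv (fun z => f z * g z)%C z (l * g z + f z * m)%C.
Proof.
  intros F G. destruct (qderiv_increment _ _ _ F) as [L1 [e1 [L10 [E1 I1]]]].
  destruct (qderiv_increment _ _ _ G) as [L2 [e2 [L20 [E2 I2]]]].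
  destruct F as [K [d [K0 [d0 H]]]]. destruct G as [K' [d' [K0' [d0' H']]]].
  exists (K * Cmod (g z) + K' * Cmod (f z) + L1 * L2), (Rmin (Rmin d d') (Rmin e1 e2)).
  pose proof (Cmod_ge_0 (g z)). pose proof (Cmod_ge_0 (f z)).
  split; [nra|]. split; [repeat apply Rmin_pos; lra|].
  intros k Hk. pose proof (Rmin_l d d'). pose proof (Rmin_r d d').
  pose proof (Rmin_l e1 e2). pose proof (Rmin_r e1 e2).
  pose proof (Rmin_l (Rmin d d') (Rmin e1 e2)). pose proof (Rmin_r (Rmin d d') (Rmin e1 e2)).
  specialize (H k ltac:(lra)). specialize (H' k ltac:(lra)).
  specialize (I1 k ltac:(lra)). specialize (I2 k ltac:(lra)).
  replace (f (z + k) * g (z + k) - f z * g z - (l * g z + f z * m) * k)%C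
    with ((f (z + k) - f z - l * k) * g z + (g (z + k) - g z - m * k) * f z
          + (f (z + k) - f z) * (g (z + k) - g z))%C by ring.
  eapply Rle_trans; [apply Cmod_triangle|].
  eapply Rle_trans; [apply Rplus_le_compat_r, Cmod_triangle|].
  rewrite !Cmod_mult.
  assert (Cmod (f (z + k) - f z)%C * Cmod (g (z + k) - g z)%C <= (L1 * Cmod k) * (L2 * Cmod k)).
  { apply Rmult_le_compat; auto using Cmod_ge_0. }
  assert (Cmod (f (z + k) - f z - l * k)%C * Cmod (g z) <= (K * Cmod k ^ 2) * Cmod (g z))
    by (apply Rmult_le_compat_r; auto).
  assert (Cmod (g (z + k) - g z - m * k)%C * Cmod (f z) <= (K' * Cmod k ^ 2) * Cmod (f z))
    by (apply Rmult_le_compat_r; auto).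
  simpl in *. lra.
Qed.

Lemma qderiv_scal a f z l : qderiv f z l -> qderiv (fun z => a * f z)%C z (a * l)%C.
Proof.
  intros D. replace (a * l)%C with (RtoC 0 * f z + a * l)%C by ring.
  apply (qderiv_mult (fun _ => a) f); auto using qderiv_const.
Qed.

Lemma qderiv_comp f g z l m : qderiv g z l -> qderiv f (g z) m ->
  qderiv (fun z => f (g z)) z (m * l)%C.
Proof.
  intros G F. destruct (qderiv_increment _ _ _ G) as [L [e [L0 [E I]]]].
  destruct F as [K [d [K0 [d0 H]]]]. destruct G as [K' [d' [K0' [d0' H']]]].
  exists (K * L ^ 2 + Cmod m * K'), (Rmin d' (Rmin e (d / (L + 1)))).
  pose proof (Cmod_ge_0 m).
  assert (0 <= L ^ 2) by (apply pow_le; auto).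
  split; [nra|].
  assert (0 < d / (L + 1)) by (apply Rdiv_lt_0_compat; lra).
  split; [repeat apply Rmin_pos; lra|].
  intros k Hk. pose proof (Rmin_l d' (Rmin e (d / (L + 1)))).
  pose proof (Rmin_r d' (Rmin e (d / (L + 1)))).
  pose proof (Rmin_l e (d / (L + 1))). pose proof (Rmin_r e (d / (L + 1))).
  pose proof (Cmod_ge_0 k).
  specialize (H' k ltac:(lra)). specialize (I k ltac:(lra)).
  set (j := (g (z + k) - g z)%C) in *.
  assert (Cmod k * (L + 1) < d) by (apply Rlt_div_r; lra).
  specialize (H j ltac:(nra)).
  replace (g z + j)%C with (g (z + k)%C) in H by (unfold j; ring).
  replace (f (g (z + k)%C) - f (g z) - m * l * k)%C
    with ((f (g (z + k)%C) - f (g z) - m * j) + m * (g (z + k) - g z - l * k))%C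
    by (unfold j; ring).
  eapply Rle_trans; [apply Cmod_triangle|]. rewrite Cmod_mult. fold j.
  assert (Cmod j ^ 2 <= (L * Cmod k) ^ 2) by (apply pow_incr; split; auto using Cmod_ge_0).
  assert (K * Cmod j ^ 2 <= K * (L * Cmod k) ^ 2) by (apply Rmult_le_compat_l; auto).
  assert (Cmod m * Cmod (j - l * k)%C <= Cmod m * (K' * Cmod k ^ 2))
    by (apply Rmult_le_compat_l; auto).
  simpl in *. nra.
Qed.

Lemma qderiv_inv z : z <> RtoC 0 -> qderiv (fun z => / z)%C z (- / (z * z))%C.
Proof.
  intros Nz. assert (Pz : 0 < Cmod z) by (apply Cmod_gt_0; auto).
  exists (2 / Cmod z ^ 3), (Cmod z / 2).
  split. { apply Rlt_le, Rdiv_lt_0_compat; [lra|apply pow_lt; auto]. }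
  split; [lra|]. intros k Hk.
  assert (B : Cmod z / 2 <= Cmod (z + k)%C).
  { pose proof (Cmod_triangle (z + k) (- k)) as T. rewrite Cmod_opp in T.
    replace (z + k + - k)%C with z in T by ring. lra. }
  assert (Nk : (z + k)%C <> RtoC 0) by (intros E; rewrite E, Cmod_0 in B; lra).
  replace (/ (z + k) - / z - - / (z * z) * k)%C with (k * k / (z * z * (z + k)))%C
    by (field; auto).
  rewrite Cmod_div, !Cmod_mult.
  2:{ intros E. apply (f_equal Cmod) in E. rewrite !Cmod_mult, Cmod_0 in E.
      assert (0 < Cmod z * Cmod z * Cmod (z + k)) by (repeat apply Rmult_lt_0_compat; lra). lra. }
  apply (Rle_trans _ (Cmod k * Cmod k / (Cmod z * Cmod z * (Cmod z / 2)))).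
  - apply Rmult_le_compat_l; [pose proof (Cmod_ge_0 k); nra|].
    apply Rinv_le_contravar; [repeat apply Rmult_lt_0_compat; lra|].
    apply Rmult_le_compat_l; nra.
  - right. field. lra.
Qed.

Lemma qderiv_Re f z s l : qderiv f (z + RtoC s)%C l ->
  is_derive (fun s => Re (f (z + RtoC s)%C)) s (Re l) /\
  is_derive (fun s => Im (f (z + RtoC s)%C)) s (Im l).
Proof.
  intros [K [d [K0 [d0 H]]]].
  assert (B : forall e, 0 < e -> exists d', 0 < d' /\ forall h : R, h <> 0 -> Rabs h < d' ->
    Cmod ((f (z + RtoC (s + h)) - f (z + RtoC s)) / RtoC h - l)%C < e).
  { intros e He. exists (Rmin d (e / (K + 1))).
    split. { apply Rmin_pos; auto. apply Rdiv_lt_0_compat; lra. }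
    intros h Nh Hh. pose proof (Rmin_l d (e / (K + 1))). pose proof (Rmin_r d (e / (K + 1))).
    specialize (H (RtoC h)). rewrite Cmod_R in H. specialize (H ltac:(lra)).
    assert (Ph : 0 < Rabs h) by (apply Rabs_pos_lt; auto).
    assert (Nh' : RtoC h <> RtoC 0) by (intros E; apply Nh, RtoC_inj, E).
    rewrite RtoC_plus, Cplus_assoc.
    replace ((f (z + s + h) - f (z + s)) / h - l)%C with ((f (z + s + h) - f (z + s) - l * h) / h)%C
      by (field; auto).
    rewrite Cmod_div, Cmod_R by auto. apply Rlt_div_l; auto.
    assert (Rabs h * (K + 1) < e) by (apply Rlt_div_r; lra).
    eapply Rle_lt_trans; [apply H|]. nra. }
  split; apply is_derive_Reals; intros e He; destruct (B e He) as [d' [P' H']];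
    exists (mkposreal d' P'); intros h Nh Hh; specialize (H' h Nh Hh).
  - eapply Rle_lt_trans; [|apply H']. eapply Rle_trans; [|apply re_le_Cmod]. right. f_equal.
    unfold Cdiv. rewrite <- RtoC_inv by auto.
    destruct (f (z + RtoC (s + h))%C) as [a b], (f (z + RtoC s)%C) as [a' b'], l as [l1 l2].
    simpl. field. auto.
  - eapply Rle_lt_trans; [|apply H'].
    eapply Rle_trans; [|eapply Rle_trans; [apply Rmax_r|apply Rmax_Cmod]]. right. f_equal.
    unfold Cdiv. rewrite <- RtoC_inv by auto.
    destruct (f (z + RtoC (s + h))%C) as [a b], (f (z + RtoC s)%C) as [a' b'], l as [l1 l2].
    simpl. field. auto.
Qed.

(** * The complex exponential *)

Lemma smooth_sin_cos : smooth sin /\ smooth cos.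
Proof.
  enough (H : forall n, Cn n sin /\ Cn n cos) by (split; intros n; apply H).
  induction n as [|n [IS IC]]; [simpl; auto|]. split.
  - exists cos. split; auto. intros x. apply is_derive_sin.
  - exists (fun x => -1 * sin x). split; [|apply Cn_mult; auto using Cn_const].
    intros x. replace (-1 * sin x) with (- sin x) by ring. apply is_derive_cos.
Qed.

Lemma Cmod_le_Rabs (z : C) : Cmod z <= 2 * (Rabs (Re z) + Rabs (Im z)).
Proof.
  eapply Rle_trans; [apply Cmod_2Rmax|].
  assert (S2 : sqrt 2 <= 2) by (pose proof (sqrt_sqrt 2 ltac:(lra)); pose proof (sqrt_pos 2); nra).
  pose proof (sqrt_pos 2). pose proof (Rabs_pos (Re z)). pose proof (Rabs_pos (Im z)).
  apply Rmult_le_compat; auto.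
  - apply (Rle_trans _ (Rabs (fst z))); [apply H0|apply Rmax_l].
  - apply Rmax_lub; unfold Re, Im in *; lra.
Qed.

Lemma Cexp_taylor : exists K, 0 <= K /\ forall k, Cmod k < 1 ->
  Cmod (Cexp k - 1 - k)%C <= K * Cmod k ^ 2.
Proof.
  destruct smooth_sin_cos as [Ss Sc].
  destruct (taylor_near_0 exp 2 (fun n => Cn_exp n)) as [K1 [K10 H1]].
  destruct (taylor_near_0 sin 2 Ss) as [K2 [K20 H2]].
  destruct (taylor_near_0 cos 2 Sc) as [K3 [K30 H3]].
  (* 3 bounds exp on the unit disk, and 2 bounds the norm by the two components. *)
  exists (2 * (3 * K3 + K1 + (1 + K1) * (1 + K2) + K2)). split; [nra|].
  intros [x y] Hk.
  pose proof (re_le_Cmod (x, y)) as Rx. simpl in Rx.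
  assert (Ry : Rabs y <= Cmod (x, y)).
  { eapply Rle_trans; [|apply Rmax_Cmod]. apply Rmax_r. }
  set (r := Cmod (x, y)) in *.
  assert (r0 : 0 <= r) by apply Cmod_ge_0.
  specialize (H1 x ltac:(lra)). specialize (H2 y ltac:(lra)). specialize (H3 y ltac:(lra)).
  assert (Me : R_maclaurin exp 0 = 1 /\ R_maclaurin exp 1 = 1).
  { unfold R_maclaurin; change (Derive_n exp 1 0) with (Derive exp 0);
    rewrite (is_derive_unique _ _ _ (is_derive_exp 0)); simpl; rewrite ?exp_0, ?sin_0, ?cos_0; split; field. }
  assert (Ms : R_maclaurin sin 0 = 0 /\ R_maclaurin sin 1 = 1).
  { unfold R_maclaurin; change (Derive_n sin 1 0) with (Derive sin 0);
    rewrite (is_derive_unique _ _ _ (is_derive_sin 0)); simpl; rewrite ?exp_0, ?sin_0, ?cos_0; split; field. }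
  assert (Mc : R_maclaurin cos 0 = 1 /\ R_maclaurin cos 1 = 0).
  { unfold R_maclaurin; change (Derive_n cos 1 0) with (Derive cos 0);
    rewrite (is_derive_unique _ _ _ (is_derive_cos 0)); simpl; rewrite ?exp_0, ?sin_0, ?cos_0; split; field. }
  simpl psum in H1, H2, H3.
  rewrite (proj1 Me), (proj2 Me) in H1. rewrite (proj1 Ms), (proj2 Ms) in H2.
  rewrite (proj1 Mc), (proj2 Mc) in H3.
  replace (exp x - (0 + 1 * 1 + 1 * (x * 1))) with (exp x - 1 - x) in H1 by ring.
  replace (sin y - (0 + 0 * 1 + 1 * (y * 1))) with (sin y - y) in H2 by ring.
  replace (cos y - (0 + 1 * 1 + 0 * (y * 1))) with (cos y - 1) in H3 by ring.
  assert (X2 : Rabs x ^ 2 <= r ^ 2) by (apply pow_incr; split; auto using Rabs_pos).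
  assert (Y2 : Rabs y ^ 2 <= r ^ 2) by (apply pow_incr; split; auto using Rabs_pos).
  pose proof (Rabs_pos x) as X0. pose proof (Rabs_pos y) as Y0.
  assert (Ex : exp x <= 3).
  { apply (Rle_trans _ (exp 1)); [|apply exp_le_3]. apply exp_monotone.
    pose proof (Rle_abs x); lra. }
  pose proof (exp_pos x) as Ep.
  eapply Rle_trans; [apply Cmod_le_Rabs|]. rewrite Rmult_assoc. apply Rmult_le_compat_l; [lra|].
  unfold Cexp; simpl.
  replace (exp x * cos y + - (1) + - x) with (exp x * (cos y - 1) + (exp x - 1 - x)) by ring.
  replace (exp x * sin y + - 0 + - y) with ((exp x - 1) * sin y + (sin y - y)) by ring.
  assert (A1 : Rabs (exp x * (cos y - 1) + (exp x - 1 - x)) <= (3 * K3 + K1) * r ^ 2).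
  { eapply Rle_trans; [apply Rabs_triang|]. rewrite Rabs_mult, (Rabs_pos_eq (exp x)) by lra.
    pose proof (Rabs_pos (cos y - 1)).
    assert (Rabs (cos y - 1) <= K3 * r ^ 2) by nra.
    assert (exp x * Rabs (cos y - 1) <= 3 * (K3 * r ^ 2)) by (apply Rmult_le_compat; lra).
    nra. }
  assert (B1 : Rabs (exp x - 1) <= (1 + K1) * r).
  { replace (exp x - 1) with ((exp x - 1 - x) + x) by ring.
    eapply Rle_trans; [apply Rabs_triang|]. assert (r ^ 2 <= r) by (simpl; nra). nra. }
  assert (B2 : Rabs (sin y) <= (1 + K2) * r).
  { replace (sin y) with ((sin y - y) + y) by ring.
    eapply Rle_trans; [apply Rabs_triang|]. assert (r ^ 2 <= r) by (simpl; nra). nra. }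
  assert (A2 : Rabs ((exp x - 1) * sin y + (sin y - y)) <= ((1 + K1) * (1 + K2) + K2) * r ^ 2).
  { eapply Rle_trans; [apply Rabs_triang|]. rewrite Rabs_mult.
    assert (Rabs (exp x - 1) * Rabs (sin y) <= ((1 + K1) * r) * ((1 + K2) * r))
      by (apply Rmult_le_compat; auto using Rabs_pos).
    nra. }
  simpl in *. lra.
Qed.

Lemma Cexp_plus z w : Cexp (z + w) = (Cexp z * Cexp w)%C.
Proof.
  destruct z as [a b], w as [a' b']. unfold Cexp; simpl.
  rewrite exp_plus, cos_plus, sin_plus. unfold Cmult; simpl. f_equal; ring.
Qed.

Lemma Cexp_0 : Cexp (RtoC 0) = RtoC 1.
Proof. unfold Cexp; simpl. rewrite exp_0, cos_0, sin_0. unfold RtoC. f_equal; ring. Qed.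

Lemma Cmod_Cexp z : Cmod (Cexp z) = exp (Re z).
Proof.
  unfold Cmod, Cexp; simpl.
  replace (exp (Re z) * cos (Im z) * (exp (Re z) * cos (Im z) * 1) +
     exp (Re z) * sin (Im z) * (exp (Re z) * sin (Im z) * 1))
    with (Rsqr (exp (Re z)) * (Rsqr (sin (Im z)) + Rsqr (cos (Im z)))) by (unfold Rsqr; ring).
  rewrite sin2_cos2, Rmult_1_r. apply sqrt_Rsqr, Rlt_le, exp_pos.
Qed.

Lemma qderiv_Cexp z : qderiv Cexp z (Cexp z).
Proof.
  destruct Cexp_taylor as [K [K0 H]].
  exists (Cmod (Cexp z) * K), 1. split; [apply Rmult_le_pos; auto using Cmod_ge_0|].
  split; [lra|]. intros k Hk. rewrite Cexp_plus.
  replace (Cexp z * Cexp k - Cexp z - Cexp z * k)%C with (Cexp z * (Cexp k - 1 - k))%C by ring.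
  rewrite Cmod_mult, Rmult_assoc. apply Rmult_le_compat_l; auto using Cmod_ge_0.
Qed.

(** * The exponential integral *)

Definition E1_ker (t : C) : C := (Cexp (- t) / t)%C.

Definition E1_ker' (t : C) : C := (- (Cexp (- t) * (/ t + / (t * t))))%C.

Lemma Re_pos_neq_0 (z : C) : 0 < Re z -> z <> RtoC 0.
Proof. intros H E. rewrite E in H. simpl in H. lra. Qed.

Lemma Rabs_Re_Im_le (z : C) : Rabs (Re z) <= Cmod z /\ Rabs (Im z) <= Cmod z.
Proof.
  split; [apply re_le_Cmod|]. eapply Rle_trans; [|apply Rmax_Cmod]. apply Rmax_r.
Qed.

(** Writing [exp (- k) = 1 - k + rho], the difference is [exp (- t)] times
    [rho / (t + k) + k^2 / (t^2 (t + k)) + k^2 / (t (t + k))].  The factor [exp (- Re t)] is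
    what makes the bound integrable along a ray. *)
Lemma E1_ker_increment r : 0 < r -> exists K, 0 <= K /\ forall t k : C,
  r <= Re t -> Cmod k < Rmin 1 (r / 2) ->
  Cmod (E1_ker (t + k) - E1_ker t - k * E1_ker' t)%C <= K * Cmod k ^ 2 * exp (- Re t).
Proof.
  intros Hr. destruct Cexp_taylor as [K [K0 H]].
  exists (K * (2 / r) + (2 / r ^ 3 + 2 / r ^ 2)).
  assert (P1 : 0 < 2 / r) by (apply Rdiv_lt_0_compat; lra).
  assert (P2 : 0 < 2 / r ^ 2) by (apply Rdiv_lt_0_compat; [lra|apply pow_lt; auto]).
  assert (P3 : 0 < 2 / r ^ 3) by (apply Rdiv_lt_0_compat; [lra|apply pow_lt; auto]).
  split; [nra|]. intros t k Ht Hk.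
  pose proof (Rmin_l 1 (r / 2)). pose proof (Rmin_r 1 (r / 2)).
  pose proof (Rabs_Re_Im_le k) as [Rk _]. pose proof (Rle_abs (- Re k)) as Rk'.
  rewrite Rabs_Ropp in Rk'.
  assert (Tk : r / 2 <= Re (t + k)) by (destruct t, k; simpl in *; lra).
  assert (Nt : t <> RtoC 0) by (apply Re_pos_neq_0; lra).
  assert (Ntk : (t + k)%C <> RtoC 0) by (apply Re_pos_neq_0; lra).
  specialize (H (- k)%C). rewrite Cmod_opp in H. specialize (H ltac:(lra)).
  set (rho := (Cexp (- k) - 1 - - k)%C) in *.
  replace (E1_ker (t + k) - E1_ker t - k * E1_ker' t)%C
    with (Cexp (- t) * (rho / (t + k) + (k * k / (t * t * (t + k)) + k * k / (t * (t + k)))))%C.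
  2:{ unfold E1_ker, E1_ker'. replace (- (t + k))%C with (- t + - k)%C by ring. rewrite Cexp_plus.
      replace (Cexp (- k)) with (rho + 1 - k)%C by (unfold rho; ring).
      field. auto. }
  rewrite Cmod_mult, Cmod_Cexp. rewrite Rmult_comm.
  replace (Re (- t)%C) with (- Re t) by (destruct t; reflexivity).
  apply Rmult_le_compat_r; [apply Rlt_le, exp_pos|].
  assert (Mt : r <= Cmod t).
  { eapply Rle_trans; [apply Ht|]. eapply Rle_trans; [apply Rle_abs|apply re_le_Cmod]. }
  assert (Mtk : r / 2 <= Cmod (t + k)%C).
  { eapply Rle_trans; [apply Tk|]. eapply Rle_trans; [apply Rle_abs|apply re_le_Cmod]. }
  assert (Q : 0 <= Cmod k ^ 2) by (apply pow_le, Cmod_ge_0).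
  assert (DIV : forall u w : C, w <> RtoC 0 -> forall a b, Cmod u <= a -> 0 < b -> b <= Cmod w ->
    Cmod (u / w)%C <= a / b).
  { intros u w Nw a b Ha Hb Hw. rewrite Cmod_div by auto. unfold Rdiv.
    apply Rmult_le_compat; auto using Cmod_ge_0.
    - apply Rlt_le, Rinv_0_lt_compat; lra.
    - apply Rinv_le_contravar; auto. }
  assert (NM : forall u w : C, u <> RtoC 0 -> w <> RtoC 0 -> (u * w)%C <> RtoC 0).
  { intros u w Nu Nw E. apply (f_equal Cmod) in E. rewrite Cmod_mult, Cmod_0 in E.
    apply Cmod_gt_0 in Nu. apply Cmod_gt_0 in Nw. nra. }
  assert (B1 : Cmod (rho / (t + k))%C <= K * Cmod k ^ 2 / (r / 2)) by (apply DIV; auto; lra).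
  assert (B2 : Cmod (k * k / (t * t * (t + k)))%C <= Cmod k ^ 2 / (r * r * (r / 2))).
  { apply DIV; auto.
    - rewrite Cmod_mult. right; ring.
    - repeat apply Rmult_lt_0_compat; lra.
    - rewrite !Cmod_mult. apply Rmult_le_compat; try lra; [nra|]. apply Rmult_le_compat; lra. }
  assert (B3 : Cmod (k * k / (t * (t + k)))%C <= Cmod k ^ 2 / (r * (r / 2))).
  { apply DIV; auto.
    - rewrite Cmod_mult. right; ring.
    - repeat apply Rmult_lt_0_compat; lra.
    - rewrite !Cmod_mult. apply Rmult_le_compat; lra. }
  eapply Rle_trans; [apply Cmod_triangle|].
  eapply Rle_trans; [apply Rplus_le_compat; [apply B1|]|].
  - eapply Rle_trans; [apply Cmod_triangle|]. apply Rplus_le_compat; [apply B2|apply B3].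
  - right. field. lra.
Qed.

Lemma qderiv_E1_ker t : 0 < Re t -> qderiv E1_ker t (E1_ker' t).
Proof.
  intros Ht. destruct (E1_ker_increment (Re t) Ht) as [K [K0 H]].
  exists (K * exp (- Re t)), (Rmin 1 (Re t / 2)).
  split; [apply Rmult_le_pos; auto; apply Rlt_le, exp_pos|].
  split; [apply Rmin_pos; lra|].
  intros k Hk. rewrite (Cmult_comm (E1_ker' t)).
  eapply Rle_trans; [apply H; auto; lra|]. right; ring.
Qed.

Lemma qderiv_E1_ker' t : 0 < Re t -> exists l, qderiv E1_ker' t l.
Proof.
  intros Ht. pose proof (Re_pos_neq_0 t Ht) as Nt.
  assert (D : exists l, qderiv (fun t => - RtoC 1 * (Cexp (- RtoC 1 * t) * (/ t + / t * / t)))%C t l).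
  { eexists. apply (qderiv_scal (- RtoC 1)%C (fun t => Cexp (- RtoC 1 * t) * (/ t + / t * / t))%C).
    apply qderiv_mult.
    - apply (qderiv_comp Cexp); [|apply qderiv_Cexp]. apply (qderiv_scal _ (fun t => t)), qderiv_id.
    - apply qderiv_plus; [apply qderiv_inv; auto|]. apply qderiv_mult; apply qderiv_inv; auto. }
  destruct D as [l D]. exists l. revert D. apply (qderiv_ext_loc _ _ _ _ (Re t)); auto.
  intros k Hk. unfold E1_ker'.
  assert (N : (t + k)%C <> RtoC 0).
  { apply Re_pos_neq_0. pose proof (Rabs_Re_Im_le k) as [Rk _]. pose proof (Rle_abs (- Re k)) as Rk'.
    rewrite Rabs_Ropp in Rk'. destruct t, k; simpl in *; lra. }
  replace (- RtoC 1 * (t + k))%C with (- (t + k))%C by ring.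
  field. auto.
Qed.

Lemma Re_plus_RtoC z s : Re (z + RtoC s)%C = Re z + s.
Proof. destruct z; reflexivity. Qed.

Lemma is_RInt_gen_exp_opp :
  is_RInt_gen (fun s => exp (- s)) (at_point 0) at_oo 1.
Proof.
  replace 1 with (0 - (-1)) by ring.
  apply (is_RInt_gen_FTC _ _ _ (fun s => - exp (- s)) _ _ _ spans_nonneg).
  - intros s _. auto_derive; auto. ring.
  - intros s _. cont; auto.
  - intros P HP. unfold filtermap, at_point. rewrite Ropp_0, exp_0.
    apply (locally_singleton _ _ HP).
  - replace 0 with (- 0) by ring.
    apply (filterlim_comp _ _ _ (fun s => exp (- s)) Ropp _ (locally 0)).
    + apply filterlim_exp_opp_p.
    + apply (filterlim_opp (V := RN)).
Qed.

(** The integral [E1] is defined by its real and imaginary parts, and both are treated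
    alike. *)
Definition is_part (p : C -> R) : Prop := p = Re \/ p = Im.

Lemma Rabs_part_le p (w : C) : is_part p -> Rabs (p w) <= Cmod w.
Proof. intros [-> | ->]; apply Rabs_Re_Im_le. Qed.

Lemma is_derive_part p f z s l : is_part p -> qderiv f (z + RtoC s)%C l ->
  is_derive (fun s => p (f (z + RtoC s)%C)) s (p l).
Proof. intros [-> | ->] D; apply (qderiv_Re f z s l D). Qed.

Lemma Cmod_E1_ker_le z s : 0 < Re z -> 0 <= s -> Cmod (E1_ker (z + RtoC s)%C) <= / Re z * exp (- s).
Proof.
  intros Hz Hs. unfold E1_ker.
  assert (R : Re (z + RtoC s)%C = Re z + s) by apply Re_plus_RtoC.
  rewrite Cmod_div by (apply Re_pos_neq_0; lra). rewrite Cmod_Cexp.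
  replace (Re (- (z + RtoC s))%C) with (- (Re z + s)) by (destruct z; simpl; ring).
  unfold Rdiv. rewrite Rmult_comm.
  apply Rmult_le_compat; try (apply Rlt_le, exp_pos).
  - apply Rlt_le, Rinv_0_lt_compat, Cmod_gt_0, Re_pos_neq_0. lra.
  - apply Rinv_le_contravar; auto. rewrite <- (Rplus_0_r (Re z)).
    apply (Rle_trans _ (Re (z + RtoC s)%C)); [lra|].
    eapply Rle_trans; [apply Rle_abs|apply re_le_Cmod].
  - apply exp_monotone; lra.
Qed.

Lemma E1_correct p z : is_part p -> 0 < Re z ->
  is_RInt_gen (fun s => p (E1_ker (z + RtoC s)%C)) (at_point 0) at_oo (p (Defs.E1 z)).
Proof.
  intros Hp Hz.
  assert (E : p (Defs.E1 z) = RInt_gen (fun s => p (E1_ker (z + RtoC s)%C)) (at_point 0) at_oo)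
    by (destruct Hp as [-> | ->]; reflexivity).
  pose proof (is_RInt_gen_Rscal _ (/ (Re z)) _ is_RInt_gen_exp_opp) as I0.
  assert (EX : exists l, is_RInt_gen (fun s => p (E1_ker (z + RtoC s)%C)) (at_point 0) at_oo l).
  { refine (ex_RInt_gen_dominated _ _ _ _ _ _ spans_nonneg _ _ _ I0).
    - intros s Hs. eapply continuous_R_derive. apply is_derive_part; auto.
      apply qderiv_E1_ker. rewrite Re_plus_RtoC; lra.
    - intros s _. cont; auto.
    - intros s Hs. eapply Rle_trans; [apply Rabs_part_le; auto|]. apply (Cmod_E1_ker_le z s Hz Hs). }
  destruct EX as [l Hl]. rewrite E, (is_RInt_gen_unique _ _ Hl). exact Hl.
Qed.

Lemma E1_ker_infty p z (k : C) : is_part p -> 0 < Re z ->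
  filterlim (fun s => p (k * E1_ker (z + RtoC s))%C) at_oo (locally 0).
Proof.
  intros Hp Hz P [e He].
  pose proof (Cmod_ge_0 k). pose proof (Rinv_0_lt_compat _ Hz).
  assert (e1 : 0 < e / (Cmod k * / Re z + 1)).
  { apply Rdiv_lt_0_compat; [apply cond_pos|]. nra. }
  destruct (filterlim_exp_opp_p _ (locally_ball 0 (mkposreal _ e1))) as [M HM].
  exists (Rmax M 0). intros s Hs. pose proof (Rmax_l M 0). pose proof (Rmax_r M 0).
  specialize (HM s ltac:(lra)). change (Rabs (exp (- s) - 0) < e / (Cmod k * / Re z + 1)) in HM.
  rewrite Rminus_0_r, Rabs_pos_eq in HM by (apply Rlt_le, exp_pos).
  apply He. change (Rabs (p (k * E1_ker (z + RtoC s))%C - 0) < e). rewrite Rminus_0_r.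
  eapply Rle_lt_trans; [apply Rabs_part_le; auto|]. rewrite Cmod_mult.
  pose proof (Cmod_E1_ker_le z s Hz ltac:(lra)) as B. pose proof (exp_pos (- s)).
  apply Rlt_div_r in HM; [|nra].
  assert (Cmod k * Cmod (E1_ker (z + RtoC s)%C) <= Cmod k * (/ Re z * exp (- s)))
    by (apply Rmult_le_compat_l; auto).
  nra.
Qed.

(** As [E1_ker] vanishes at infinity, only the boundary term at [z] remains. *)
Lemma is_RInt_gen_E1_ker' p z (k : C) : is_part p -> 0 < Re z ->
  is_RInt_gen (fun s => p (k * E1_ker' (z + RtoC s))%C) (at_point 0) at_oo (- p (k * E1_ker z)%C).
Proof.
  intros Hp Hz.
  assert (P : forall s, 0 <= s -> 0 < Re (z + RtoC s)%C) by (intros; rewrite Re_plus_RtoC; lra).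
  rewrite <- (Rminus_0_l (p (k * E1_ker z)%C)).
  apply (is_RInt_gen_FTC _ _ _ (fun s => p (k * E1_ker (z + RtoC s))%C) _ _ _ spans_nonneg).
  - intros s Hs. apply (is_derive_part p (fun t => k * E1_ker t)%C); auto.
    apply qderiv_scal, qderiv_E1_ker; auto.
  - intros s Hs. destruct (qderiv_E1_ker' _ (P s Hs)) as [l Hl].
    eapply continuous_R_derive. apply (is_derive_part p (fun t => k * E1_ker' t)%C); auto.
    apply qderiv_scal, Hl.
  - intros Q HQ. unfold filtermap, at_point. rewrite Cplus_0_r. apply (locally_singleton _ _ HQ).
  - apply E1_ker_infty; auto.
Qed.

(** Differentiation under the integral sign: the error of the linear approximation of the
    integrand is quadratic with a constant proportional to [exp (- s)]. *)
Lemma qderiv_E1 z : 0 < Re z -> qderiv Defs.E1 z (- E1_ker z)%C.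
Proof.
  intros Hz. destruct (E1_ker_increment (Re z) Hz) as [K [K0 H]].
  exists (4 * K), (Rmin 1 (Re z / 2)). split; [lra|]. split; [apply Rmin_pos; lra|].
  intros k Hk.
  pose proof (Rmin_r 1 (Re z / 2)).
  pose proof (Rabs_Re_Im_le k) as [Rk _]. pose proof (Rle_abs (- Re k)) as Rk'.
  rewrite Rabs_Ropp in Rk'.
  assert (Hzk : 0 < Re (z + k)%C) by (destruct z, k; simpl in *; lra).
  pose proof (is_RInt_gen_Rscal _ (K * Cmod k ^ 2) _ is_RInt_gen_exp_opp) as I0.
  rewrite Rmult_1_r in I0.
  assert (B : forall s, 0 <= s ->
    Cmod (E1_ker (z + k + RtoC s) - E1_ker (z + RtoC s) - k * E1_ker' (z + RtoC s))%C <= K * Cmod k ^ 2 * exp (- s)).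
  { intros s Hs. replace (z + k + RtoC s)%C with (z + RtoC s + k)%C by ring.
    eapply Rle_trans; [apply H; auto; rewrite Re_plus_RtoC; lra|].
    apply Rmult_le_compat_l; [apply Rmult_le_pos; auto; apply pow_le, Cmod_ge_0|].
    apply exp_monotone. rewrite Re_plus_RtoC. lra. }
  assert (BP : forall p, is_part p -> Rabs (p (Defs.E1 (z + k) - Defs.E1 z - - E1_ker z * k)%C) <= K * Cmod k ^ 2).
  { intros p Hp.
    pose proof (is_RInt_gen_Rminus _ _ _ _ (is_RInt_gen_Rminus _ _ _ _ (E1_correct p _ Hp Hzk)
      (E1_correct p z Hp Hz)) (is_RInt_gen_E1_ker' p z k Hp Hz)) as I1.
    assert (S : forall u v : C, p (u - v)%C = p u - p v) by (destruct Hp as [-> | ->]; reflexivity).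
    assert (S' : forall u : C, p (- u)%C = - p u) by (destruct Hp as [-> | ->]; reflexivity).
    replace (- E1_ker z * k)%C with (- (k * E1_ker z))%C by ring. rewrite !S, S'.
    refine (Rabs_RInt_gen_le _ _ _ _ _ _ _ spans_nonneg _ I1 I0).
    intros s Hs. eapply Rle_trans; [|apply (B s Hs)]. rewrite <- !S. apply Rabs_part_le; auto. }
  pose proof (BP Re (or_introl eq_refl)). pose proof (BP Im (or_intror eq_refl)).
  eapply Rle_trans; [apply Cmod_le_Rabs|]. lra.
Qed.

(** * Maclaurin coefficients from a differential equation *)

Lemma one_minus_neq_0 (z : C) : Cmod z < 1 -> (1 - z)%C <> RtoC 0.
Proof.
  intros H E. assert (z = RtoC 1) by (replace z with (1 - (1 - z))%C by ring; rewrite E; ring).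
  subst z. rewrite Cmod_1 in H. lra.
Qed.

Lemma Cmod_lt_1_open (z : C) : Cmod z < 1 -> forall k, Cmod k < 1 - Cmod z -> Cmod (z + k)%C < 1.
Proof. intros H k Hk. eapply Rle_lt_trans; [apply Cmod_triangle|]. lra. Qed.

Lemma qderiv_mobius z : Cmod z < 1 ->
  qderiv (fun z => RtoC 1 / (RtoC 1 - z))%C z (1 / ((1 - z) * (1 - z)))%C.
Proof.
  intros H. pose proof (one_minus_neq_0 z H) as N.
  pose proof (qderiv_comp (fun w => / w)%C _ _ _ _ (qderiv_one_minus z) (qderiv_inv _ N)) as D.
  cbv beta in D.
  replace (1 / ((1 - z) * (1 - z)))%C with (- / ((1 - z) * (1 - z)) * - (1))%C by (field; auto).
  revert D. apply (qderiv_ext_loc _ _ _ _ (1 - Cmod z)); [lra|]. intros k Hk.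
  pose proof (one_minus_neq_0 _ (Cmod_lt_1_open z H k Hk)). field. auto.
Qed.

(** This is [(1 - z)^2 f' = f - kappa (1 - z)], solved for [f']: one equation for both
    functions, so that their coefficients are treated together. *)
Definition disk_ode (f : C -> C) (kappa : R) : Prop :=
  forall z, Cmod z < 1 -> qderiv f z ((f z - RtoC kappa * (1 - z)) / ((1 - z) * (1 - z)))%C.

(** Here [z / (1 - z) = 1 / (1 - z) - 1]. *)
Lemma disk_ode_f0 : disk_ode f0 0.
Proof.
  intros z H. pose proof (one_minus_neq_0 z H) as N.
  assert (D : qderiv (fun z => RtoC 1 / (RtoC 1 - z) + - RtoC 1)%C z (1 / ((1 - z) * (1 - z)) + 0)%C).
  { apply qderiv_plus; [apply qderiv_mobius; auto|apply qderiv_const]. }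
  pose proof (qderiv_comp Cexp _ _ _ _ D (qderiv_Cexp _)) as D2. cbv beta in D2.
  assert (E : forall w, Cmod w < 1 -> (RtoC 1 / (RtoC 1 - w) + - RtoC 1 = w / (1 - w))%C).
  { intros w Hw. pose proof (one_minus_neq_0 w Hw). field. auto. }
  replace ((f0 z - RtoC 0 * (1 - z)) / ((1 - z) * (1 - z)))%C
    with (Cexp (1 / (1 - z) + - (1)) * (1 / ((1 - z) * (1 - z)) + 0))%C.
  - revert D2. apply (qderiv_ext_loc _ _ _ _ (1 - Cmod z)); [lra|]. intros k Hk.
    unfold f0. rewrite E; auto. apply Cmod_lt_1_open; auto.
  - rewrite E by auto. unfold f0. field. auto.
Qed.

Lemma Re_mobius_pos z : Cmod z < 1 -> 0 < Re (RtoC 1 / (RtoC 1 - z))%C.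
Proof.
  intros H. pose proof (Rabs_Re_Im_le z) as [R _]. pose proof (Rle_abs (Re z)).
  destruct z as [x y]. simpl in *.
  replace (1 * ((1 + - x) / ((1 + - x) * ((1 + - x) * 1) + (0 + - y) * ((0 + - y) * 1))) -
    0 * (- (0 + - y) / ((1 + - x) * ((1 + - x) * 1) + (0 + - y) * ((0 + - y) * 1))))
    with ((1 - x) / ((1 - x) ^ 2 + y ^ 2)).
  - apply Rdiv_lt_0_compat; nra.
  - field. nra.
Qed.

Lemma disk_ode_f1 : disk_ode f1 1.
Proof.
  intros z H. pose proof (one_minus_neq_0 z H) as N.
  pose proof (Re_mobius_pos z H) as P. pose proof (Re_pos_neq_0 _ P) as NP.
  pose proof (qderiv_mult _ _ _ _ _ (qderiv_Cexp (1 / (1 - z))%C) (qderiv_E1 _ P)) as D.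
  pose proof (qderiv_comp (fun x => Cexp x * Defs.E1 x)%C _ _ _ _ (qderiv_mobius z H) D) as D2.
  cbv beta in D2.
  match type of D2 with qderiv _ _ ?l => replace ((f1 z - RtoC 1 * (1 - z)) / ((1 - z) * (1 - z)))%C with l end.
  - exact D2.
  - unfold f1, E1_ker. set (x := (1 / (1 - z))%C) in *.
    assert (E : (Cexp x * Cexp (- x))%C = RtoC 1).
    { rewrite <- Cexp_plus. replace (x + - x)%C with (RtoC 0) by ring. apply Cexp_0. }
    replace (Cexp x * Defs.E1 x + Cexp x * - (Cexp (- x) / x))%C
      with (Cexp x * Defs.E1 x - (Cexp x * Cexp (- x)) / x)%C by (field; auto).
    rewrite E. replace (1 / x)%C with (1 - z)%C by (unfold x; field; auto). field. auto.
Qed.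

(** The derivatives of [kappa (1 - z)]. *)
Definition ode_source (kappa : R) (n : nat) (z : C) : C :=
  match n with O => RtoC kappa * (1 - z) | 1%nat => - RtoC kappa | _ => RtoC 0 end%C.

Lemma qderiv_ode_source kappa n z : qderiv (ode_source kappa n) z (ode_source kappa (S n) z).
Proof.
  destruct n as [|[|n]]; [|apply (qderiv_const (- RtoC kappa)%C)|apply (qderiv_const (RtoC 0))].
  change (qderiv (fun z => RtoC kappa * (1 - z))%C z (- RtoC kappa)%C).
  replace (- RtoC kappa)%C with (RtoC kappa * - (1))%C by ring.
  apply qderiv_scal, qderiv_one_minus.
Qed.

(** Each derivative is a combination of two earlier ones divided by [(1 - z)^2], so it is
    differentiable in turn; differentiating the relation gives the next one.  The
    coefficients are those of Leibniz' rule for [(1 - z)^2 f']. *)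
Lemma C_derive_iterates f kappa : disk_ode f kappa -> forall n z, Cmod z < 1 ->
  qderiv (Nat.iter n C_derive f) z (Nat.iter (S n) C_derive f z) /\
  ((1 - z) * (1 - z) * Nat.iter (S n) C_derive f z
   = (1 + 2 * RtoC (INR n) * (1 - z)) * Nat.iter n C_derive f z
     - RtoC (INR n * (INR n - 1)) * Nat.iter (pred n) C_derive f z - ode_source kappa n z)%C.
Proof.
  intros F n. induction n as [n IH] using (well_founded_induction Wf_nat.lt_wf).
  destruct n as [|n].
  - intros z H. pose proof (F z H) as D. pose proof (one_minus_neq_0 z H) as N. simpl Nat.iter.
    rewrite (C_derive_qderiv _ _ _ D). split; auto.
    simpl ode_source. simpl INR. rewrite Rmult_0_l. field. auto.
  - set (g := fun n => Nat.iter n C_derive f) in *.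
    change (forall z, Cmod z < 1 -> qderiv (g (S n)) z (g (S (S n)) z) /\
      ((1 - z) * (1 - z) * g (S (S n)) z = (1 + 2 * RtoC (INR (S n)) * (1 - z)) * g (S n) z
       - RtoC (INR (S n) * (INR (S n) - 1)) * g n z - ode_source kappa (S n) z)%C).
    intros z H. pose proof (one_minus_neq_0 z H) as N.
    set (A := fun z => ((1 + 2 * RtoC (INR n) * (1 - z)) * g n z
      + RtoC (- (INR n * (INR n - 1))) * g (pred n) z + - (1) * ode_source kappa n z)%C).
    (* The relation of order n on a whole neighbourhood, so that it can be differentiated. *)
    assert (EA : forall w, Cmod w < 1 ->
      g (S n) w = (A w * (1 / (1 - w) * (1 / (1 - w))))%C).
    { intros w Hw. pose proof (one_minus_neq_0 w Hw).
      destruct (IH n ltac:(lia) w Hw) as [_ E].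
      change ((1 - w) * (1 - w) * g (S n) w = (1 + 2 * RtoC (INR n) * (1 - w)) * g n w
       - RtoC (INR n * (INR n - 1)) * g (pred n) w - ode_source kappa n w)%C in E.
      unfold A. rewrite RtoC_opp.
      replace ((1 + 2 * INR n * (1 - w)) * g n w + - (INR n * (INR n - 1))%R * g (Init.Nat.pred n) w +
         - (1) * ode_source kappa n w)%C with ((1 - w) * (1 - w) * g (S n) w)%C.
      - field. auto.
      - rewrite E. ring. }
    assert (T : qderiv (fun z => RtoC (- (INR n * (INR n - 1))) * g (pred n) z)%C z
                  (RtoC (- (INR n * (INR n - 1))) * g n z)%C).
    (* For n = 0, 1 the predecessor is only a placeholder: its coefficient vanishes. *)
    { destruct n as [|[|n]].
      - replace (RtoC (- (INR 0 * (INR 0 - 1)))) with (RtoC 0) by (f_equal; simpl; ring).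
        replace (0 * g 0%nat z)%C with (RtoC 0) by ring.
        apply (qderiv_ext_loc (fun _ => RtoC 0) _ _ _ 1); [lra|intros; ring|apply qderiv_const].
      - replace (RtoC (- (INR 1 * (INR 1 - 1)))) with (RtoC 0) by (f_equal; simpl; ring).
        replace (0 * g 1%nat z)%C with (RtoC 0) by ring.
        apply (qderiv_ext_loc (fun _ => RtoC 0) _ _ _ 1); [lra|intros; ring|apply qderiv_const].
      - destruct (IH (S n) ltac:(lia) z H) as [D _]. apply qderiv_scal, D. }
    destruct (IH n ltac:(lia) z H) as [Dn _]. change (qderiv (g n) z (g (S n) z)) in Dn.
    set (u := (2 * RtoC (INR n))%C).
    assert (DA : qderiv A z (((0 + u * - (1)) * g n z + (1 + u * (1 - z)) * g (S n) z)
      + RtoC (- (INR n * (INR n - 1))) * g n z + - (1) * ode_source kappa (S n) z)%C).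
    { apply qderiv_plus; [apply qderiv_plus; [|exact T]|].
      - apply (qderiv_mult (fun z => 1 + u * (1 - z))%C (g n)); auto.
        apply (qderiv_plus (fun _ => RtoC 1) (fun z => u * (1 - z))%C); [apply qderiv_const|].
        apply qderiv_scal, qderiv_one_minus.
      - apply qderiv_scal, qderiv_ode_source. }
    pose proof (qderiv_mult _ _ _ _ _ DA (qderiv_mult _ _ _ _ _ (qderiv_mobius z H) (qderiv_mobius z H))) as D.
    cbv beta in D.
    match type of D with qderiv _ _ ?x => set (l := x) in * end.
    assert (D' : qderiv (g (S n)) z l).
    { revert D. apply (qderiv_ext_loc _ _ _ _ (1 - Cmod z)); [lra|]. intros k Hk.
      symmetry. apply EA. apply Cmod_lt_1_open; auto. }
    assert (El : g (S (S n)) z = l) by (apply (C_derive_qderiv (g (S n)) z l D')).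
    rewrite El. split; auto.
    assert (E2 : A z = ((1 - z) * (1 - z) * g (S n) z)%C) by (rewrite EA by auto; field; auto).
    unfold l. rewrite E2, S_INR. unfold u.
    rewrite !RtoC_opp, !RtoC_mult, !RtoC_minus, RtoC_plus. field. auto.
Qed.

(** At [z = 0], after division by [n!], the differentiated equations become a three-term
    recurrence, and the coefficients are determined by the first one. *)
Lemma C_maclaurin_ode f kappa (y : nat -> R) : disk_ode f kappa ->
  f (RtoC 0) = RtoC (y 0%nat) -> y 1%nat = y 0%nat - kappa ->
  (forall n, (INR n + 2) * y (S (S n)) = (2 * INR n + 3) * y (S n) - INR n * y n + kappa * 0 ^ n) ->
  forall n, C_maclaurin f n = RtoC (y n).
Proof.
  intros F Y0 Y1 YS.
  assert (R0 : Cmod (RtoC 0) < 1) by (rewrite Cmod_0; lra).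
  pose proof (fun n => proj2 (C_derive_iterates f kappa F n (RtoC 0) R0)) as E.
  assert (Fn : forall n, RtoC (INR (fact n)) <> RtoC 0).
  { intros n Q. apply RtoC_inj in Q. apply (INR_fact_neq_0 n Q). }
  enough (H : forall n, Nat.iter n C_derive f (RtoC 0) = RtoC (INR (fact n) * y n) /\
     Nat.iter (S n) C_derive f (RtoC 0) = RtoC (INR (fact (S n)) * y (S n))).
  { intros n. unfold C_maclaurin. rewrite (proj1 (H n)), RtoC_mult. field. auto. }
  induction n as [|n [IH1 IH2]].
  - split.
    + simpl. rewrite Y0. f_equal. ring.
    + specialize (E 0%nat). simpl INR in E. simpl pred in E. simpl ode_source in E.
      rewrite Rmult_0_l in E.
      replace (INR (fact 1) * y 1%nat) with (y 0%nat - kappa) by (rewrite Y1; simpl; ring).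
      rewrite RtoC_minus, <- Y0. change (f (RtoC 0)) with (Nat.iter 0 C_derive f (RtoC 0)).
      replace (Nat.iter 1 C_derive f (RtoC 0)) with
        ((1 - 0) * (1 - 0) * Nat.iter 1 C_derive f (RtoC 0))%C by ring.
      rewrite E. ring.
  - split; auto. specialize (E (S n)). simpl pred in E. rewrite IH1, IH2 in E.
    replace (Nat.iter (S (S n)) C_derive f (RtoC 0)) with
        ((1 - 0) * (1 - 0) * Nat.iter (S (S n)) C_derive f (RtoC 0))%C by ring.
    rewrite E.
    replace (INR (fact (S (S n))) * y (S (S n))) with
      (INR (fact (S n)) * ((2 * INR n + 3) * y (S n) - INR n * y n + kappa * 0 ^ n)).
    2:{ rewrite <- YS, (fact_simpl (S n)), mult_INR, !S_INR. ring. }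
    assert (S0 : ode_source kappa (S n) (RtoC 0) = RtoC (- (INR (fact (S n)) * (kappa * 0 ^ n)))).
    { destruct n as [|n]; simpl ode_source.
      - rewrite <- RtoC_opp. f_equal. simpl. ring.
      - f_equal. rewrite pow_ne_zero by lia. ring. }
    rewrite S0.
    replace (1 + 2 * RtoC (INR (S n)) * (1 - 0))%C with (RtoC (1 + 2 * INR (S n)))
      by (rewrite RtoC_plus, RtoC_mult; ring).
    rewrite <- !RtoC_mult, <- !RtoC_minus. f_equal.
    rewrite (fact_simpl n), mult_INR, S_INR. ring.
Qed.

Lemma f1_at_0 : exists l,
  is_RInt_gen (fun s => exp (- s) / (1 + s)) (at_point 0) at_oo l /\
  f1 (RtoC 0) = RtoC l.
Proof.
  assert (P1 : 0 < Re (RtoC 1)) by (simpl; lra).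
  pose proof (E1_correct Re _ (or_introl eq_refl) P1) as I1.
  pose proof (E1_correct Im _ (or_intror eq_refl) P1) as I2.
  assert (G : forall s, 0 <= s -> E1_ker (RtoC 1 + RtoC s)%C = RtoC (exp (- (1 + s)) / (1 + s))).
  { intros s Hs. unfold E1_ker. rewrite <- RtoC_plus, <- RtoC_opp, RtoC_div by lra.
    f_equal. unfold Cexp; simpl. rewrite cos_0, sin_0. unfold RtoC. f_equal; ring. }
  exists (exp 1 * Re (Defs.E1 (RtoC 1))). split.
  - apply (is_RInt_gen_spans_ext _ _ _ (fun s => exp 1 * Re (E1_ker (RtoC 1 + RtoC s)%C)) _ _ spans_nonneg).
    + intros s Hs. rewrite G by auto. simpl.
      replace (exp (- s)) with (exp 1 * exp (- (1 + s))) by (rewrite <- exp_plus; f_equal; ring).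
      field. lra.
    + apply is_RInt_gen_Rscal; auto.
  - assert (Z : Im (Defs.E1 (RtoC 1)) = 0).
    { rewrite <- (is_RInt_gen_unique _ _ I2).
      apply is_RInt_gen_unique.
      apply (is_RInt_gen_spans_ext _ _ _ (fun s => 0 * Re (E1_ker (RtoC 1 + RtoC s)%C)) _ _ spans_nonneg).
      - intros s Hs. rewrite G by auto. simpl. ring.
      - pose proof (is_RInt_gen_Rscal _ 0 _ I1) as Z. rewrite Rmult_0_l in Z. exact Z. }
    unfold f1. replace (RtoC 1 / (RtoC 1 - RtoC 0))%C with (RtoC 1) by (field; intros Q; apply RtoC_inj in Q; lra).
    rewrite (surjective_pairing (Defs.E1 (RtoC 1))). unfold Re, Im in *. rewrite Z.
    unfold Cexp; simpl. rewrite cos_0, sin_0. unfold RtoC, Cmult; simpl. f_equal; ring.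
Qed.

(** Both sides satisfy the same recurrence; the first values agree because
    [b_1 = b_0 - 1] and [beta 1 = 1 - b_0]. *)
Lemma C_maclaurin_f1 n : (0 < n)%nat -> C_maclaurin f1 n = RtoC (- beta n).
Proof.
  destruct f1_at_0 as [l [Il E]]. pose proof (beta_1_eq l Il) as B1.
  intros Hn.
  rewrite (C_maclaurin_ode f1 1 (fun n => match n with O => l | _ => - beta n end) disk_ode_f1).
  - destruct n; [lia|reflexivity].
  - exact E.
  - rewrite B1. ring.
  - intros m. pose proof (beta_recurrence m) as R. destruct m as [|m].
    + simpl in *. lra.
    + rewrite pow_ne_zero in * by lia. lra.
Qed.

(** * Sequences controlled by their increments *)

Lemma rsqrt_decreasing m n : (0 < m <= n)%nat -> rsqrt n <= rsqrt m.
Proof.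
  intros H. unfold rsqrt. pose proof (sqrt_INR_ge1 m ltac:(lia)).
  apply Rinv_le_contravar; [lra|]. apply sqrt_le_1_alt, le_INR; lia.
Qed.

Lemma rsqrt_sqr n : (0 < n)%nat -> rsqrt n ^ 2 = / INR n.
Proof.
  intros H. unfold rsqrt. rewrite pow_inv. f_equal. simpl. rewrite Rmult_1_r.
  apply sqrt_sqrt, pos_INR.
Qed.

Lemma bigO_shift u N j : bigO u N -> bigO (fun n => u (n + j)%nat) N.
Proof.
  intros [K [K0 [n0 H]]]. exists K; split; auto. exists (S n0). intros n Hn.
  eapply Rle_trans; [apply H; lia|]. apply Rmult_le_compat_l; auto.
  pose proof (rsqrt_bounds (n + j) ltac:(lia)).
  apply pow_incr. split; [lra|]. apply rsqrt_decreasing; lia.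
Qed.

Lemma bigO_smooth_bounded f (s : R) : smooth f -> (s = 1 \/ s = -1) -> bigO (fun n => f (s * rsqrt n)) 0.
Proof.
  intros F Hs. destruct (taylor_near_0 f 0 F) as [K [K0 H]]. exists K; split; auto.
  exists 1%nat. intros n Hn. pose proof (rsqrt_bounds n ltac:(lia)).
  specialize (H (s * rsqrt n)). simpl in H. rewrite Rminus_0_r in H. apply H.
  destruct Hs as [-> | ->]; apply Rabs_le; lra.
Qed.

(** A null sequence is bounded by the tail of the sum of its increments. Four orders are
    given up in order to sum [rsqrt k ^ 4 = 1 / k^2], whose tail is at most [2 / n]. *)
Lemma bigO_of_increments u L : bigO u 1 -> bigO (fun n => u (S n) - u n) (L + 4) -> bigO u L.
Proof.
  intros H0 [K [K0 [n1 H1]]]. exists (2 * K); split; [lra|].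
  exists (S n1). intros n Hn.
  assert (T : forall d, Rabs (u (n + d)%nat - u n) <= 2 * K * rsqrt n ^ L * (/ INR n - / INR (n + d))).
  { induction d as [|d IH].
    - rewrite Nat.add_0_r, !Rminus_diag, Rabs_R0. lra.
    - rewrite Nat.add_succ_r.
      replace (u (S (n + d)) - u n) with ((u (S (n + d)) - u (n + d)%nat) + (u (n + d)%nat - u n)) by ring.
      eapply Rle_trans; [apply Rabs_triang|].
      specialize (H1 (n + d)%nat ltac:(lia)).
      set (m := (n + d)%nat) in *. assert (Hm : (0 < m)%nat) by (unfold m; lia).
      pose proof (rsqrt_bounds m Hm) as Em. pose proof (rsqrt_decreasing n m ltac:(unfold m; lia)) as Dm.
      assert (P : 0 < INR m) by (apply lt_0_INR; auto).
      assert (Q : 0 <= rsqrt n ^ L) by (apply pow_le; lra).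
      rewrite pow_add in H1. replace (rsqrt m ^ 4) with ((rsqrt m ^ 2) ^ 2) in H1 by ring.
      rewrite rsqrt_sqr in H1 by auto.
      assert (E1 : rsqrt m ^ L <= rsqrt n ^ L) by (apply pow_incr; lra).
      assert (E2 : (/ INR m) ^ 2 <= 2 * (/ INR m - / INR (S m))).
      { rewrite S_INR.
        replace (2 * (/ INR m - / (INR m + 1))) with ((/ INR m) ^ 2 * (2 * INR m / (INR m + 1)))
          by (field; lra).
        rewrite <- (Rmult_1_r ((/ INR m) ^ 2)) at 1. apply Rmult_le_compat_l; [apply pow2_ge_0|].
        assert (1 <= INR m) by (apply (le_INR 1); auto).
        apply Rle_div_r; lra. }
      assert (E3 : rsqrt m ^ L * (/ INR m) ^ 2 <= rsqrt n ^ L * (2 * (/ INR m - / INR (S m)))).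
      { apply Rmult_le_compat; auto; [apply pow_le; lra|apply pow2_ge_0]. }
      assert (K * (rsqrt m ^ L * (/ INR m) ^ 2) <= K * (rsqrt n ^ L * (2 * (/ INR m - / INR (S m)))))
        by (apply Rmult_le_compat_l; auto).
      lra. }
  assert (Hn' : (0 < n)%nat) by lia.
  assert (P : 0 < INR n) by (apply lt_0_INR; auto).
  pose proof (rsqrt_bounds n Hn') as En.
  assert (Q : 0 <= 2 * K * rsqrt n ^ L) by (apply Rmult_le_pos; [lra|apply pow_le; lra]).
  assert (I1 : / INR n <= 1).
  { rewrite <- Rinv_1. apply Rinv_le_contravar; [lra|]. apply (le_INR 1); auto. }
  apply le_epsilon. intros e He.
  destruct H0 as [K' [K0' H0]].
  assert (Hd : 0 < e / (K' + 1)) by (apply Rdiv_lt_0_compat; lra).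
  destruct (filter_and _ _ H0 (rsqrt_small _ Hd)) as [n2 H2].
  destruct (H2 (n + n2)%nat ltac:(lia)) as [H3 [H4 H5]].
  specialize (T n2). simpl in H3. rewrite Rmult_1_r in H3.
  assert (0 < / INR (n + n2)) by (apply Rinv_0_lt_compat, lt_0_INR; lia).
  assert (H6 : rsqrt (n + n2) * (K' + 1) < e) by (apply Rlt_div_r; lra).
  replace (u n) with (u (n + n2)%nat - (u (n + n2)%nat - u n)) by ring.
  eapply Rle_trans; [apply Rabs_triang|]. rewrite Rabs_Ropp.
  assert (2 * K * rsqrt n ^ L * (/ INR n - / INR (n + n2)) <= 2 * K * rsqrt n ^ L * 1)
    by (apply Rmult_le_compat_l; lra).
  lra.
Qed.

(** With [x <= y] the two square roots, [(y / x)^L <= exp (L (y - x) / x)], and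
    [L / x <= 4]. *)
Lemma growth_monotone L n : (0 < n)%nat -> INR L <= sqrt (INR n) ->
  rsqrt n ^ L * exp (4 * sqrt (INR n)) <= rsqrt (S n) ^ L * exp (4 * sqrt (INR (S n))).
Proof.
  intros Hn HL. pose proof (sqrt_INR_ge1 n Hn) as S1.
  assert (S2 : sqrt (INR n) <= sqrt (INR (S n))) by (apply sqrt_le_1_alt, le_INR; lia).
  unfold rsqrt. set (x := sqrt (INR n)) in *. set (y := sqrt (INR (S n))) in *.
  assert (B : (y / x) ^ L <= exp (4 * (y - x))).
  { apply (Rle_trans _ (exp ((y - x) / x) ^ L)).
    - apply pow_incr. split; [apply Rdiv_le_0_compat; lra|].
      replace (y / x) with (1 + (y - x) / x) by (field; lra). apply exp_ineq1_le.
    - rewrite <- exp_INR_mult. apply exp_monotone.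
      replace (INR L * ((y - x) / x)) with ((INR L / x) * (y - x)) by (field; lra).
      apply Rmult_le_compat_r; [lra|]. apply Rle_div_l; lra. }
  replace ((/ x) ^ L) with ((/ y) ^ L * (y / x) ^ L).
  - replace (exp (4 * y)) with (exp (4 * (y - x)) * exp (4 * x))
      by (rewrite <- exp_plus; f_equal; ring).
    rewrite Rmult_assoc. apply Rmult_le_compat_l.
    + apply pow_le, Rlt_le, Rinv_0_lt_compat; lra.
    + apply Rmult_le_compat_r; auto. apply Rlt_le, exp_pos.
  - rewrite <- Rpow_mult_distr. f_equal. field. lra.
Qed.

(** The bounds for the increments are eventually increasing, so the sum of [n] of them is
    at most [n] times the last; the factor [n] costs two orders. *)
Lemma bigO_of_growing_increments S0 L :
  bigO (fun n => (S0 (S n) - S0 n) * exp (- (4 * sqrt (INR n)))) (L + 2) ->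
  bigO (fun n => S0 n * exp (- (4 * sqrt (INR n)))) L.
Proof.
  intros [K [K0 [n1 H1]]].
  set (g := fun n => rsqrt n ^ (L + 2) * exp (4 * sqrt (INR n))).
  destruct (rsqrt_small (/ (INR (L + 2) + 1))) as [n2 H2].
  { apply Rinv_0_lt_compat. pose proof (pos_INR (L + 2)); lra. }
  (* From n0 on, both the bound on increments and the monotonicity of g hold. *)
  set (n0 := S (n1 + n2)).
  assert (gpos : forall n, (0 < n)%nat -> 0 < g n).
  { intros n Hn. apply Rmult_lt_0_compat; [apply pow_lt, rsqrt_bounds; auto|apply exp_pos]. }
  assert (EX : forall x, exp (- x) * exp x = 1).
  { intros x. rewrite <- exp_plus, Rplus_opp_l. apply exp_0. }
  set (C := Rabs (S0 n0) / g n0).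
  assert (C0 : 0 <= C) by (apply Rdiv_le_0_compat; [apply Rabs_pos|apply gpos; unfold n0; lia]).
  assert (T : forall d, Rabs (S0 (n0 + d)%nat) <= (C + INR d * K) * g (n0 + d)%nat).
  { induction d as [|d IH].
    - rewrite Nat.add_0_r. simpl INR. unfold C. right. field.
      apply Rgt_not_eq, gpos. unfold n0; lia.
    - rewrite Nat.add_succ_r. set (m := (n0 + d)%nat) in *.
      assert (Hm : (0 < m)%nat) by (unfold m, n0; lia).
      assert (M : g m <= g (S m)).
      { apply growth_monotone; auto.
        destruct (H2 m ltac:(unfold m, n0; lia)) as [[E1 _] E2]. unfold rsqrt in E1, E2.
        pose proof (sqrt_INR_ge1 m Hm). pose proof (pos_INR (L + 2)).
        apply Rinv_lt_contravar in E2.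
        - rewrite !Rinv_inv in E2. lra.
        - apply Rmult_lt_0_compat; auto. apply Rinv_0_lt_compat; lra. }
      specialize (H1 m ltac:(unfold m, n0; lia)).
      assert (D : Rabs (S0 (S m) - S0 m) <= K * g m).
      { rewrite Rabs_mult, (Rabs_pos_eq (exp _)) in H1 by (apply Rlt_le, exp_pos).
        apply (Rmult_le_compat_r (exp (4 * sqrt (INR m)))) in H1; [|apply Rlt_le, exp_pos].
        rewrite Rmult_assoc, EX, Rmult_1_r in H1. unfold g. lra. }
      replace (S0 (S m)) with ((S0 (S m) - S0 m) + S0 m) by ring.
      eapply Rle_trans; [apply Rabs_triang|].
      pose proof (gpos m Hm). pose proof (pos_INR d). rewrite S_INR.
      apply (Rle_trans _ ((C + (INR d + 1) * K) * g m)); [lra|].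
      apply Rmult_le_compat_l; auto. nra. }
  exists (C + K); split; [lra|]. exists n0. intros n Hn.
  specialize (T (n - n0)%nat). replace (n0 + (n - n0))%nat with n in T by lia.
  assert (Hn' : (0 < n)%nat) by (unfold n0 in *; lia).
  pose proof (rsqrt_bounds n Hn') as En. pose proof (gpos n Hn') as Gn.
  assert (P : 0 < INR n) by (apply lt_0_INR; auto).
  rewrite Rabs_mult, (Rabs_pos_eq (exp _)) by (apply Rlt_le, exp_pos).
  assert (B : C + INR (n - n0) * K <= (C + K) * INR n).
  { assert (1 <= INR n) by (apply (le_INR 1); auto).
    assert (INR (n - n0) <= INR n) by (apply le_INR; lia). nra. }
  assert (B2 : Rabs (S0 n) <= (C + K) * INR n * g n).
  { eapply Rle_trans; [apply T|]. apply Rmult_le_compat_r; lra. }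
  apply (Rmult_le_compat_r (exp (- (4 * sqrt (INR n))))) in B2; [|apply Rlt_le, exp_pos].
  eapply Rle_trans; [apply B2|]. right. unfold g.
  rewrite pow_add, rsqrt_sqr by auto.
  replace ((C + K) * INR n * (rsqrt n ^ L * / INR n * exp (4 * sqrt (INR n))) * exp (- (4 * sqrt (INR n))))
    with ((C + K) * rsqrt n ^ L * (exp (- (4 * sqrt (INR n))) * exp (4 * sqrt (INR n)))) by (field; lra).
  rewrite EX. ring.
Qed.

(** * The truncated expansions and their residual *)

(** This is [n^(-3/4)]. *)
Definition weight (n : nat) : R := rsqrt n * sqrt (rsqrt n).

Lemma weight_pos n : (0 < n)%nat -> 0 < weight n.
Proof.
  intros H. pose proof (rsqrt_bounds n H).
  apply Rmult_lt_0_compat; [lra|apply sqrt_lt_R0; lra].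
Qed.

Lemma weight_sqr n : (0 < n)%nat -> weight n * weight n = rsqrt n ^ 3.
Proof.
  intros H. pose proof (rsqrt_bounds n H). unfold weight.
  replace (rsqrt n * sqrt (rsqrt n) * (rsqrt n * sqrt (rsqrt n)))
    with (rsqrt n ^ 2 * (sqrt (rsqrt n) * sqrt (rsqrt n))) by ring.
  rewrite sqrt_sqrt by lra. ring.
Qed.

(** For [n = 1 / x^2], the ratio of [exp (2 sqrt n) * n^(-3/4)] at [n + j] and at [n];
    changing [x] into [- x] changes the sign of the exponent. *)
Definition shift_ratio (j : nat) (x : R) : R :=
  exp (2 * (INR j * x / (sqrt (1 + INR j * x ^ 2) + 1)))
  * exp (- (3 / 4) * ln (1 + INR j * x ^ 2)).

Definition shift_arg (j : nat) (x : R) : R := x / sqrt (1 + INR j * x ^ 2).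

Lemma shift_base_pos j x : 0 < 1 + INR j * x ^ 2.
Proof. pose proof (pos_INR j). pose proof (pow2_ge_0 x). nra. Qed.

Lemma smooth_shift_base j : smooth (fun x => 1 + INR j * x ^ 2).
Proof.
  apply smooth_plus; [apply smooth_const|]. apply smooth_mult; [apply smooth_const|].
  apply smooth_pow, smooth_id.
Qed.

Lemma smooth_shift_ratio j : smooth (shift_ratio j).
Proof.
  apply smooth_mult; apply smooth_exp; (apply smooth_mult; [apply smooth_const|]).
  - apply smooth_div.
    + intros x. pose proof (sqrt_pos (1 + INR j * x ^ 2)). lra.
    + apply smooth_mult; [apply smooth_const|apply smooth_id].
    + apply smooth_plus; [|apply smooth_const].
      apply smooth_sqrt; [apply shift_base_pos|apply smooth_shift_base].
  - apply smooth_ln; [apply shift_base_pos|apply smooth_shift_base].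
Qed.

Lemma smooth_shift_arg j : smooth (shift_arg j).
Proof.
  apply smooth_div; [|apply smooth_id|].
  - intros x. apply Rgt_not_eq, sqrt_lt_R0, shift_base_pos.
  - apply smooth_sqrt; [apply shift_base_pos|apply smooth_shift_base].
Qed.

Lemma shift_arg_opp j x : shift_arg j (- x) = - shift_arg j x.
Proof. unfold shift_arg. replace ((- x) ^ 2) with (x ^ 2) by ring. field. apply Rgt_not_eq, sqrt_lt_R0, shift_base_pos. Qed.

Lemma sqrt_shift n j : (0 < n)%nat ->
  sqrt (INR (n + j)) = sqrt (INR n) * sqrt (1 + INR j * rsqrt n ^ 2).
Proof.
  intros H. assert (0 < INR n) by (apply lt_0_INR; auto).
  rewrite <- sqrt_mult_alt by lra. f_equal. rewrite rsqrt_sqr, plus_INR by auto. field. lra.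
Qed.

Lemma rsqrt_shift n j : (0 < n)%nat -> rsqrt (n + j) = shift_arg j (rsqrt n).
Proof.
  intros H. pose proof (sqrt_INR_ge1 n H). pose proof (sqrt_lt_R0 _ (shift_base_pos j (rsqrt n))).
  unfold rsqrt at 1. rewrite sqrt_shift by auto. unfold shift_arg.
  rewrite Rinv_mult. unfold rsqrt, Rdiv. reflexivity.
Qed.

Lemma weight_shift n j : (0 < n)%nat ->
  weight (n + j) = weight n * exp (- (3 / 4) * ln (1 + INR j * rsqrt n ^ 2)).
Proof.
  intros H. pose proof (rsqrt_bounds n H). pose proof (shift_base_pos j (rsqrt n)) as B.
  unfold weight. rewrite rsqrt_shift by auto. unfold shift_arg.
  set (l := ln (1 + INR j * rsqrt n ^ 2)).
  assert (E1 : / sqrt (1 + INR j * rsqrt n ^ 2) = exp (- / 4 * l) * exp (- / 4 * l)).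
  { rewrite <- exp_plus. replace (- / 4 * l + - / 4 * l) with (- (/ 2 * l)) by field.
    rewrite exp_Ropp. f_equal. unfold l. rewrite <- (exp_ln _ B) at 1.
    set (b := ln (1 + INR j * rsqrt n ^ 2)).
    rewrite <- (sqrt_Rsqr (exp (/ 2 * b))) by (apply Rlt_le, exp_pos).
    f_equal. unfold Rsqr. rewrite <- exp_plus. f_equal. field. }
  unfold Rdiv. rewrite sqrt_mult_alt by lra. rewrite E1.
  rewrite sqrt_square by (apply Rlt_le, exp_pos).
  replace (exp (- (3 * / 4) * l)) with (exp (- / 4 * l) * exp (- / 4 * l) * exp (- / 4 * l)).
  - ring.
  - rewrite <- !exp_plus. f_equal. field.
Qed.

Lemma exp_sqrt_shift n j (s : R) : (0 < n)%nat -> s = 1 \/ s = -1 ->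
  exp (2 * s * sqrt (INR (n + j))) * weight (n + j)
  = exp (2 * s * sqrt (INR n)) * weight n * shift_ratio j (s * rsqrt n).
Proof.
  intros H Hs. rewrite weight_shift by auto. unfold shift_ratio.
  replace ((s * rsqrt n) ^ 2) with (rsqrt n ^ 2) by (destruct Hs; subst; ring).
  replace (exp (2 * s * sqrt (INR (n + j)))) with (exp (2 * s * sqrt (INR n)) *
    exp (2 * (INR j * (s * rsqrt n) / (sqrt (1 + INR j * rsqrt n ^ 2) + 1)))); [ring|].
  rewrite <- exp_plus. f_equal. rewrite sqrt_shift by auto.
  pose proof (shift_base_pos j (rsqrt n)) as B.
  pose proof (sqrt_sqrt _ (Rlt_le _ _ B)) as Q. pose proof (sqrt_lt_R0 _ B) as S0.
  set (t := sqrt (1 + INR j * rsqrt n ^ 2)) in *.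
  pose proof (sqrt_INR_ge1 n H) as L1.
  assert (E : INR j * rsqrt n = sqrt (INR n) * (t * t - 1)).
  { rewrite Q. unfold rsqrt. field. lra. }
  replace (INR j * (s * rsqrt n)) with (s * (INR j * rsqrt n)) by ring. rewrite E. field. lra.
Qed.

Definition trunc (N : nat) (x : R) : R := psum (fun m => c m * x ^ m) N.

(** The two candidate expansions: [s = 1] for [a_n] and [s = -1] for [b_n].  They come from
    a single function of [s / sqrt n]. *)
Definition approx (N : nat) (s : R) (n : nat) : R := exp (2 * s * sqrt (INR n)) * weight n * trunc N (s * rsqrt n).

Definition shifted (N j : nat) (x : R) : R := shift_ratio j x * trunc N (shift_arg j x).

Lemma smooth_trunc N : smooth (trunc N).
Proof.
  apply smooth_psum. intros i. apply smooth_mult; [apply smooth_const|apply smooth_pow, smooth_id].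
Qed.

Lemma smooth_shifted N j : smooth (shifted N j).
Proof.
  apply smooth_mult; [apply smooth_shift_ratio|].
  apply (smooth_comp (trunc N)); [apply smooth_trunc|apply smooth_shift_arg].
Qed.

Lemma approx_shift N n j s : (0 < n)%nat -> s = 1 \/ s = -1 ->
  approx N s (n + j) = exp (2 * s * sqrt (INR n)) * weight n * shifted N j (s * rsqrt n).
Proof.
  intros H Hs. unfold approx. rewrite exp_sqrt_shift by auto.
  unfold shifted. rewrite rsqrt_shift by auto.
  replace (s * shift_arg j (rsqrt n)) with (shift_arg j (s * rsqrt n)); [ring|].
  destruct Hs as [-> | ->].
  - rewrite !Rmult_1_l; reflexivity.
  - replace (-1 * rsqrt n) with (- rsqrt n) by ring. rewrite shift_arg_opp. ring.
Qed.

(** The recurrence applied to [approx], divided by the leading factor and by [n], as a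
    function of [x = s / sqrt n]; since [n = 1 / x^2] only even powers of [x] come from the
    coefficients of the recurrence. *)
Definition residual (N : nat) (x : R) : R :=
  (1 + 2 * x ^ 2) * shifted N 2 x - (2 + 3 * x ^ 2) * shifted N 1 x + shifted N 0 x.

Lemma smooth_residual N : smooth (residual N).
Proof.
  assert (S : forall a b, smooth (fun x => a + b * x ^ 2)).
  { intros a b. apply smooth_plus; [apply smooth_const|].
    apply smooth_mult; [apply smooth_const|apply smooth_pow, smooth_id]. }
  apply smooth_plus; [apply smooth_minus|apply smooth_shifted];
    (apply smooth_mult; [apply S|apply smooth_shifted]).
Qed.

Definition beta_ratio (n : nat) : R := beta n / (sqrt (exp 1) * scale n).

Definition beta_norm (n : nat) : R := beta n / (sqrt PI * sqrt (exp 1)).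

Lemma trunc_opp N x : trunc N (- x) = psum (fun m => (-1) ^ m * c m * x ^ m) N.
Proof.
  apply psum_ext. intros i _. replace (- x) with (-1 * x) by ring.
  rewrite Rpow_mult_distr. ring.
Qed.

Definition beta_error (N n : nat) : R := beta_ratio n - trunc N (-1 * rsqrt n).

Lemma bigO_beta_error N : bigO (beta_error N) N.
Proof.
  apply (bigO_ext (fun n => beta_ratio n - psum (fun m => (-1) ^ m * c m * rsqrt n ^ m) N)).
  - exists 0%nat. intros n _. unfold beta_error. rewrite <- trunc_opp. do 2 f_equal. ring.
  - apply beta_asym.
Qed.

Lemma beta_norm_eq n : (0 < n)%nat ->
  beta_norm n = exp (2 * -1 * sqrt (INR n)) * weight n * beta_ratio n.
Proof.
  intros H. unfold beta_norm, beta_ratio, scale. fold (weight n).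
  replace (2 * -1 * sqrt (INR n)) with (- (2 * sqrt (INR n))) by ring.
  pose proof (sqrt_lt_R0 _ PI_RGT_0). pose proof (sqrt_lt_R0 _ (exp_pos 1)).
  pose proof (exp_pos (- (2 * sqrt (INR n)))). pose proof (weight_pos n H).
  field. repeat split; lra.
Qed.

Lemma beta_norm_shift N n j : (0 < n)%nat ->
  beta_norm (n + j) = exp (2 * -1 * sqrt (INR n)) * weight n *
    (shifted N j (-1 * rsqrt n) + shift_ratio j (-1 * rsqrt n) * beta_error N (n + j)).
Proof.
  intros H. rewrite beta_norm_eq by lia.
  replace (beta_ratio (n + j)) with (trunc N (-1 * rsqrt (n + j)) + beta_error N (n + j))
    by (unfold beta_error; ring).
  rewrite Rmult_plus_distr_l. fold (approx N (-1) (n + j)).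
  rewrite approx_shift, exp_sqrt_shift by auto. ring.
Qed.

Lemma beta_norm_recurrence n : (0 < n)%nat ->
  (INR n + 2) * beta_norm (n + 2) - (2 * INR n + 3) * beta_norm (n + 1) + INR n * beta_norm n = 0.
Proof.
  intros H. pose proof (beta_recurrence n) as R. rewrite pow_ne_zero in R by lia.
  replace (n + 2)%nat with (S (S n)) by lia. replace (n + 1)%nat with (S n) by lia.
  unfold beta_norm, Rdiv.
  set (q := / (sqrt PI * sqrt (exp 1))).
  replace ((INR n + 2) * (beta (S (S n)) * q) - (2 * INR n + 3) * (beta (S n) * q) + INR n * (beta n * q))
    with (((INR n + 2) * beta (S (S n)) - (2 * INR n + 3) * beta (S n) + INR n * beta n) * q) by ring.
  rewrite R. ring.
Qed.

Lemma INR_ep n : (0 < n)%nat -> INR n * rsqrt n ^ 2 = 1.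
Proof. intros H. rewrite rsqrt_sqr by auto. field. apply not_0_INR; lia. Qed.

Lemma bigO_poly_factor a b : bigO (fun n => a + b * rsqrt n ^ 2) 0.
Proof.
  apply (bigO_plus (fun _ => a)); [apply bigO_const|].
  apply bigO_scal. apply (bigO_le _ 0 2); [lia|apply bigO_pow].
Qed.

(** The residual is known to be small along [- 1 / sqrt n], where it is the residual
    of the truncated expansion of an exact solution; so it is small along [1 / sqrt n]
    as well. *)
Lemma bigO_residual N : bigO (fun n => residual N (rsqrt n)) N.
Proof.
  apply bigO_smooth_reflect; [apply smooth_residual|].
  pose proof (fun j => bigO_smooth_bounded _ (-1) (smooth_shift_ratio j) (or_intror eq_refl)) as R.
  pose proof (fun j => bigO_shift _ _ j (bigO_beta_error N)) as D.
  apply (bigO_ext (fun n => - (((1 + 2 * rsqrt n ^ 2) * (shift_ratio 2 (-1 * rsqrt n) * beta_error N (n + 2))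
     - (2 + 3 * rsqrt n ^ 2) * (shift_ratio 1 (-1 * rsqrt n) * beta_error N (n + 1)))
     + shift_ratio 0 (-1 * rsqrt n) * beta_error N (n + 0)))).
  - exists 1%nat. intros n Hn. assert (H : (0 < n)%nat) by lia.
    pose proof (beta_norm_recurrence n H) as E.
    rewrite !(beta_norm_shift N n) in E by auto.
    replace (beta_norm n) with (beta_norm (n + 0)) in E by (f_equal; lia).
    rewrite (beta_norm_shift N n 0) in E by auto.
    set (w := exp (2 * -1 * sqrt (INR n)) * weight n) in E.
    assert (Hw : 0 < w) by (apply Rmult_lt_0_compat; [apply exp_pos|apply weight_pos; auto]).
    apply (f_equal (fun x => x * rsqrt n ^ 2)) in E. rewrite Rmult_0_l in E.
    pose proof (INR_ep n H) as I.
    set (t2 := shift_ratio 2 (-1 * rsqrt n) * beta_error N (n + 2)) in *.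
    set (t1 := shift_ratio 1 (-1 * rsqrt n) * beta_error N (n + 1)) in *.
    set (t0 := shift_ratio 0 (-1 * rsqrt n) * beta_error N (n + 0)) in *.
    replace (- rsqrt n) with (-1 * rsqrt n) by ring. unfold residual.
    replace ((-1 * rsqrt n) ^ 2) with (rsqrt n ^ 2) by ring.
    set (v2 := shifted N 2 (-1 * rsqrt n)) in *.
    set (v1 := shifted N 1 (-1 * rsqrt n)) in *.
    set (v0 := shifted N 0 (-1 * rsqrt n)) in *.
    assert (E' : w * ((1 + 2 * rsqrt n ^ 2) * (v2 + t2) - (2 + 3 * rsqrt n ^ 2) * (v1 + t1) + (v0 + t0)) = 0).
    (* Multiples of 1 - n x^2 = 0, with x^2 = 1 / n, convert the powers of n. *)
    { transitivity (((INR n + 2) * (w * (v2 + t2)) - (2 * INR n + 3) * (w * (v1 + t1))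
        + INR n * (w * (v0 + t0))) * rsqrt n ^ 2
        + (1 - INR n * rsqrt n ^ 2) * (w * (v2 + t2 - 2 * (v1 + t1) + (v0 + t0)))); [ring|].
      rewrite E, I. ring. }
    apply Rmult_integral in E'. destruct E' as [E'|E']; lra.
  - apply bigO_opp. apply bigO_plus; [apply bigO_minus|].
    + apply (bigO_mult _ _ 0 N); [apply bigO_poly_factor|].
      apply (bigO_mult _ _ 0 N); auto.
    + apply (bigO_mult _ _ 0 N); [apply bigO_poly_factor|].
      apply (bigO_mult _ _ 0 N); auto.
    + apply (bigO_mult _ _ 0 N); auto.
Qed.

Lemma c_0 : c 0 = 1.
Proof.
  unfold c. simpl. unfold R_maclaurin. simpl. unfold mu.
  destruct (Req_EM_T 0 0); [|lra]. rewrite exp_0. field.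
Qed.

Lemma trunc_0 N : trunc (S N) 0 = 1.
Proof.
  unfold trunc. rewrite psum_Sl, c_0, psum_zero; [simpl; ring|].
  intros; simpl; ring.
Qed.

Lemma shifted_0_eq N x : shifted N 0 x = trunc N x.
Proof.
  unfold shifted, shift_ratio, shift_arg. simpl INR.
  rewrite !Rmult_0_l, Rplus_0_r, ln_1, sqrt_1, Rmult_0_r.
  unfold Rdiv at 1. rewrite Rmult_0_l, Rmult_0_r, exp_0, Rdiv_1_r. ring.
Qed.

(** * Casoratians *)

(** The determinant of two solutions is multiplied by [n / (n + 2)] at each step; with the
    factor [n (n + 1)] it becomes constant. *)
Definition casoratian (u v : nat -> R) (n : nat) : R :=
  INR n * (INR n + 1) * (u (n + 1)%nat * v n - u n * v (n + 1)%nat).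

Lemma casoratian_step u v n r :
  (INR n + 2) * u (n + 2)%nat - (2 * INR n + 3) * u (n + 1)%nat + INR n * u n = r ->
  (INR n + 2) * v (n + 2)%nat - (2 * INR n + 3) * v (n + 1)%nat + INR n * v n = 0 ->
  casoratian u v (S n) - casoratian u v n = (INR n + 1) * r * v (n + 1)%nat.
Proof.
  intros U V. unfold casoratian. rewrite S_INR.
  replace (S n + 1)%nat with (n + 2)%nat by lia. replace (S n) with (n + 1)%nat by lia.
  rewrite <- U.
  replace ((INR n + 1) * ((INR n + 2) * u (n + 2)%nat - (2 * INR n + 3) * u (n + 1)%nat + INR n * u n)
      * v (n + 1)%nat)
    with ((INR n + 1) * ((INR n + 2) * u (n + 2)%nat - (2 * INR n + 3) * u (n + 1)%nat + INR n * u n)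
      * v (n + 1)%nat - (INR n + 1) * u (n + 1)%nat * ((INR n + 2) * v (n + 2)%nat
        - (2 * INR n + 3) * v (n + 1)%nat + INR n * v n)) by (rewrite V; ring).
  ring.
Qed.

Lemma exp_opposite_weight n : (0 < n)%nat ->
  (exp (2 * 1 * sqrt (INR n)) * weight n) * (exp (2 * -1 * sqrt (INR n)) * weight n) = rsqrt n ^ 3.
Proof.
  intros H. rewrite <- weight_sqr by auto.
  assert (E : exp (2 * 1 * sqrt (INR n)) * exp (2 * -1 * sqrt (INR n)) = 1).
  { rewrite <- exp_plus. replace (2 * 1 * sqrt (INR n) + 2 * -1 * sqrt (INR n)) with 0 by ring. apply exp_0. }
  replace (exp (2 * 1 * sqrt (INR n)) * weight n * (exp (2 * -1 * sqrt (INR n)) * weight n))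
    with ((exp (2 * 1 * sqrt (INR n)) * exp (2 * -1 * sqrt (INR n))) * (weight n * weight n)) by ring.
  rewrite E. ring.
Qed.

Lemma is_derive_shifted_1 N : is_derive (shifted N 1) 0 (trunc N 0 + Derive (trunc N) 0).
Proof.
  assert (S1 : sqrt (1 + 1 * 0 ^ 2) = 1) by (replace (1 + 1 * 0 ^ 2) with 1 by ring; apply sqrt_1).
  assert (D1 : is_derive (shift_ratio 1) 0 1).
  { unfold shift_ratio. simpl INR. auto_derive.
    - replace (1 + 1 * (0 * (0 * 1))) with 1 by ring. rewrite sqrt_1. repeat split; lra.
    - replace (1 + 1 * (0 * (0 * 1))) with 1 by ring. rewrite sqrt_1, ln_1.
      replace (2 * (1 * 0 * / (1 + 1))) with 0 by field.
      replace (2 * (1 * 0 / (1 + 1))) with 0 by field.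
      rewrite !Rmult_0_r, !Rmult_0_l, exp_0. field. }
  assert (D2 : is_derive (shift_arg 1) 0 1).
  { unfold shift_arg. simpl INR. auto_derive.
    - replace (1 + 1 * (0 * (0 * 1))) with 1 by ring. rewrite sqrt_1. repeat split; lra.
    - replace (1 + 1 * (0 * (0 * 1))) with 1 by ring. rewrite sqrt_1. field. }
  assert (A0 : shift_arg 1 0 = 0) by (unfold shift_arg; apply Rmult_0_l).
  assert (R0 : shift_ratio 1 0 = 1).
  { unfold shift_ratio. simpl INR. rewrite S1. replace (1 + 1 * 0 ^ 2) with 1 by ring.
    rewrite ln_1. replace (2 * (1 * 0 / (1 + 1))) with 0 by field. rewrite Rmult_0_r, exp_0. ring. }
  replace (trunc N 0 + Derive (trunc N) 0)
    with (1 * trunc N (shift_arg 1 0) + shift_ratio 1 0 * (1 * Derive (trunc N) (shift_arg 1 0)))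
    by (rewrite A0, R0; ring).
  apply (is_derive_mult (K := R_AbsRing) (shift_ratio 1) (fun x => trunc N (shift_arg 1 x))); auto.
  - apply (is_derive_comp (V := RN) (trunc N) (shift_arg 1)); auto.
    apply is_derive_smooth, smooth_trunc.
  - intros; apply Rmult_comm.
Qed.

Definition leading_casoratian (N : nat) (x : R) : R :=
  (1 + x ^ 2) * (shifted N 1 x * shifted N 0 (-1 * x) - shifted N 0 x * shifted N 1 (-1 * x)).

(** The Casoratian is odd in [x], and the derivative at 0 of the ratio between two
    consecutive values of [exp (2 sqrt n)] is 1. This fixes the constant in front of the
    expansion of [a_n]. *)
Lemma bigO_leading_casoratian N :
  bigO (fun n => leading_casoratian (S N) (rsqrt n) - 2 * rsqrt n) 2.
Proof.
  set (M := fun x => leading_casoratian (S N) x - 2 * x).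
  assert (S0 : forall j, smooth (fun x => shifted (S N) j (-1 * x))).
  { intros j. apply (smooth_comp (shifted (S N) j)); [apply smooth_shifted|].
    apply smooth_mult; [apply smooth_const|apply smooth_id]. }
  assert (SM : smooth M).
  { apply smooth_minus; [|apply smooth_mult; [apply smooth_const|apply smooth_id]].
    apply smooth_mult; [apply smooth_plus; [apply smooth_const|apply smooth_pow, smooth_id]|].
    apply smooth_minus; apply smooth_mult; auto using smooth_shifted. }
  pose proof (bigO_smooth M 2 SM) as B. revert B. apply bigO_ext.
  exists 0%nat. intros n _. fold (M (rsqrt n)).
  rewrite psum_zero; [ring|].
  intros [|[|i]] Hi; [| |lia].
  - unfold R_maclaurin; simpl Derive_n. unfold M, leading_casoratian.
    replace (-1 * 0) with 0 by ring. simpl. field.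
  - assert (E : Derive M 0 = 0).
    { apply is_derive_unique.
      set (t1 := Derive (trunc (S N)) 0).
      assert (D1 : is_derive (shifted (S N) 1) 0 (1 + t1)).
      { rewrite <- (trunc_0 N). apply is_derive_shifted_1. }
      assert (D0 : is_derive (shifted (S N) 0) 0 t1).
      { apply (is_derive_ext (trunc (S N))); [intros; symmetry; apply shifted_0_eq|].
        apply is_derive_smooth, smooth_trunc. }
      assert (V0 : shifted (S N) 0 0 = 1) by (rewrite shifted_0_eq; apply trunc_0).
      assert (V1 : shifted (S N) 1 0 = 1).
      { unfold shifted, shift_arg, shift_ratio. simpl INR.
        replace (1 + 1 * 0 ^ 2) with 1 by ring. rewrite sqrt_1, ln_1.
        replace (2 * (1 * 0 / (1 + 1))) with 0 by field.
        replace (0 / 1) with 0 by field. rewrite Rmult_0_r, exp_0, trunc_0. ring. }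
      assert (OP : forall f l, is_derive f 0 l -> is_derive (fun x => f (-1 * x)) 0 (-1 * l)).
      { intros f l Df. apply (is_derive_comp (V := RN) f (fun x => -1 * x)).
        - replace (-1 * 0) with 0 by ring. exact Df.
        - auto_derive; auto. ring. }
      pose proof (OP _ _ D1) as D1'. pose proof (OP _ _ D0) as D0'.
      assert (MU : forall f g l m, is_derive f 0 l -> is_derive g 0 m ->
        is_derive (fun x : R => f x * g x) 0 (l * g 0 + f 0 * m)).
      { intros f g l m Df Dg. apply (is_derive_mult (K := R_AbsRing) f g); auto.
        intros; apply Rmult_comm. }
      pose proof (MU _ _ _ _ D1 D0') as X1. pose proof (MU _ _ _ _ D0 D1') as X2.
      pose proof (is_derive_minus (V := RN) _ _ _ _ _ X1 X2) as X3.
      assert (X4 : is_derive (fun x : R => 1 + x ^ 2) 0 0) by (auto_derive; auto; ring).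
      pose proof (MU _ _ _ _ X4 X3) as X5.
      assert (X6 : is_derive (fun x : R => 2 * x) 0 2) by (auto_derive; auto; ring).
      pose proof (is_derive_minus (V := RN) _ _ _ _ _ X5 X6) as X7.
      revert X7. unfold minus, plus, opp; simpl.
      replace (-1 * 0) with 0 by ring. rewrite V0, V1.
      match goal with |- is_derive _ _ ?l -> _ => replace l with 0 by ring end.
      apply is_derive_ext. intros x. unfold M, leading_casoratian. simpl. ring. }
    unfold R_maclaurin. change (Derive_n M 1 0) with (Derive M 0). rewrite E. simpl. field.
Qed.

(** * The expansion of the coefficients of f0 *)
Fixpoint a_pair (n : nat) : R * R :=
  match n with
  | O => (1, 1)
  | S k => let '(x, y) := a_pair k in (y, ((2 * INR k + 3) * y - INR k * x) / (INR k + 2))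
  end.

Definition a_seq (n : nat) : R := fst (a_pair n).

Lemma a_seq_recurrence n :
  (INR n + 2) * a_seq (n + 2) - (2 * INR n + 3) * a_seq (n + 1) + INR n * a_seq n = 0.
Proof.
  replace (n + 2)%nat with (S (S n)) by lia. replace (n + 1)%nat with (S n) by lia.
  unfold a_seq. simpl a_pair. destruct (a_pair n) as [x y]. simpl fst.
  pose proof (pos_INR n). field. lra.
Qed.

Lemma C_maclaurin_f0 n : C_maclaurin f0 n = RtoC (a_seq n).
Proof.
  apply (C_maclaurin_ode f0 0 a_seq disk_ode_f0).
  - unfold f0. replace (RtoC 0 / (RtoC 1 - RtoC 0))%C with (RtoC 0)
      by (field; intros E; apply RtoC_inj in E; lra).
    apply Cexp_0.
  - unfold a_seq; simpl. ring.
  - intros m. pose proof (a_seq_recurrence m) as R.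
    replace (m + 2)%nat with (S (S m)) in R by lia. replace (m + 1)%nat with (S m) in R by lia.
    lra.
Qed.

(** The constant is read off at [n = 1] from [2 beta_2 = 3 beta_1 - 1]. *)
Lemma casoratian_a n : (0 < n)%nat -> casoratian a_seq beta_norm n = / (sqrt PI * sqrt (exp 1)).
Proof.
  induction n as [|n IH]; intros H; [lia|].
  destruct n as [|n].
  - unfold casoratian, a_seq, beta_norm. simpl.
    pose proof (beta_recurrence 0) as R. simpl in R.
    pose proof (sqrt_lt_R0 _ PI_RGT_0). pose proof (sqrt_lt_R0 _ (exp_pos 1)).
    apply (Rmult_eq_reg_r (sqrt PI * sqrt (exp 1))); [|nra].
    field_simplify; [|lra..]. lra.
  - rewrite <- IH by lia. apply Rminus_diag_uniq.
    rewrite (casoratian_step _ _ _ 0).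
    + ring.
    + apply a_seq_recurrence.
    + apply beta_norm_recurrence; lia.
Qed.

Lemma bigO_beta_ratio_1 : bigO (fun n => beta_ratio n - 1) 1.
Proof.
  apply (bigO_ext (fun n => beta_error 1 n)).
  - exists 0%nat. intros n _. unfold beta_error, trunc. simpl. rewrite c_0. ring.
  - apply bigO_beta_error.
Qed.

Lemma bigO_inv u : bigO (fun n => u n - 1) 1 -> bigO (fun n => / u n) 0 /\ eventually (fun n => 0 < u n).
Proof.
  intros [K [K0 H]].
  assert (D : 0 < / (2 * (K + 1))) by (apply Rinv_0_lt_compat; lra).
  assert (B : eventually (fun n => / 2 <= u n)).
  { eapply filter_imp; [|apply (filter_and _ _ H (rsqrt_small _ D))].
    intros n [H1 [H2 H3]]. simpl in H1. rewrite Rmult_1_r in H1.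
    assert (rsqrt n * (2 * (K + 1)) < 1).
    { apply (Rmult_lt_compat_r (2 * (K + 1))) in H3; [|lra]. rewrite Rinv_l in H3; lra. }
    apply Rabs_le_between in H1. lra. }
  split.
  - exists 2. split; [lra|]. eapply filter_imp; [|apply B]. intros n Hn.
    rewrite Rabs_pos_eq by (apply Rlt_le, Rinv_0_lt_compat; lra).
    simpl. rewrite Rmult_1_r. replace 2 with (/ / 2) by (rewrite Rinv_inv; auto).
    apply Rinv_le_contravar; lra.
  - eapply filter_imp; [|apply B]. intros n Hn. lra.
Qed.

Lemma beta_ratio_pos : eventually (fun n => 0 < beta_ratio n).
Proof. apply (bigO_inv _ bigO_beta_ratio_1). Qed.

Lemma bigO_beta_ratio : bigO beta_ratio 0.
Proof.
  apply (bigO_ext (fun n => 1 + (beta_ratio n - 1))).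
  - exists 0%nat; intros; ring.
  - apply bigO_plus; [apply bigO_const|]. apply (bigO_le _ 0 1); [lia|apply bigO_beta_ratio_1].
Qed.

Lemma shift_ratio_pos j x : 0 < shift_ratio j x.
Proof. apply Rmult_lt_0_compat; apply exp_pos. Qed.

Lemma beta_norm_succ n : (0 < n)%nat ->
  beta_norm (n + 1) = exp (2 * -1 * sqrt (INR n)) * weight n * (shift_ratio 1 (-1 * rsqrt n) * beta_ratio (n + 1)).
Proof.
  intros H. rewrite beta_norm_eq by lia. rewrite exp_sqrt_shift by auto. ring.
Qed.

(** The increment is the residual times [beta_norm (n + 1)] times a power of [n]; the
    exponentials cancel. *)
Lemma bigO_casoratian_increment N :
  bigO (fun n => casoratian (approx (S N) 1) beta_norm (S n) - casoratian (approx (S N) 1) beta_norm n) N.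
Proof.
  pose proof (bigO_smooth_bounded _ (-1) (smooth_shift_ratio 1) (or_intror eq_refl)) as R.
  apply (bigO_div_pow _ N 1). rewrite Nat.add_1_r.
  apply (bigO_ext (fun n => (1 + 1 * rsqrt n ^ 2) * (residual (S N) (rsqrt n) *
    (shift_ratio 1 (-1 * rsqrt n) * beta_ratio (n + 1))))).
  - exists 1%nat. intros n Hn. assert (H : (0 < n)%nat) by lia.
    set (w1 := exp (2 * 1 * sqrt (INR n)) * weight n).
    assert (RA : (INR n + 2) * approx (S N) 1 (n + 2) - (2 * INR n + 3) * approx (S N) 1 (n + 1)
       + INR n * approx (S N) 1 n = INR n * (w1 * residual (S N) (rsqrt n))).
    { replace (approx (S N) 1 n) with (approx (S N) 1 (n + 0)) by (f_equal; lia).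
      rewrite !approx_shift by auto. fold w1. unfold residual. rewrite Rmult_1_l.
      set (v2 := shifted (S N) 2 (rsqrt n)). set (v1 := shifted (S N) 1 (rsqrt n)).
      set (v0 := shifted (S N) 0 (rsqrt n)).
      transitivity (w1 * (INR n * (v2 - 2 * v1 + v0) + (INR n * rsqrt n ^ 2) * (2 * v2 - 3 * v1))).
      - rewrite INR_ep by auto. ring.
      - ring. }
    rewrite (casoratian_step _ _ _ _ RA (beta_norm_recurrence n H)).
    rewrite beta_norm_succ by auto.
    set (w2 := exp (2 * -1 * sqrt (INR n)) * weight n).
    pose proof (exp_opposite_weight n H) as W. fold w1 w2 in W.
    pose proof (INR_ep n H) as I.
    set (t := residual (S N) (rsqrt n)). set (v := shift_ratio 1 (-1 * rsqrt n) * beta_ratio (n + 1)).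
    transitivity ((INR n * rsqrt n ^ 2) * (INR n * rsqrt n ^ 2 + 1 * rsqrt n ^ 2) * (t * v)).
    + rewrite I. ring.
    + transitivity ((INR n + 1) * INR n * (w1 * w2) * rsqrt n * (t * v)); [rewrite W|]; ring.
  - replace (S N) with (0 + (S N + (0 + 0)))%nat by lia.
    apply bigO_mult; [apply bigO_poly_factor|].
    replace (0 + (S N + (0 + 0)))%nat with (S N) by lia.
    apply bigO_mult; [apply bigO_residual|]. apply bigO_mult; auto.
    apply (bigO_shift beta_ratio 0 1), bigO_beta_ratio.
Qed.

Lemma bigO_casoratian_limit N : bigO (fun n => casoratian (approx (S (S N)) 1) beta_norm n - 2) 1.
Proof.
  pose proof (bigO_smooth_bounded _ (-1) (smooth_shift_ratio 1) (or_intror eq_refl)) as R1.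
  pose proof (bigO_smooth_bounded _ (-1) (smooth_shift_ratio 0) (or_intror eq_refl)) as R0.
  pose proof (fun j => bigO_smooth_bounded _ 1 (smooth_shifted (S (S N)) j) (or_introl eq_refl)) as V.
  pose proof (bigO_le _ 2 (S (S N)) ltac:(lia) (bigO_beta_error (S (S N)))) as D0.
  pose proof (bigO_shift _ _ 1 D0) as D1.
  apply (bigO_div_pow _ 1 1).
  apply (bigO_ext (fun n => (leading_casoratian (S (S N)) (rsqrt n) - 2 * rsqrt n) + (1 + 1 * rsqrt n ^ 2) *
    (shifted (S (S N)) 1 (1 * rsqrt n) * (shift_ratio 0 (-1 * rsqrt n) * beta_error (S (S N)) n)
     - shifted (S (S N)) 0 (1 * rsqrt n) * (shift_ratio 1 (-1 * rsqrt n) * beta_error (S (S N)) (n + 1))))).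
  - exists 1%nat. intros n Hn. assert (H : (0 < n)%nat) by lia.
    unfold casoratian.
    replace (approx (S (S N)) 1 n) with (approx (S (S N)) 1 (n + 0)) by (f_equal; lia).
    replace (beta_norm n) with (beta_norm (n + 0)) by (f_equal; lia).
    rewrite !approx_shift, !(beta_norm_shift (S (S N))) by auto.
    replace (beta_error (S (S N)) (n + 0)) with (beta_error (S (S N)) n) by (f_equal; lia).
    pose proof (exp_opposite_weight n H) as W. pose proof (INR_ep n H) as I.
    set (w1 := exp (2 * 1 * sqrt (INR n)) * weight n) in *.
    set (w2 := exp (2 * -1 * sqrt (INR n)) * weight n) in *.
    unfold leading_casoratian. rewrite !(Rmult_1_l (rsqrt n)).
    set (a1 := shifted (S (S N)) 1 (rsqrt n)). set (a0 := shifted (S (S N)) 0 (rsqrt n)).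
    set (b1 := shifted (S (S N)) 1 (-1 * rsqrt n)). set (b0 := shifted (S (S N)) 0 (-1 * rsqrt n)).
    set (d1 := shift_ratio 1 (-1 * rsqrt n) * beta_error (S (S N)) (n + 1)).
    set (d0 := shift_ratio 0 (-1 * rsqrt n) * beta_error (S (S N)) n).
    transitivity ((INR n * rsqrt n ^ 2) * (INR n * rsqrt n ^ 2 + rsqrt n ^ 2) * (a1 * (b0 + d0) - a0 * (b1 + d1))
      - 2 * rsqrt n).
    + rewrite I. ring.
    + transitivity (INR n * (INR n + 1) * (w1 * w2) * rsqrt n * (a1 * (b0 + d0) - a0 * (b1 + d1)) - 2 * rsqrt n);
        [rewrite W|]; ring.
  - apply bigO_plus; [apply bigO_leading_casoratian|].
    apply (bigO_mult _ _ 0 2); [apply bigO_poly_factor|].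
    apply bigO_minus; apply (bigO_mult _ _ 0 2); auto; apply (bigO_mult _ _ 0 2); auto.
Qed.

(** Let [e = approx - const * a_seq].  Its Casoratian with [beta_norm] tends to 0 and has
    small increments, so it is small.  Divided by [n (n + 1)] and by two consecutive values
    of [beta_norm], it is the increment of [e / beta_norm]; hence that quotient is bounded by
    a small multiple of [exp (4 sqrt n)].  This is the claim, since [beta_norm n] has the
    size of [n^(-3/4) exp (- 2 sqrt n)]. *)
Lemma a_asym :
  asym (fun n => a_seq n * (2 * (sqrt PI * sqrt (exp 1))) / (exp (2 * sqrt (INR n)) * weight n)) c.
Proof.
  set (k0 := sqrt PI * sqrt (exp 1)).
  assert (k0pos : 0 < k0) by (apply Rmult_lt_0_compat; apply sqrt_lt_R0; [apply PI_RGT_0|apply exp_pos]).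
  (* 6 = 1 + 4 - 1 + 2: one order is lost in the increments of the Casoratian and four in
     summing them; the increments of q gain one, and summing them loses two. *)
  apply asym_of_large. intros L. exists 6%nat.
  set (N := (L + 6)%nat). set (A := approx N 1).
  set (e := fun n => A n - 2 * k0 * a_seq n).
  set (U := fun n => casoratian A beta_norm n - 2).
  assert (EU : forall n, (0 < n)%nat -> casoratian e beta_norm n = U n).
  { intros n Hn. pose proof (casoratian_a n Hn) as CA. unfold U.
    replace (casoratian e beta_norm n) with
      (casoratian A beta_norm n - 2 * k0 * casoratian a_seq beta_norm n)
      by (unfold casoratian, e; ring).
    rewrite CA. fold k0. field. lra. }
  assert (BU : bigO U (L + 1)).
  { apply bigO_of_increments.
    - unfold U, A, N. replace (L + 6)%nat with (S (S (L + 4))) by lia. apply bigO_casoratian_limit.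
    - replace (L + 1 + 4)%nat with (L + 5)%nat by lia.
      apply (bigO_ext (fun n => casoratian A beta_norm (S n) - casoratian A beta_norm n)).
      + exists 0%nat. intros; unfold U; ring.
      + unfold A, N. replace (L + 6)%nat with (S (L + 5)) by lia. apply bigO_casoratian_increment. }
  set (q := fun n => e n / beta_norm n).
  assert (EX : forall x, exp (- x) * exp x = 1).
  { intros x. rewrite <- exp_plus, Rplus_opp_l. apply exp_0. }
  pose proof beta_ratio_pos as BP.
  assert (BP1 : eventually (fun n => 0 < beta_ratio (n + 1))).
  { destruct BP as [n0 BP]. exists n0. intros n Hn. apply BP. lia. }
  destruct (bigO_inv _ bigO_beta_ratio_1) as [BI _].
  assert (Bq : bigO (fun n => (q (S n) - q n) * exp (- (4 * sqrt (INR n)))) (L + 2)).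
  { apply (bigO_ext (fun n => (rsqrt n ^ 1 * U n) * (/ (1 + INR 1 * (1 * rsqrt n) ^ 2) *
      (/ shift_ratio 1 (-1 * rsqrt n) * (/ beta_ratio n * / beta_ratio (n + 1)))))).
    - eapply filter_imp; [|apply filter_and; [apply eventually_pos|apply filter_and; [apply BP|apply BP1]]].
      intros n [Hn [P0 P1]]. rewrite <- EU by auto.
      unfold q. replace (S n) with (n + 1)%nat by lia. unfold casoratian.
      rewrite (beta_norm_eq n), beta_norm_succ by auto.
      pose proof (shift_ratio_pos 1 (-1 * rsqrt n)) as PS.
      pose proof (exp_opposite_weight n Hn) as W. pose proof (INR_ep n Hn) as I.
      pose proof (rsqrt_bounds n Hn) as En. pose proof (weight_pos n Hn) as Pw.
      assert (W2 : exp (- (4 * sqrt (INR n))) = exp (2 * -1 * sqrt (INR n)) * exp (2 * -1 * sqrt (INR n))).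
      { rewrite <- exp_plus. f_equal. ring. }
      rewrite W2. pose proof (weight_sqr n Hn) as WS.
      pose proof (exp_pos (2 * -1 * sqrt (INR n))) as PE.
      set (E := exp (2 * -1 * sqrt (INR n))) in *.
      set (r := shift_ratio 1 (-1 * rsqrt n)) in *.
      set (b0 := beta_ratio n) in *. set (b1 := beta_ratio (n + 1)) in *.
      set (X := e (n + 1)%nat * (E * weight n * b0) - e n * (E * weight n * (r * b1))).
      transitivity (X / (weight n * weight n) / (r * b0 * b1)).
      + rewrite WS. simpl INR. rewrite Rmult_1_l, Rmult_1_l.
        assert (In : INR n = / rsqrt n ^ 2) 
          by (rewrite rsqrt_sqr, Rinv_inv by auto; reflexivity).
        rewrite In. field. repeat split; nra.
      + unfold X. field. repeat split; lra.
    - replace (L + 2)%nat with ((1 + (L + 1)) + (0 + (0 + (0 + 0))))%nat by lia.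
      apply bigO_mult; [apply bigO_mult; [apply bigO_pow|apply BU]|].
      apply bigO_mult; [|apply bigO_mult; [|apply bigO_mult]].
      + apply (bigO_smooth_bounded (fun x => / (1 + INR 1 * x ^ 2)) 1); auto.
        apply smooth_inv; [|apply smooth_shift_base]. intros x. apply Rgt_not_eq, shift_base_pos.
      + apply (bigO_smooth_bounded (fun x => / shift_ratio 1 x) (-1)); auto.
        apply smooth_inv; [|apply smooth_shift_ratio]. intros x. apply Rgt_not_eq, shift_ratio_pos.
      + exact BI.
      + apply (bigO_shift (fun n => / beta_ratio n) 0 1 BI). }
  apply bigO_of_growing_increments in Bq.
  pose proof (bigO_mult _ _ _ _ Bq bigO_beta_ratio) as B. rewrite Nat.add_0_r in B.
  apply (bigO_opp _ L) in B. revert B. apply bigO_ext.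
  eapply filter_imp; [|apply filter_and; [apply eventually_pos|apply BP]].
  intros n [Hn P0]. unfold q. rewrite beta_norm_eq by auto.
  pose proof (weight_pos n Hn) as Pw.
  change (psum (fun m => c m * rsqrt n ^ m) N) with (trunc N (rsqrt n)).
  unfold e, A, approx. rewrite Rmult_1_l.
  replace (2 * 1 * sqrt (INR n)) with (2 * sqrt (INR n)) by ring.
  replace (2 * -1 * sqrt (INR n)) with (- (2 * sqrt (INR n))) by ring.
  replace (exp (- (4 * sqrt (INR n)))) with (exp (- (2 * sqrt (INR n))) * exp (- (2 * sqrt (INR n))))
    by (rewrite <- exp_plus; f_equal; ring).
  rewrite exp_Ropp. pose proof (exp_pos (2 * sqrt (INR n))). field. repeat split; lra.
Qed.

Lemma rsqrt_Rpower n : (0 < n)%nat -> rsqrt n = Rpower (INR n) (- / 2).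
Proof.
  intros H. assert (P : 0 < INR n) by (apply lt_0_INR; auto).
  rewrite Rpower_Ropp, Rpower_sqrt; auto.
Qed.

Lemma rsqrt_pow_Rpower n m : (0 < n)%nat -> Rpower (INR n) (- (INR m / 2)) = rsqrt n ^ m.
Proof.
  intros H. rewrite rsqrt_Rpower by auto. rewrite <- Rpower_pow by (apply exp_pos).
  rewrite Rpower_mult. f_equal. field.
Qed.

Lemma weight_Rpower n : (0 < n)%nat -> Rpower (INR n) (3 / 4) = / weight n.
Proof.
  intros H. unfold weight. pose proof (rsqrt_bounds n H).
  rewrite <- Rpower_sqrt by lra. rewrite rsqrt_Rpower by auto.
  rewrite Rpower_mult, <- Rpower_plus, <- Rpower_Ropp. f_equal. field.
Qed.

Lemma poincare_sim_of_asym (u : nat -> C) (v g s : nat -> R) :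
  (forall n, (0 < n)%nat -> u n = RtoC (v n)) ->
  (forall n, (0 < n)%nat -> g n <> 0) ->
  asym (fun n => v n / g n) s -> poincare_sim u g s.
Proof.
  intros Hu Hg A N HN. destruct (A N) as [K [K0 H]]. exists K.
  eapply filter_imp; [|apply filter_and; [apply H|apply eventually_pos]].
  intros n [B Hn].
  rewrite Hu, <- RtoC_div, <- RtoC_minus, Cmod_R by auto.
  rewrite rsqrt_pow_Rpower by auto. rewrite sum_f_R0_psum.
  replace (S (N - 1)) with N by lia.
  rewrite (psum_ext _ (fun m => s m * rsqrt n ^ m)); auto.
  intros; rewrite rsqrt_pow_Rpower; auto.
Qed.

Theorem theorem5 :
  poincare_sim (C_maclaurin f0)
    (fun n => exp (2 * sqrt (INR n))
              / (2 * Rpower (INR n) (3 / 4) * sqrt (PI * exp 1)))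
    c
  /\
  poincare_sim (C_maclaurin f1)
    (fun n => - (sqrt (PI * exp 1)
                 / (Rpower (INR n) (3 / 4) * exp (2 * sqrt (INR n)))))
    (fun m => (-1) ^ m * c m).
Proof.
  assert (SQ : sqrt (PI * exp 1) = sqrt PI * sqrt (exp 1)).
  { apply sqrt_mult_alt. pose proof PI_RGT_0; lra. }
  rewrite SQ. pose proof (sqrt_lt_R0 _ PI_RGT_0) as SP. pose proof (sqrt_lt_R0 _ (exp_pos 1)) as SE.
  split.
  - apply (poincare_sim_of_asym _ a_seq).
    + intros n _. apply C_maclaurin_f0.
    + intros n Hn. rewrite weight_Rpower by auto. pose proof (weight_pos n Hn).
      apply Rgt_not_eq, Rdiv_lt_0_compat; [apply exp_pos|].
      repeat apply Rmult_lt_0_compat; try lra. apply Rinv_0_lt_compat; auto.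
    + intros N. pose proof (a_asym N) as B. revert B. apply bigO_ext.
      exists 1%nat. intros n Hn. rewrite weight_Rpower by lia. f_equal.
      pose proof (weight_pos n Hn). pose proof (exp_pos (2 * sqrt (INR n))). field. repeat split; lra.
  - apply (poincare_sim_of_asym _ (fun n => - beta n)).
    + intros n Hn. apply C_maclaurin_f1; auto.
    + intros n Hn. rewrite weight_Rpower by auto. pose proof (weight_pos n Hn).
      apply Rlt_not_eq. apply Ropp_lt_gt_0_contravar. apply Rdiv_lt_0_compat.
      * apply Rmult_lt_0_compat; auto.
      * apply Rmult_lt_0_compat; [apply Rinv_0_lt_compat; auto|apply exp_pos].
    + intros N. pose proof (beta_asym N) as B. revert B. apply bigO_ext.
      exists 1%nat. intros n Hn. rewrite weight_Rpower by lia. f_equal.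
      pose proof (weight_pos n Hn) as W. pose proof (exp_pos (2 * sqrt (INR n))) as E.
      unfold scale. fold (weight n). rewrite exp_Ropp. field. repeat split; lra.
Qed.
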